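(* Let $\alpha>-\frac12$. Then for all $x,y\in\mathbb{R}$ and all $\lambda\in\mathbb{C}$, $$G_\lambda^{(\alpha,\alpha)}(x)\,G_\lambda^{(\alpha,\alpha)}(y)=\int_{-\infty}^{+\infty}G_\lambda^{(\alpha,\alpha)}(z)\,d\mu_{x,y}^{(\alpha,\alpha)}(z),$$ where $$d\mu_{x,y}^{(\alpha,\alpha)}(z)=\begin{cases}\mathcal{K}_{\alpha,\alpha}(x,y,z)\,A_{\alpha,\alpha}(|z|)\,dz&\text{if }xy\neq0,\\ d\delta_x(z)&\text{if }y=0,\\ d\delta_y(z)&\text{if }x=0.\end{cases}$$
   Context: For parameters $a\ge b>-\frac12$ and $\lambda\in\mathbb{C}$, $x\in\mathbb{R}$, the Jacobi function is $\varphi_\lambda^{(a,b)}(x)={}_2F_1\bigl(\frac{a+b+1+i\lambda}2,\frac{a+b+1-i\lambda}2;a+1;-\sinh^2x\bigr)$, with ${}_2F_1$ the Gauss hypergeometric function (analytically continued to $(-\infty,0]$). The Opdam function for $\alpha=\beta$ (so $\rho=2\alpha+1$) is $$G_\lambda^{(\alpha,\alpha)}(x)=\varphi_\lambda^{(\alpha,\alpha)}(x)+\frac{2\alpha+1+i\lambda}{4(\alpha+1)}\sinh(2x)\,\varphi_\lambda^{(\alpha+1,\alpha+1)}(x).$$ $A_{\alpha,\alpha}(z)=(\sinh z\cosh z)^{2\alpha+1}$ for $z\ge0$. $\delta_x$ is the Dirac mass at $x$. $M_{\alpha,\alpha}=\dfrac{\Gamma(\alpha+1)}{\sqrt\pi\,\Gamma(\alpha+\frac12)}$.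 For $x,y,z\in\mathbb{R}\setminus\{0\}$ with $\bigl||x|-|y|\bigr|<|z|<|x|+|y|$, $$\mathcal{K}_{\alpha,\alpha}(x,y,z)=2^{4\alpha+2}M_{\alpha,\alpha}\,e^{x+y-z}\,\frac{\bigl[\sinh(x+y+z)\sinh(-x+y+z)\sinh(x-y+z)\sinh(x+y-z)\bigr]^{\alpha-\frac12}}{|\sinh2x\,\sinh2y\,\sinh2z|^{2\alpha}}\cdot\frac{\sinh(x+y+z)\sinh(-x+y+z)\sinh(x-y+z)}{\sinh2x\,\sinh2y\,\sinh2z},$$ and $\mathcal{K}_{\alpha,\alpha}(x,y,z)=0$ otherwise. *)

(* Defs.v *)
From HB Require Import structures.
From mathcomp Require Import all_boot all_order all_algebra.
From mathcomp Require Import complex.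
From mathcomp Require Import all_classical all_reals all_analysis.
Set Implicit Arguments.
Unset Strict Implicit.
Unset Printing Implicit Defensive.
Import Order.TTheory GRing.Theory Num.Theory.
Import numFieldNormedType.Exports.
Local Open Scope classical_set_scope.
Local Open Scope ring_scope.
Local Open Scope complex_scope.

Section Hyperbolic.
Variable R : realType.

Definition sinh (x : R) : R := (expR x - expR (- x)) / 2.
Definition cosh (x : R) : R := (expR x + expR (- x)) / 2.

(* Euler's integral; only meaningful for s > 0. *)
Definition Gamma (s : R) : R :=
  \int[lebesgue_measure]_(t in `]0, +oo[) (t `^ (s - 1) * expR (- t)).

End Hyperbolic.

Section Hypergeometric.
Variable R : realType.

(* The alias R[i]^o carries the topology given by the modulus. *)
Definition pseries_sum (u : nat -> R[i]) (x : R) (w : R[i]) : Prop :=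
  series (fun n => u n * x%:C ^+ n : R[i]^o) @ \oo --> (w : R[i]^o).

Definition real_analytic_at (f : R -> R[i]) (x0 : R) : Prop :=
  exists u : nat -> R[i], \forall x \near x0, pseries_sum u (x - x0) (f x).

Definition pochhammer (a : R[i]) (n : nat) : R[i] := \prod_(k < n) (a + k%:R).

Definition gauss_coef (a b c : R[i]) (n : nat) : R[i] :=
  pochhammer a n * pochhammer b n / (pochhammer c n * n`!%:R).

(* The values of f on [1, +oo[ are unconstrained. *)
Definition gauss_continuation (a b c : R[i]) (f : R -> R[i]) : Prop :=
  (forall x : R, `|x| < 1 -> pseries_sum (gauss_coef a b c) x (f x)) /\
  (forall x : R, x < 1 -> real_analytic_at f x).

(* The value at x < 1 of the analytic continuation of the Gauss series along
   the real line. The set below is then a singleton when c is not a nonpositive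
   integer: uniqueness is the identity theorem, existence is Pfaff's formula
   (1 - x)^-a 2F1(a, c - b; c; x / (x - 1)) for x < 1/2. *)
Definition hyp2F1 (a b c : R[i]) (x : R) : R[i] :=
  xget 0 [set w | exists2 f, gauss_continuation a b c f & f x = w].

End Hypergeometric.

Section Opdam.
Variable R : realType.

Definition jacobi_fun (a b : R) (lambda : R[i]) (x : R) : R[i] :=
  hyp2F1 (((a + b + 1)%:C + 'i * lambda) / 2)
         (((a + b + 1)%:C - 'i * lambda) / 2)
         (a + 1)%:C
         (- sinh x ^+ 2).

Definition opdam_fun (alpha : R) (lambda : R[i]) (x : R) : R[i] :=
  jacobi_fun alpha alpha lambda x +
  ((2 * alpha + 1)%:C + 'i * lambda) / (4 * (alpha + 1))%:C *
  (sinh (2 * x))%:C * jacobi_fun (alpha + 1) (alpha + 1) lambda x.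

Definition opdam_weight (alpha z : R) : R :=
  (sinh z * cosh z) `^ (2 * alpha + 1).

Definition opdam_const (alpha : R) : R :=
  Gamma (alpha + 1) / (Num.sqrt pi * Gamma (alpha + 2^-1)).

Definition opdam_kernel (alpha x y z : R) : R :=
  if [&& x != 0, y != 0, z != 0,
         `| `|x| - `|y| | < `|z| & `|z| < `|x| + `|y|]
  then
    2 `^ (4 * alpha + 2) * opdam_const alpha * expR (x + y - z) *
    ((sinh (x + y + z) * sinh (- x + y + z) *
      sinh (x - y + z) * sinh (x + y - z)) `^ (alpha - 2^-1) /
     `|sinh (2 * x) * sinh (2 * y) * sinh (2 * z)| `^ (2 * alpha)) *
    (sinh (x + y + z) * sinh (- x + y + z) * sinh (x - y + z) /
     (sinh (2 * x) * sinh (2 * y) * sinh (2 * z)))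
  else 0.

End Opdam.

Section ComplexIntegral.
Context d (T : measurableType d) (R : realType).
Variable mu : {measure set T -> \bar R}.

Definition cintegrable (f : T -> R[i]) : Prop :=
  mu.-integrable setT (fun t => (complex.Re (f t))%:E) /\
  mu.-integrable setT (fun t => (complex.Im (f t))%:E).

Definition cintegral (f : T -> R[i]) : R[i] :=
  (\int[mu]_(t in setT) complex.Re (f t)) +i*
  (\int[mu]_(t in setT) complex.Im (f t)).

End ComplexIntegral.

Section OpdamMeasure.
Variable R : realType.

Definition opdam_density (alpha x y z : R) : R :=
  opdam_kernel alpha x y z * opdam_weight alpha `|z|.

(* The measure mu_{x,y} is signed in general, so it is given through its
   integral: f is integrated against K A dz as f K A against Lebesgue measure. *)
Definition opdam_mu_integrable (alpha x y : R) (f : R -> R[i]) : Prop :=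
  if x * y != 0 then
    cintegrable lebesgue_measure (fun z => f z * (opdam_density alpha x y z)%:C)
  else if y == 0 then cintegrable (dirac (x : measurableTypeR R)) f
  else cintegrable (dirac (y : measurableTypeR R)) f.

Definition opdam_mu_integral (alpha x y : R) (f : R -> R[i]) : R[i] :=
  if x * y != 0 then
    cintegral lebesgue_measure (fun z => f z * (opdam_density alpha x y z)%:C)
  else if y == 0 then cintegral (dirac (x : measurableTypeR R)) f
  else cintegral (dirac (y : measurableTypeR R)) f.

End OpdamMeasure.

(* Main.v *)
(* Write X = 2x, Y = 2y and P_0(v) = 2F1(a, b; alpha + 1; (1 - v) / 2), P_1 for
   the same function with all three parameters raised by one, where
   a, b = (2 alpha + 1 +- i lambda) / 2. Then G(x) = P_0(ch X) + k sh X P_1(ch X),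
   and as functions of X the pair (P_0(ch X), sh X P_1(ch X)) solves a first-order
   system with a regular singularity at 0, whose solution is unique by an energy
   estimate. Both
     int P_0(V) w  and  int d_X V P_1(V) w,   V = ch X ch Y + sh X sh Y s,
   with w = (1 - s^2)^(alpha - 1/2) on ]-1, 1[, solve the same system in X (by
   differentiation under the integral and an integration by parts in s), hence
   equal n P_0(ch X) P_0(ch Y) and n sh X P_1(ch X) P_0(ch Y) with n = int w;
   together with the first identity at alpha + 1 they give
     G(x) G(y) = M int (1 + s) (P_0(V) + k (e^(X + Y) - V) P_1(V)) w(s) ds.
   Substituting V = ch 2z turns this into an integral over
   ||x| - |y|| < z < |x| + |y|, whose integrand is the sum of the values at z and
   -z of G times the density.
   The analytic continuation defining 2F1 is reached by gluing the Gauss series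
   and Pfaff's formula, which agree by uniqueness for the system; the glued
   function is analytic since at each regular point the system has a power
   series solution. *)

Require Import Defs.
From HB Require Import structures.
From mathcomp Require Import all_boot all_order all_algebra.
From mathcomp Require Import complex.
From mathcomp Require Import all_classical all_reals all_analysis.
From mathcomp Require Import measurable_realfun ring lra.
Set Implicit Arguments.
Unset Strict Implicit.
Unset Printing Implicit Defensive.
Import Order.TTheory GRing.Theory Num.Theory.
Import numFieldNormedType.Exports.
Local Open Scope classical_set_scope.
Local Open Scope ring_scope.
Local Open Scope complex_scope.

(** * Complex-valued functions of a real variable *)

(** The condition alpha > -1/2 enters twice. With c = alpha + 1, the singular term of the system at
    X = 0 has coefficient 2c - 1 > 0, the sign that lets an energy estimate discard it; and the
    weight has exponent alpha - 1/2 > -1, so it is integrable and boundary terms vanish. The Opdam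
    formula rests on (1 + s)(e^(X + Y) - V) = d_X V + d_Y V + sh X sh Y (1 - s^2). The first two
    terms give the mixed products of P_0 and P_1. The last one raises the exponent of the weight by
    one, which is why the identity at alpha + 1 appears; int s P_0(V) w takes the same form by
    parts. With k = a / (2c) and a + b = 2 alpha + 1 the coefficients of P_1(ch X) P_1(ch Y) add up
    to k^2, as the product requires. On the integration side the weight may blow up at both ends,
    and when |x| = |y| the support reaches z = 0, where 1 / sh 2z blows up and the substitution is
    critical. Hence substitutions on open intervals by exhaustion, and a bound on the density that
    compensates the pole. *)

Section ComplexDerivative.
Variable R : realType.
Implicit Types (f g : R -> R[i]) (x : R).

(** Differentiability is stated componentwise, so that the real rules of derivation, the mean value
    theorem and real integration apply directly. *)
Definition cder f x (l : R[i]) : Prop :=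
  is_derive x (1 : R) (fun t => complex.Re (f t)) (complex.Re l) /\
  is_derive x (1 : R) (fun t => complex.Im (f t)) (complex.Im l).

Lemma cReM (z w : R[i]) :
  complex.Re (z * w) = complex.Re z * complex.Re w - complex.Im z * complex.Im w.
Proof. by case: z => a b; case: w. Qed.

Lemma cImM (z w : R[i]) :
  complex.Im (z * w) = complex.Re z * complex.Im w + complex.Im z * complex.Re w.
Proof. by case: z => a b; case: w. Qed.

Lemma cReD (z w : R[i]) : complex.Re (z + w) = complex.Re z + complex.Re w.
Proof. by case: z => a b; case: w. Qed.

Lemma cImD (z w : R[i]) : complex.Im (z + w) = complex.Im z + complex.Im w.
Proof. by case: z => a b; case: w. Qed.

Lemma cReN (z : R[i]) : complex.Re (- z) = - complex.Re z.
Proof. by case: z. Qed.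

Lemma cImN (z : R[i]) : complex.Im (- z) = - complex.Im z.
Proof. by case: z. Qed.

Lemma complex_ext (z w : R[i]) :
  complex.Re z = complex.Re w -> complex.Im z = complex.Im w -> z = w.
Proof. by case: z => a b; case: w => c d /= -> ->. Qed.

Lemma is_derive_ext (h k : R -> R) x l l' : h = k -> l = l' ->
  is_derive x (1 : R) h l -> is_derive x (1 : R) k l'.
Proof. by move=> -> ->. Qed.

Lemma is_derive_comp1 (h k : R -> R) x l l' :
  is_derive (k x) (1 : R) h l -> is_derive x (1 : R) k l' ->
  is_derive x (1 : R) (fun t => h (k t)) (l * l').
Proof. by move=> dh dk; apply: is_derive_ext (is_derive1_comp dh dk). Qed.

Lemma cder_cst (z : R[i]) x : cder (fun=> z) x 0.
Proof. by split; apply: is_derive_cst. Qed.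

Lemma cderD f g x l m :
  cder f x l -> cder g x m -> cder (fun t => f t + g t) x (l + m).
Proof.
move=> [fr fi] [gr gi]; split.
- apply: is_derive_ext (is_deriveD fr gr); last by rewrite cReD.
  by apply/funext => t; rewrite fctE cReD.
- apply: is_derive_ext (is_deriveD fi gi); last by rewrite cImD.
  by apply/funext => t; rewrite fctE cImD.
Qed.

Lemma cderM f g x l m :
  cder f x l -> cder g x m -> cder (fun t => f t * g t) x (l * g x + f x * m).
Proof.
move=> [fr fi] [gr gi]; split.
- apply: is_derive_ext (is_deriveB (is_deriveM fr gr) (is_deriveM fi gi)).
    by apply/funext => t; rewrite !fctE cReM.
  by rewrite cReD !cReM /GRing.scale /=; ring.
- apply: is_derive_ext (is_deriveD (is_deriveM fr gi) (is_deriveM fi gr)).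
    by apply/funext => t; rewrite !fctE cImM.
  by rewrite cImD !cImM /GRing.scale /=; ring.
Qed.

Lemma cderZ (z : R[i]) f x l : cder f x l -> cder (fun t => z * f t) x (z * l).
Proof. by move=> /(cderM (cder_cst z x)); rewrite mul0r add0r. Qed.

Lemma cderN f x l : cder f x l -> cder (fun t => - f t) x (- l).
Proof.
move=> /(cderZ (-1)); rewrite mulN1r; congr (cder _ _ _).
by apply/funext => t; rewrite mulN1r.
Qed.

Lemma cderB f g x l m :
  cder f x l -> cder g x m -> cder (fun t => f t - g t) x (l - m).
Proof. by move=> fl /cderN; apply: cderD. Qed.

Lemma cder_real (h : R -> R) x (l : R) :
  is_derive x (1 : R) h l -> cder (fun t => (h t)%:C) x l%:C.
Proof. by move=> hl; split => //=; apply: is_derive_cst. Qed.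

Lemma cder_comp f (h : R -> R) x l (k : R) :
  cder f (h x) l -> is_derive x (1 : R) h k ->
  cder (fun t => f (h t)) x (k%:C * l).
Proof.
move=> [fr fi] hk; split.
- by apply: is_derive_ext (is_derive1_comp fr hk) => //=; rewrite cReM/=; ring.
- by apply: is_derive_ext (is_derive1_comp fi hk) => //=; rewrite cImM/=; ring.
Qed.

Lemma near_is_derive (h k : R -> R) x l :
  (\forall y \near x, h y = k y) -> is_derive x (1 : R) h l ->
  is_derive x (1 : R) k l.
Proof.
move=> hk hl; by apply: near_eq_is_derive hl; rewrite ?oner_eq0.
Qed.

Lemma near_cder f g x l :
  (\forall y \near x, f y = g y) -> cder f x l -> cder g x l.
Proof.
move=> fg [fr fi]; split.
- by apply: near_is_derive fr; near=> y; congr complex.Re; near: y.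
- by apply: near_is_derive fi; near=> y; congr complex.Im; near: y.
Unshelve. all: end_near. Qed.

Lemma is_derive_continuous (h : R -> R) x l :
  is_derive x (1 : R) h l -> {for x, continuous h}.
Proof. by move=> d; apply: differentiable_continuous; apply/derivable1_diffP; exact: ex_derive. Qed.

Lemma cder_continuous f x l : cder f x l ->
  {for x, continuous (fun t => complex.Re (f t))} /\
  {for x, continuous (fun t => complex.Im (f t))}.
Proof.
by move=> [fr fi]; split; [exact: is_derive_continuous fr|exact: is_derive_continuous fi].
Qed.

(** Real-valued and, unlike the modulus, differentiable at 0 as well: hence usable as an energy. *)
Definition sqn (z : R[i]) : R := complex.Re z ^+ 2 + complex.Im z ^+ 2.

Lemma sqn_ge0 z : 0 <= sqn z.
Proof. by rewrite addr_ge0// sqr_ge0. Qed.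

Lemma sqn_eq0 z : sqn z <= 0 -> z = 0.
Proof.
rewrite /sqn => h; have := sqr_ge0 (complex.Re z).
have := sqr_ge0 (complex.Im z) => hi hr.
by apply: complex_ext => /=; apply/eqP; rewrite -sqrf_eq0 eq_le; apply/andP; split; lra.
Qed.

Lemma is_derive_sqn f x l : cder f x l ->
  is_derive x (1 : R) (fun t => sqn (f t))
    (2 * (complex.Re (f x) * complex.Re l + complex.Im (f x) * complex.Im l)).
Proof.
move=> [fr fi].
apply: is_derive_ext (is_deriveD (is_deriveM fr fr) (is_deriveM fi fi)).
  by apply/funext => t; rewrite !fctE /sqn !expr2.
by rewrite /GRing.scale /=; ring.
Qed.

End ComplexDerivative.

(** * Gronwall's inequality *)

Section Gronwall.
Variable R : realType.

(** The function [expR (- K * x) * E x] is nonincreasing. Nothing but continuity is asked at the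
    endpoints, since one of the systems to be treated is singular at the left one. *)
Lemma gronwall_right (E E' : R -> R) (K a b : R) :
  a < b -> {within `[a, b], continuous E} ->
  (forall x, a < x < b -> is_derive x (1 : R) E (E' x)) ->
  (forall x, a < x < b -> E' x <= K * E x) ->
  E a <= 0 -> E b <= 0.
Proof.
move=> ab cE dE leE Ea.
pose h x := expR (- K * x) * E x.
have de x : is_derive x (1 : R) (fun t => expR (- K * t)) (- K * expR (- K * x)).
  have d1 : is_derive x (1 : R) (fun t => - K * t) (- K).
    by apply: is_derive_ext (is_deriveZ (- K) (is_derive_id x 1));
      rewrite /GRing.scale/= ?mulr1.
  by apply: is_derive_ext (is_derive1_comp (is_derive_expR _) d1) => //; rewrite mulrC.
have dh x : a < x < b ->
    is_derive x (1 : R) h (expR (- K * x) * (E' x - K * E x)).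
  move=> axb; apply: is_derive_ext (is_deriveM (de x) (dE x axb)) => //.
  by rewrite /GRing.scale/=; ring.
have ch : {within `[a, b], continuous h}.
  move=> x; apply: cvgM; last exact: cE.
  apply: continuous_subspaceT x => y.
  apply: differentiable_continuous; apply/derivable1_diffP.
  by apply: ex_derive.
have [x + hE] := MVT ab (fun x xab => dh x xab) ch.
rewrite in_itv/= => axb.
have : h b <= h a.
  rewrite -subr_le0 hE; apply: mulr_le0_ge0; last by rewrite subr_ge0 ltW.
  by rewrite mulr_ge0_le0 ?expR_ge0// subr_le0 leE.
have hb : expR (- K * a) * E a <= 0 by rewrite mulr_ge0_le0// expR_ge0.
move=> /le_trans/(_ hb); rewrite /h pmulr_rle0 ?expR_gt0//.
Qed.

End Gronwall.

(** * Power series *)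

Section PowerSeries.
Variable R : realType.

Section RealSeries.
Implicit Types (c : nat -> R) (rho x : R).

(** Encodes a radius of convergence at least [rho^-1] as a coefficient bound, which is what
    recursions deliver. *)
Definition geo_bounded c rho := exists A : R, forall n, `|c n| <= A * rho ^+ n.

Lemma geo_bounded_cvg c rho x : 0 < rho -> geo_bounded c rho ->
  rho * `|x| < 1 -> cvgn (pseries c x).
Proof.
move=> rho0 [A cA] rx; apply: normed_cvg.
have A0 : 0 <= A by have := cA 0; rewrite expr0 mulr1; apply: le_trans.
have H1 n : 0 <= geometric A (rho * `|x|) n.
  by rewrite /geometric /= mulr_ge0// exprn_ge0// mulr_ge0// ltW.
have H2 n : `|c n * x ^+ n| <= geometric A (rho * `|x|) n.
  by rewrite normrM normrX /geometric /= exprMn mulrA ler_wpM2r// exprn_ge0.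
apply: series_le_cvg H1 H2 _ => //.
by apply: is_cvg_geometric_series; rewrite ger0_norm// mulr_ge0// ltW.
Qed.

(** Any larger ratio absorbs the factor [n.+1]: by Bernoulli [(rho' / rho) ^+ n] is at least
    [1 + n * d], and [n + 1 <= (1 + d^-1) * (1 + n * d)]. *)
Lemma geo_bounded_diffs c rho rho' : 0 < rho -> rho < rho' ->
  geo_bounded c rho -> geo_bounded (pseries_diffs c) rho'.
Proof.
move=> rho0 rr' [A cA].
have r'0 : 0 < rho' by apply: lt_trans rr'.
have A0 : 0 <= A by have := cA 0; rewrite expr0 mulr1; apply: le_trans.
pose d := rho' / rho - 1.
have d0 : 0 < d by rewrite subr_gt0 ltr_pdivlMr// mul1r.
have bern n : 1 + n%:R * d <= (rho' / rho) ^+ n.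
  have -> : rho' / rho = 1 + d by rewrite /d; ring.
  elim: n => [|n ih]; first by rewrite mul0r addr0 expr0.
  rewrite exprS; apply: le_trans (ler_wpM2l _ ih); last by rewrite addr_ge0// ltW.
  rewrite -natr1 -subr_ge0.
  have -> : (1 + d) * (1 + n%:R * d) - (1 + (n%:R + 1) * d) = n%:R * d ^+ 2 by ring.
  by rewrite mulr_ge0// sqr_ge0.
exists (A * rho * (1 + d^-1)) => n.
rewrite /pseries_diffs normrM ger0_norm//.
apply: le_trans (ler_wpM2l _ (cA n.+1)) _ => //.
have -> : rho' ^+ n = (rho' / rho) ^+ n * rho ^+ n.
  by rewrite exprMn -mulrA -exprMn mulVf ?expr1n ?mulr1// gt_eqF.
have h : n.+1%:R <= (1 + d^-1) * (rho' / rho) ^+ n.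
  apply: le_trans (ler_wpM2l _ (bern n)); last by rewrite addr_ge0// invr_ge0 ltW.
  rewrite -natr1 -subr_ge0.
  have -> : (1 + d^-1) * (1 + n%:R * d) - (n%:R + 1) = d^-1 + n%:R * d.
    by field; rewrite gt_eqF.
  by rewrite addr_ge0// ?mulr_ge0// ?invr_ge0 ltW.
rewrite exprS.
have -> : n.+1%:R * (A * (rho * rho ^+ n)) = A * rho * rho ^+ n * n.+1%:R by ring.
have -> : A * rho * (1 + d^-1) * ((rho' / rho) ^+ n * rho ^+ n) =
          A * rho * rho ^+ n * ((1 + d^-1) * (rho' / rho) ^+ n) by ring.
by apply: ler_wpM2l h; rewrite !mulr_ge0// ?exprn_ge0// ltW.
Qed.

(** Termwise differentiation asks the series and its first two formal derivatives to converge at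
    some [K] beyond [|x|]. Each formal derivative costs a slightly larger ratio, hence
    [rho < r1 < r2] with [r2 * K < 1]. *)
Lemma geo_bounded_derive c rho x : 0 < rho -> geo_bounded c rho ->
  rho * `|x| < 1 ->
  is_derive x (1 : R) (fun x => limn (pseries c x)) (limn (pseries (pseries_diffs c) x)).
Proof.
move=> rho0 gc rx.
have [K [xK K0 rK]] : exists K : R, [/\ `|x| < K, 0 < K & rho * K < 1].
  exists ((`|x| + rho^-1) / 2).
  have xr : `|x| < rho^-1 by rewrite -[rho^-1]mul1r ltr_pdivlMr// mulrC.
  have r0 : 0 < rho^-1 by rewrite invr_gt0.
  split; [lra|have := normr_ge0 x; lra|].
  rewrite -ltr_pdivlMl// mulr1; lra.
have [r1 [rr1 r1K]] : exists r1, rho < r1 /\ r1 * K < 1.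
  exists ((rho + K^-1) / 2).
  have : rho < K^-1 by rewrite -[K^-1]mul1r ltr_pdivlMr.
  split; first lra.
  rewrite -ltr_pdivlMr// mul1r; lra.
have [r2 [rr2 r2K]] : exists r2, r1 < r2 /\ r2 * K < 1.
  exists ((r1 + K^-1) / 2).
  have : r1 < K^-1 by rewrite -[K^-1]mul1r ltr_pdivlMr.
  split; first lra.
  rewrite -ltr_pdivlMr// mul1r; lra.
have r10 : 0 < r1 by apply: lt_trans rr1.
have nK : `|K| = K by rewrite gtr0_norm.
have g1 := geo_bounded_diffs rho0 rr1 gc.
have g2 := geo_bounded_diffs r10 rr2 g1.
apply: (@pseries_snd_diffs _ c K).
- by apply: geo_bounded_cvg gc _ => //; rewrite nK.
- by apply: geo_bounded_cvg g1 _ => //; rewrite nK.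
- by apply: geo_bounded_cvg g2 _; rewrite ?nK// (lt_trans r10).
- by rewrite nK.
Qed.

End RealSeries.

Implicit Types (u : nat -> R[i]) (x rho : R).

(** A norm equivalent to the modulus, with values in the reals, submultiplicative and free of square
    roots. *)
Definition cnorm1 (z : R[i]) : R := `|complex.Re z| + `|complex.Im z|.

Lemma cnorm1_ge0 z : 0 <= cnorm1 z.
Proof. by rewrite addr_ge0. Qed.

Lemma cnorm1M z w : cnorm1 (z * w) <= cnorm1 z * cnorm1 w.
Proof.
rewrite /cnorm1 cReM cImM.
apply: le_trans (lerD (ler_normB _ _) (ler_normD _ _)) _.
by rewrite !normrM le_eqVlt; apply/orP; left; apply/eqP; ring.
Qed.

Lemma cnorm1D z w : cnorm1 (z + w) <= cnorm1 z + cnorm1 w.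
Proof.
rewrite /cnorm1 cReD cImD.
apply: le_trans (lerD (ler_normD _ _) (ler_normD _ _)) _.
by rewrite le_eqVlt; apply/orP; left; apply/eqP; ring.
Qed.

Lemma cnorm1_real (r : R) : cnorm1 r%:C = `|r|.
Proof. by rewrite /cnorm1 /= normr0 addr0. Qed.

Lemma cnorm1N z : cnorm1 (- z) = cnorm1 z.
Proof. by rewrite /cnorm1 cReN cImN !normrN. Qed.

Lemma norm_le_cnorm1 (z : R[i]) : `|z| <= (cnorm1 z)%:C.
Proof.
rewrite normc_def lecR /cnorm1.
rewrite -[leRHS]ger0_norm ?addr_ge0// -sqrtr_sqr ler_wsqrtr//.
rewrite sqrrD !real_normK ?num_real// -addrA lerD2l -[leLHS]add0r lerD//.
Qed.

Lemma norm_ge_Re (z : R[i]) : (`|complex.Re z|)%:C <= `|z|.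
Proof. exact: normc_ge_Re. Qed.

Lemma norm_ge_Im (z : R[i]) : (`|complex.Im z|)%:C <= `|z|.
Proof.
rewrite normc_def lecR -sqrtr_sqr ler_wsqrtr//.
by rewrite lerDr sqr_ge0.
Qed.

(** Links the modulus topology in which the Gauss series is defined with componentwise limits, by
    [|Re z|, |Im z| <= |z| <= |Re z| + |Im z|]. *)
Lemma cvg_complexP (s : nat -> R[i]) (w : R[i]) :
  ((s : nat -> R[i]^o) @ \oo --> (w : R[i]^o)) <->
  ((fun n => complex.Re (s n)) @ \oo --> complex.Re w /\
   (fun n => complex.Im (s n)) @ \oo --> complex.Im w).
Proof.
split.
  move=> /cvgrPdist_lt sw; split; apply/cvgrPdist_lt => e e0.
    have := sw e%:C; rewrite ltcR => /(_ e0) [N _ H].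
    exists N => // n /H /= {}H; rewrite -ltcR; apply: le_lt_trans H.
    by rewrite -cReN -cReD; exact: norm_ge_Re.
  have := sw e%:C; rewrite ltcR => /(_ e0) [N _ H].
  exists N => // n /H /= {}H; rewrite -ltcR; apply: le_lt_trans H.
  by rewrite -cImN -cImD; exact: norm_ge_Im.
move=> [/cvgrPdist_lt sr /cvgrPdist_lt si]; apply/cvgrPdist_lt => e e0.
have [e' ee' e'0] : exists2 e' : R, e = e'%:C & 0 < e'.
  exists (complex.Re e); last by move: e0; rewrite ltcE => /andP[].
  by apply/esym/RRe_real; exact: gtr0_real.
have e2 : 0 < e' / 2 by rewrite divr_gt0.
have [N _ HN] := sr _ e2; have [M _ HM] := si _ e2.
exists (maxn N M) => // n /=; rewrite geq_max => /andP[/HN /= h1 /HM /= h2].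
rewrite ee'; apply: le_lt_trans (norm_le_cnorm1 _) _.
rewrite ltcR /cnorm1 cReD cReN cImD cImN; lra.
Qed.

Definition re_seq u n := complex.Re (u n).
Definition im_seq u n := complex.Im (u n).

Definition is_csum u x (w : R[i]) :=
  pseries (re_seq u) x @ \oo --> complex.Re w /\
  pseries (im_seq u) x @ \oo --> complex.Im w.

Lemma pseries_sumP u x w : pseries_sum u x w <-> is_csum u x w.
Proof.
rewrite /pseries_sum cvg_complexP /is_csum.
have hr n : complex.Re (series (fun n => u n * x%:C ^+ n) n) = pseries (re_seq u) x n.
  rewrite /pseries /series /= (big_morph _ (@cReD R) (erefl : complex.Re 0 = 0)).
  by apply: eq_bigr => i _; rewrite -rmorphXn/= cReM /= mulr0 subr0.
have hi n : complex.Im (series (fun n => u n * x%:C ^+ n) n) = pseries (im_seq u) x n.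
  rewrite /pseries /series /= (big_morph _ (@cImD R) (erefl : complex.Im 0 = 0)).
  by apply: eq_bigr => i _; rewrite -rmorphXn/= cImM /= mulr0 add0r.
by rewrite (funext hr) (funext hi).
Qed.

Lemma is_csum_unique u x w w' : is_csum u x w -> is_csum u x w' -> w = w'.
Proof.
by move=> [a b] [c d]; apply: complex_ext;
  [apply: cvg_unique a c|apply: cvg_unique b d].
Qed.

Lemma is_csum0 u : is_csum u 0 (u 0%N).
Proof.
have h (c : nat -> R) : pseries c 0 @ \oo --> c 0%N.
  apply: cvg_near_cst; exists 1%N => // n /= n0.
  rewrite /pseries /series /= big_ltn// expr0 mulr1 big_nat big1 ?addr0//.
  by move=> i /andP[i0 _]; rewrite expr0n gtn_eqF// mulr0.
by split; apply: h.
Qed.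

Lemma is_csumD u v x w z : is_csum u x w -> is_csum v x z ->
  is_csum (fun n => u n + v n) x (w + z).
Proof.
move=> [ur ui] [vr vi]; split.
- rewrite cReD; have -> : pseries (re_seq (fun n => u n + v n)) x =
      pseries (re_seq u) x \+ pseries (re_seq v) x.
    apply/funext => n; rewrite /pseries /series /= -big_split/=.
    by apply: eq_bigr => i _; rewrite /re_seq cReD mulrDl.
  exact: cvgD.
- rewrite cImD; have -> : pseries (im_seq (fun n => u n + v n)) x =
      pseries (im_seq u) x \+ pseries (im_seq v) x.
    apply/funext => n; rewrite /pseries /series /= -big_split/=.
    by apply: eq_bigr => i _; rewrite /im_seq cImD mulrDl.
  exact: cvgD.
Qed.

Lemma is_csumZ u x w (z : R[i]) : is_csum u x w ->
  is_csum (fun n => z * u n) x (z * w).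
Proof.
move=> [ur ui]; split.
- rewrite cReM; have -> : pseries (re_seq (fun n => z * u n)) x =
      (fun n => complex.Re z * pseries (re_seq u) x n
                - complex.Im z * pseries (im_seq u) x n).
    apply/funext => n; rewrite /pseries /series /= !mulr_sumr -sumrB.
    by apply: eq_bigr => i _; rewrite /re_seq /im_seq cReM; ring.
  by apply: cvgB; apply: cvgMl_tmp.
- rewrite cImM; have -> : pseries (im_seq (fun n => z * u n)) x =
      (fun n => complex.Re z * pseries (im_seq u) x n
                + complex.Im z * pseries (re_seq u) x n).
    apply/funext => n; rewrite /pseries /series /= !mulr_sumr -big_split/=.
    by apply: eq_bigr => i _; rewrite /re_seq /im_seq cImM; ring.
  by apply: cvgD; apply: cvgMl_tmp.
Qed.

(** Coefficients of the series multiplied by its variable. With it a differential equation becomes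
    an identity between sequences. *)
Definition shift_seq u n := if n is k.+1 then u k else 0.

Lemma is_csumX u x w : is_csum u x w -> is_csum (shift_seq u) x (x%:C * w).
Proof.
move=> [ur ui].
have h (c d : nat -> R) l : d 0%N = 0 -> (forall n, d n.+1 = c n) ->
    pseries c x @ \oo --> l -> pseries d x @ \oo --> x * l.
  move=> d0 dc cl; rewrite -(cvg_shiftS (pseries d x)).
  have -> : (fun n => pseries d x n.+1) = (fun n => x * pseries c x n).
    apply/funext => n; rewrite /pseries /series /= big_nat_recl// d0 mul0r add0r.
    by rewrite mulr_sumr; apply: eq_bigr => i _; rewrite dc exprS; ring.
  exact: cvgMl_tmp.
split; rewrite ?cReM ?cImM /= mul0r ?subr0 ?addr0.
- by apply: h ur.
- by apply: h ui.
Qed.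

Definition csum u x : R[i] :=
  limn (pseries (re_seq u) x) +i* limn (pseries (im_seq u) x).

Lemma csum0 u : csum u 0 = u 0%N.
Proof.
have [hr hi] := is_csum0 u.
by apply: complex_ext; [exact: cvg_lim hr|exact: cvg_lim hi].
Qed.

Definition cgeo u rho := exists A : R, forall n, cnorm1 (u n) <= A * rho ^+ n.

Lemma cgeo_re u rho : cgeo u rho -> geo_bounded (re_seq u) rho.
Proof.
move=> [A uA]; exists A => n; apply: le_trans (uA n).
by rewrite /cnorm1 lerDl.
Qed.

Lemma cgeo_im u rho : cgeo u rho -> geo_bounded (im_seq u) rho.
Proof.
move=> [A uA]; exists A => n; apply: le_trans (uA n).
by rewrite /cnorm1 lerDr.
Qed.

Lemma cgeo_is_csum u rho x : 0 < rho -> cgeo u rho -> rho * `|x| < 1 ->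
  is_csum u x (csum u x).
Proof.
move=> r0 gu rx; split.
- exact: geo_bounded_cvg (cgeo_re gu) rx.
- exact: geo_bounded_cvg (cgeo_im gu) rx.
Qed.

Definition cdiffs u n := n.+1%:R * u n.+1.

Lemma re_cdiffs u : re_seq (cdiffs u) = pseries_diffs (re_seq u).
Proof.
apply/funext => n; rewrite /re_seq /cdiffs /pseries_diffs.
by rewrite -(rmorph_nat (real_complex R)) cReM /= mul0r subr0.
Qed.

Lemma im_cdiffs u : im_seq (cdiffs u) = pseries_diffs (im_seq u).
Proof.
apply/funext => n; rewrite /im_seq /cdiffs /pseries_diffs.
by rewrite -(rmorph_nat (real_complex R)) cImM /= mul0r addr0.
Qed.

Lemma cgeo_cdiffs u rho rho' : 0 < rho -> rho < rho' -> cgeo u rho ->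
  cgeo (cdiffs u) rho'.
Proof.
move=> r0 rr' gu.
have [A hA] := geo_bounded_diffs r0 rr' (cgeo_re gu).
have [B hB] := geo_bounded_diffs r0 rr' (cgeo_im gu).
exists (A + B) => n; rewrite mulrDl.
apply: lerD; [rewrite -[complex.Re _]/(re_seq _ n) re_cdiffs; exact: hA|].
by rewrite -[complex.Im _]/(im_seq _ n) im_cdiffs; exact: hB.
Qed.

Lemma cder_csum u rho x : 0 < rho -> cgeo u rho -> rho * `|x| < 1 ->
  cder (csum u) x (csum (cdiffs u) x).
Proof.
move=> r0 gu rx; split.
- by rewrite /csum /= re_cdiffs; apply: geo_bounded_derive rx => //; exact: cgeo_re.
- by rewrite /csum /= im_cdiffs; apply: geo_bounded_derive rx => //; exact: cgeo_im.
Qed.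

Lemma cgeo_cdiffs_is_csum u rho x : 0 < rho -> cgeo u rho -> rho * `|x| < 1 ->
  is_csum (cdiffs u) x (csum (cdiffs u) x).
Proof.
move=> r0 gu rx; have [r1 [rr1 r1x]] : exists r1, rho < r1 /\ r1 * `|x| < 1.
  have [->|x0] := eqVneq x 0.
    by exists (rho + 1); rewrite normr0 mulr0; split=> //; lra.
  have x0' : 0 < `|x| by rewrite normr_gt0.
  exists ((rho + `|x|^-1) / 2).
  have : rho < `|x|^-1 by rewrite -[`|x|^-1]mul1r ltr_pdivlMr.
  split; first lra.
  rewrite -ltr_pdivlMr// mul1r; lra.
exact: cgeo_is_csum (lt_trans r0 rr1) (cgeo_cdiffs r0 rr1 gu) r1x.
Qed.

End PowerSeries.

(** * The hypergeometric function on the half-line *)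

Section GaussCoefficients.
Variable R : realType.
Implicit Types (a b : R[i]) (c rho : R) (u : nat -> R[i]).

Lemma pochhammer0 a : pochhammer a 0 = 1.
Proof. by rewrite /pochhammer big_ord0. Qed.

Lemma pochhammerSr a n : pochhammer a n.+1 = pochhammer a n * (a + n%:R).
Proof. by rewrite /pochhammer big_ord_recr. Qed.

Lemma pochhammerSl a n : pochhammer a n.+1 = a * pochhammer (a + 1) n.
Proof.
rewrite /pochhammer big_ord_recl addr0; congr (_ * _).
by apply: eq_bigr => i _; rewrite lift0 -natr1; ring.
Qed.

Lemma realD_neq0 c n : 0 < c -> c%:C + n%:R != 0 :> R[i].
Proof.
by move=> c0; rewrite -(rmorph_nat (real_complex R)) -rmorphD fmorph_eq0 gt_eqF// ltr_wpDr.
Qed.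

Lemma pochhammer_neq0 c n : 0 < c -> pochhammer c%:C n != 0.
Proof.
by move=> c0; rewrite /pochhammer; apply/prodf_neq0 => i _; exact: realD_neq0.
Qed.

Lemma realC_neq0 c : 0 < c -> c%:C != 0 :> R[i].
Proof. by move=> c0; rewrite fmorph_eq0 gt_eqF. Qed.

Lemma natC_neq0 n : n.+1%:R != 0 :> R[i].
Proof. by rewrite pnatr_eq0. Qed.

Lemma factC_neq0 n : n`!%:R != 0 :> R[i].
Proof. by rewrite pnatr_eq0 -lt0n fact_gt0. Qed.

Ltac nonzero := rewrite ?nat1r ?natr1; repeat (apply/andP; split);
  first [exact: factC_neq0 | exact: natC_neq0 | by [] | exact: realC_neq0
        | exact: realD_neq0 | exact: pochhammer_neq0].

Lemma gauss_coef0 a b c : gauss_coef a b c%:C 0 = 1.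
Proof. by rewrite /gauss_coef !pochhammer0 fact0 !mulr1 divr1. Qed.

Lemma gauss_coefS a b c n : 0 < c ->
  gauss_coef a b c%:C n.+1 =
  (a + n%:R) * (b + n%:R) / ((c%:C + n%:R) * n.+1%:R) * gauss_coef a b c%:C n.
Proof.
move=> c0; rewrite /gauss_coef !pochhammerSr factS natrM.
by field; nonzero.
Qed.

Lemma cnorm1_nat n : cnorm1 (n%:R : R[i]) = n%:R.
Proof. by rewrite -(rmorph_nat (real_complex R)) cnorm1_real ger0_norm. Qed.

(** Ratio test. The constant is a sum over the indices up to [N], where the ratio is not controlled,
    so that it dominates each of those terms. *)
Lemma cgeo_ratio u rho N : 0 < rho ->
  (forall n, (N <= n)%N -> cnorm1 (u n.+1) <= rho * cnorm1 (u n)) -> cgeo u rho.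
Proof.
move=> r0 hu; exists (\sum_(k < N.+1) cnorm1 (u k) / rho ^+ k) => n.
elim: n => [|n ih].
  rewrite expr0 mulr1 big_ord_recl expr0 divr1 lerDl sumr_ge0// => i _.
  by rewrite divr_ge0 ?cnorm1_ge0// exprn_ge0// ltW.
have [Nn|nN] := leqP N n.
  by apply: le_trans (hu _ Nn) _; rewrite exprS mulrCA ler_wpM2l// ltW.
rewrite -ler_pdivrMr ?exprn_gt0//.
rewrite (bigD1 (Ordinal (nN : (n.+1 < N.+1)%N)))//= lerDl sumr_ge0// => i _.
by rewrite divr_ge0 ?cnorm1_ge0// exprn_ge0// ltW.
Qed.

Lemma gauss_cgeo a b c rho : 0 < c -> 1 < rho -> cgeo (gauss_coef a b c%:C) rho.
Proof.
move=> c0 r1.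
pose A := cnorm1 a; pose B := cnorm1 b.
have A0 : 0 <= A by exact: cnorm1_ge0.
have B0 : 0 <= B by exact: cnorm1_ge0.
(* For [n >= y] one has [A + B + A * B <= (rho - 1) * n]; together with [1 <= n] this gives
   [(A + n) * (B + n) <= rho * n ^ 2], which is at most [rho * (c + n) * (n + 1)]. *)
pose y := (A + B + A * B) / (rho - 1) + 1.
have r10 : 0 < rho - 1 by rewrite subr_gt0.
apply: (@cgeo_ratio _ _ (Num.truncn y).+1); first by rewrite (lt_trans _ r1).
move=> n Nn; rewrite gauss_coefS//.
apply: le_trans (cnorm1M _ _) _; apply: ler_wpM2r; first exact: cnorm1_ge0.
have yn : y <= n%:R.
  by apply: ltW; apply: lt_le_trans (real_truncnS_gt (num_real y)) _; rewrite ler_nat.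
have -> : (c%:C + n%:R) * n.+1%:R = ((c + n%:R) * n.+1%:R)%:C :> R[i].
  by rewrite rmorphM rmorphD !rmorph_nat.
rewrite -fmorphV; apply: le_trans (cnorm1M _ _) _; rewrite cnorm1_real.
have cn0 : 0 < c + n%:R by rewrite ltr_wpDr.
rewrite normfV ger0_norm ?mulr_ge0 ?(ltW cn0)//.
rewrite ler_pdivrMr ?mulr_gt0//.
apply: le_trans (cnorm1M _ _) _.
have hA : cnorm1 (a + n%:R) <= A + n%:R by apply: le_trans (cnorm1D _ _) _; rewrite cnorm1_nat.
have hB : cnorm1 (b + n%:R) <= B + n%:R by apply: le_trans (cnorm1D _ _) _; rewrite cnorm1_nat.
apply: le_trans (ler_pM _ _ hA hB) _; rewrite ?cnorm1_ge0//.
have n1 : 1 <= n%:R :> R by rewrite ler1n (leq_trans _ Nn).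
have h : A + B + A * B <= (rho - 1) * n%:R.
  rewrite -ler_pdivrMl// mulrC; apply: le_trans yn; rewrite /y; lra.
set m : R := n%:R in h n1 *.
have -> : n.+1%:R = m + 1 :> R by rewrite -natr1.
have h1 : (A + B + A * B) * m <= (rho - 1) * m * m by apply: ler_wpM2r h; lra.
have h2 : A * B * 1 <= A * B * m by rewrite ler_wpM2l// mulr_ge0.
have h3 : 0 <= rho * (c * (m + 1) + m) by rewrite mulr_ge0 ?addr_ge0 ?mulr_ge0; lra.
nra.
Qed.

Lemma gauss_cdiffs a b c : 0 < c ->
  cdiffs (gauss_coef a b c%:C) =
  (fun n => a * b / c%:C * gauss_coef (a + 1) (b + 1) (c + 1)%:C n).
Proof.
move=> c0; apply/funext => n; rewrite /cdiffs /gauss_coef !pochhammerSl factS natrM.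
rewrite rmorphD rmorph1.
have c1 : 0 < c + 1 by lra.
have := pochhammer_neq0 n c1; rewrite rmorphD rmorph1 => ?.
field.
nonzero.
Qed.

(** Coefficient of [t ^ n.+1] in [t (1 - t) g' + (c - (a + b + 1) t) g = c f], where [f] and [g] are
    the Gauss series at [(a, b, c)] and [(a + 1, b + 1, c + 1)]. *)
Lemma gauss_contiguous a b c n : 0 < c ->
  let v := gauss_coef (a + 1) (b + 1) (c + 1)%:C in
  (n.+1%:R + c%:C) * v n.+1 - (n.+1%:R + a + b) * v n =
  c%:C * gauss_coef a b c%:C n.+1.
Proof.
move=> c0 v; rewrite /v gauss_coefS ?addr_gt0// /gauss_coef !pochhammerSl factS natrM.
have c1 : 0 < c + 1 by lra.
have := pochhammer_neq0 n c1; have := realD_neq0 n c1; rewrite rmorphD rmorph1 => ? ?.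
rewrite -natr1.
field.
nonzero.
Qed.

(** Coefficient form of [a h - (1 - s) h' = (a (c - b) / c) k], where [h] and [k] are the Gauss
    series at [(a, b, c)] and [(a + 1, b, c + 1)]. *)
Lemma pfaff_contiguous a b c n : 0 < c ->
  (a + n%:R) * gauss_coef a b c%:C n - n.+1%:R * gauss_coef a b c%:C n.+1 =
  a * (c%:C - b) / c%:C * gauss_coef (a + 1) b (c + 1)%:C n.
Proof.
move=> c0.
have h1 : (a + n%:R) * pochhammer a n = a * pochhammer (a + 1) n.
  by rewrite mulrC -pochhammerSr pochhammerSl.
have h2 : pochhammer c%:C n * (c%:C + n%:R) = c%:C * pochhammer (c + 1)%:C n.
  by rewrite -pochhammerSr pochhammerSl rmorphD rmorph1.
rewrite gauss_coefS//.
have -> : (a + n%:R) * gauss_coef a b c%:C n - n.+1%:R *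
    ((a + n%:R) * (b + n%:R) / ((c%:C + n%:R) * n.+1%:R) * gauss_coef a b c%:C n) =
    (a + n%:R) * gauss_coef a b c%:C n * (c%:C - b) / (c%:C + n%:R).
  by field; nonzero.
rewrite /gauss_coef !mulrA h1.
have alg (x p f d e : R[i]) : p != 0 -> f != 0 -> e != 0 ->
    x / (p * f) * d / e = x * d / (p * e * f).
  by move=> p0 f0 e0; field; rewrite p0 f0 e0.
have c1 : 0 < c + 1 by lra.
have F0 : n`!%:R != 0 :> R[i] by exact: factC_neq0.
have C0 := realC_neq0 c0.
have D0 := pochhammer_neq0 n c1.
rewrite alg ?pochhammer_neq0 ?realD_neq0// h2.
move: (pochhammer (c + 1)%:C n) (n`!%:R) D0 F0 => D F D0 F0.
by field; rewrite D0 C0 F0.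
Qed.

(** Coefficient form of [s (1 - s) k' + (c - b s) k = c h] for the same two series. *)
Lemma pfaff_contiguous2 a b c n : 0 < c ->
  let k := gauss_coef (a + 1) b (c + 1)%:C in
  (n.+1%:R + c%:C) * k n.+1 - (n%:R + b) * k n =
  c%:C * gauss_coef a b c%:C n.+1.
Proof.
move=> c0 k; rewrite /k gauss_coefS ?addr_gt0// /gauss_coef.
rewrite [pochhammer a _]pochhammerSl [pochhammer b n.+1]pochhammerSr.
rewrite [pochhammer c%:C _]pochhammerSl factS natrM.
have c1 : 0 < c + 1 by lra.
have := pochhammer_neq0 n c1; have := realD_neq0 n c1; rewrite rmorphD rmorph1 => ? ?.
rewrite -natr1.
field.
nonzero.
Qed.

End GaussCoefficients.

(** * The hypergeometric equation as a first-order system *)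

Section HypergeometricSystem.
Variable R : realType.
Implicit Types (a b : R[i]) (c t s : R).

(* First-order form of the hypergeometric equation: f and g stand for
   2F1(a, b; c) and 2F1(a + 1, b + 1; c + 1). *)
Definition hyp_system a b c (f g : R -> R[i]) t :=
  cder f t (a * b / c%:C * g t) /\
  exists2 dg, cder g t dg &
    (t * (1 - t))%:C * dg = c%:C * f t - (c%:C - (a + b + 1) * t%:C) * g t.

Lemma unit_disc_radius t : `|t| < 1 -> exists2 rho : R, 1 < rho & rho * `|t| < 1.
Proof.
move=> t1; have [->|t0] := eqVneq t 0; first by exists 2; rewrite ?normr0 ?mulr0//; lra.
have t0' : 0 < `|t| by rewrite normr_gt0.
exists ((1 + `|t|^-1) / 2); last rewrite -ltr_pdivlMr// mul1r.
  have : 1 < `|t|^-1 by rewrite invf_gt1.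
  lra.
have : 1 < `|t|^-1 by rewrite invf_gt1.
lra.
Qed.

Lemma gauss_is_csum a b c t : 0 < c -> `|t| < 1 ->
  is_csum (gauss_coef a b c%:C) t (csum (gauss_coef a b c%:C) t).
Proof.
move=> c0 /unit_disc_radius[rho r1 rt].
by apply: cgeo_is_csum rt; [lra|exact: gauss_cgeo].
Qed.

Lemma gauss_cdiffs_is_csum a b c t : 0 < c -> `|t| < 1 ->
  is_csum (cdiffs (gauss_coef a b c%:C)) t (csum (cdiffs (gauss_coef a b c%:C)) t).
Proof.
move=> c0 /unit_disc_radius[rho r1 rt].
by apply: cgeo_cdiffs_is_csum rt; [lra|exact: gauss_cgeo].
Qed.

Lemma gauss_cder a b c t : 0 < c -> `|t| < 1 ->
  cder (csum (gauss_coef a b c%:C)) t (csum (cdiffs (gauss_coef a b c%:C)) t).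
Proof.
move=> c0 /unit_disc_radius[rho r1 rt].
by apply: cder_csum rt; [lra|exact: gauss_cgeo].
Qed.

Lemma gauss_cdiffsE a b c t : 0 < c -> `|t| < 1 ->
  csum (cdiffs (gauss_coef a b c%:C)) t =
  a * b / c%:C * csum (gauss_coef (a + 1) (b + 1) (c + 1)%:C) t.
Proof.
move=> c0 t1; have := gauss_cdiffs_is_csum a b c0 t1; rewrite {1}gauss_cdiffs//.
move=> /is_csum_unique; apply; apply: is_csumZ; apply: gauss_is_csum => //; lra.
Qed.

Lemma is_csum_ext (u v : nat -> R[i]) t w : u =1 v -> is_csum u t w -> is_csum v t w.
Proof. by move=> /funext ->. Qed.

Lemma gauss_hyp_system a b c t : 0 < c -> `|t| < 1 ->
  hyp_system a b c (csum (gauss_coef a b c%:C))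
    (csum (gauss_coef (a + 1) (b + 1) (c + 1)%:C)) t.
Proof.
move=> c0 t1; have c1 : 0 < c + 1 by lra.
split; first by rewrite -gauss_cdiffsE//; exact: gauss_cder.
eexists; first exact: gauss_cder.
set v := gauss_coef (a + 1) _ _; set u := gauss_coef a _ _.
have D := gauss_cdiffs_is_csum (a + 1) (b + 1) c1 t1.
have L := is_csumD (is_csumX D) (is_csumZ (-1) (is_csumX (is_csumX D))).
have V := gauss_is_csum (a + 1) (b + 1) c1 t1.
have M := is_csumD (is_csumZ c%:C (gauss_is_csum a b c0 t1))
  (is_csumD (is_csumZ (- c%:C) V) (is_csumZ (a + b + 1) (is_csumX V))).
rewrite -/v -/u in L M *.
have LM : (fun n => shift_seq (cdiffs v) n + -1 * shift_seq (shift_seq (cdiffs v)) n)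
  =1 (fun n => c%:C * u n + (- c%:C * v n + (a + b + 1) * shift_seq v n)).
  case=> [|n] /=.
    by rewrite /u /v !gauss_coef0; ring.
  have := gauss_contiguous a b n c0; rewrite -/v -/u /= => <-.
  by case: n => [|n] /=; rewrite /cdiffs -?natr1; ring.
have := is_csum_unique (is_csum_ext LM L) M => H.
transitivity (t%:C * csum (cdiffs v) t + -1 * (t%:C * (t%:C * csum (cdiffs v) t))).
  by rewrite rmorphM rmorphB rmorph1; ring.
by rewrite H; ring.
Qed.

(** The exponential of [a * L] for complex [a] and real [L]. At [L = - ln (1 - t)] it is the power
    [(1 - t) ^ (- a)] of Pfaff's formula. *)
Definition cexp a (L : R) : R[i] :=
  (expR (complex.Re a * L) * cos (complex.Im a * L)) +i*
  (expR (complex.Re a * L) * sin (complex.Im a * L)).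

Lemma cexp0 a : cexp a 0 = 1.
Proof. by apply: complex_ext; rewrite /cexp /= !mulr0 expR0 ?cos0 ?sin0 ?mulr0 ?mulr1. Qed.

Lemma cexpS a L : cexp (a + 1) L = (expR L)%:C * cexp a L.
Proof.
have ha : expR (complex.Re (a + 1) * L) = expR L * expR (complex.Re a * L).
  by rewrite cReD /= mulrDl mul1r addrC expRD.
have hi : complex.Im (a + 1) = complex.Im a by rewrite cImD /= addr0.
by apply: complex_ext; rewrite /cexp ?cReM ?cImM /= ha hi; ring.
Qed.

Lemma is_derive_scale (k x : R) : is_derive x (1 : R) (fun t => k * t) k.
Proof.
by apply: is_derive_ext (is_deriveZ k (is_derive_id x 1)); rewrite /GRing.scale/= ?mulr1.
Qed.

Lemma cder_cexp a L : cder (cexp a) L (a * cexp a L).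
Proof.
have de := is_derive1_comp (is_derive_expR _) (is_derive_scale (complex.Re a) L).
have dc := is_derive1_comp (is_derive_cos _) (is_derive_scale (complex.Im a) L).
have ds := is_derive1_comp (is_derive_sin _) (is_derive_scale (complex.Im a) L).
split.
- apply: is_derive_ext (is_deriveM de dc) => //.
  by rewrite cReM /cexp/= /GRing.scale/=; ring.
- apply: is_derive_ext (is_deriveM de ds) => //.
  by rewrite cImM /cexp/= /GRing.scale/=; ring.
Qed.

(** This is [t / (t - 1)], which maps []-oo, 1/2[] into []-1, 1[]. *)
Definition pfaff_arg t : R := 1 - (1 - t)^-1.
Definition pfaff_fun a (b : R[i]) c t : R[i] :=
  cexp a (- ln (1 - t)) * csum (gauss_coef a b c%:C) (pfaff_arg t).

Lemma is_derive_onem t : is_derive t (1 : R) (fun t => 1 - t) (-1).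
Proof.
apply: is_derive_ext (is_deriveB (is_derive_cst (1:R) t 1) (is_derive_id t 1)) => //.
by rewrite sub0r.
Qed.

Lemma is_derive_pfaff_arg t : t != 1 ->
  is_derive t (1 : R) pfaff_arg (- (1 - t)^-1 ^+ 2).
Proof.
move=> t1; have t10 : 1 - t != 0 by rewrite subr_eq0 eq_sym.
have h := @is_deriveV _ (fun t => 1 - t) t _ _ t10 (is_derive_onem t).
apply: is_derive_ext (is_deriveB (is_derive_cst (1:R) t 1) h) => //.
by rewrite /GRing.scale/= exprVn; ring.
Qed.

Lemma is_derive_ln_onem t : t < 1 ->
  is_derive t (1 : R) (fun t => - ln (1 - t)) (1 - t)^-1.
Proof.
move=> t1; have t0 : 0 < 1 - t by lra.
have h := @is_derive_comp1 _ (@ln R) (fun t => 1 - t) _ _ _ (is_derive1_ln t0) (is_derive_onem t).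
by apply: is_derive_ext (is_deriveN h) => //; rewrite mulrN1 opprK.
Qed.

Lemma pfaff_arg_lt1 t : t < 2^-1 -> `|pfaff_arg t| < 1.
Proof.
move=> t1; have t0 : 0 < 1 - t by lra.
rewrite /pfaff_arg ltr_norml; apply/andP; split; last first.
  have : 0 < (1 - t)^-1 by rewrite invr_gt0.
  lra.
have : (1 - t)^-1 < 2 by rewrite -[2]invrK ltf_pV2 ?posrE ?invr_gt0//; lra.
lra.
Qed.

(** The second parameter is the same in both components because [(c + 1) - (b + 1) = c - b]. The two
    equations then reduce to the two contiguity relations at [s = t / (t - 1)]. *)
Lemma pfaff_hyp_system a b c t : 0 < c -> t < 2^-1 ->
  hyp_system a b c (pfaff_fun a (c%:C - b) c) (pfaff_fun (a + 1) (c%:C - b) (c + 1)) t.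
Proof.
move=> c0 t1; have c1 : 0 < c + 1 by lra.
have t1' : t < 1 by lra.
have t10 : 1 - t != 0 by rewrite gt_eqF//; lra.
have s1 := pfaff_arg_lt1 t1.
set s := pfaff_arg t in s1 *.
pose b' := c%:C - b; rewrite -/b'.
set h := gauss_coef a b' c%:C; set k := gauss_coef (a + 1) b' (c + 1)%:C.
have H1 : a * csum h s - (1 - s%:C) * csum (cdiffs h) s = a * b / c%:C * csum k s.
  have D := gauss_cdiffs_is_csum a b' c0 s1.
  have H := gauss_is_csum a b' c0 s1.
  have K := gauss_is_csum (a + 1) b' c1 s1.
  have L := is_csumD (is_csumZ a H) (is_csumD (is_csumZ (-1) D) (is_csumX D)).
  have M := is_csumZ (a * b / c%:C) K.
  rewrite -/h -/k in L M.
  have LM : (fun n => a * h n + (-1 * cdiffs h n + shift_seq (cdiffs h) n))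
      =1 (fun n => a * b / c%:C * k n).
    move=> n; have := pfaff_contiguous a b' n c0; rewrite -/h -/k.
    have -> : c%:C - b' = b by rewrite /b'; ring.
    move=> <-.
    by case: n => [|n] /=; rewrite /cdiffs; ring.
  have := is_csum_unique (is_csum_ext LM L) M => <-; ring.
have H2 : (s%:C * (1 - s%:C)) * csum (cdiffs k) s + (c%:C - b' * s%:C) * csum k s
    = c%:C * csum h s.
  have D := gauss_cdiffs_is_csum (a + 1) b' c1 s1.
  have H := gauss_is_csum a b' c0 s1.
  have K := gauss_is_csum (a + 1) b' c1 s1.
  have L := is_csumD (is_csumD (is_csumX D) (is_csumZ (-1) (is_csumX (is_csumX D))))
      (is_csumD (is_csumZ c%:C K) (is_csumZ (- b') (is_csumX K))).
  have M := is_csumZ c%:C H.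
  rewrite -/h -/k in L M.
  have LM : (fun n => (shift_seq (cdiffs k) n + -1 * shift_seq (shift_seq (cdiffs k)) n)
      + (c%:C * k n + - b' * shift_seq k n)) =1 (fun n => c%:C * h n).
    case=> [|n] /=; first by rewrite /h /k !gauss_coef0; ring.
    have := pfaff_contiguous2 a b' n c0; rewrite -/h -/k /= => <-.
    by case: n => [|n] /=; rewrite /cdiffs -?natr1; ring.
  have := is_csum_unique (is_csum_ext LM L) M => <-; ring.
set L := - ln (1 - t).
have eL : expR L = (1 - t)^-1 by rewrite /L expRN lnK// posrE; lra.
have t1n : t != 1 by rewrite lt_eqF.
have dlog := is_derive_ln_onem t1'.
have ds := is_derive_pfaff_arg t1n.
have d a0 c' (c'0 : 0 < c') := cderM (cder_comp (cder_cexp a0 _) dlog)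
  (cder_comp (gauss_cder a0 b' c'0 s1) ds).
(* Both [s = 1 - i] and [t = 1 - i^-1] are rational in [i], which turns the remaining goals into
   field identities. *)
pose i : R[i] := (1 - t)^-1%:C.
have i0 : i != 0 by rewrite fmorph_eq0 invr_eq0.
have t1C : 1 - t%:C != 0 :> R[i].
  by rewrite -(rmorph1 (real_complex R)) -rmorphB fmorph_eq0.
have sE : s%:C = 1 - i by rewrite /s /pfaff_arg rmorphB rmorph1.
have tE : t%:C = 1 - i^-1 by rewrite /i -fmorphV invrK rmorphB rmorph1; ring.
have iE : (- (1 - t)^-1 ^+ 2)%:C = - i ^+ 2 by rewrite rmorphN rmorphXn.
split.
  have := d a c c0; rewrite -/L -/s -/h iE; congr (cder _ _ _).
  rewrite /pfaff_fun -/s -/k -/L cexpS eL -/i.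
  transitivity (i * cexp a L * (a * csum h s - (1 - s%:C) * csum (cdiffs h) s)).
    by rewrite sE; ring.
  by rewrite H1; ring.
eexists; first exact: d.
rewrite -/L -/s -/k iE /pfaff_fun -/s -/k -/h -/L cexpS eL -/i.
transitivity (cexp a L * (c%:C * csum h s) - (c%:C - (a + b + 1) * t%:C) *
  (i * cexp a L * csum k s)); last by ring.
rewrite -H2 rmorphM rmorphB rmorph1 tE sE -/i /b'.
by field.
Qed.

Lemma gauss_csum0 a b c : csum (gauss_coef a b c%:C) 0 = 1.
Proof. by rewrite csum0 gauss_coef0. Qed.

Lemma pfaff_fun0 a b c : pfaff_fun a b c 0 = 1.
Proof.
by rewrite /pfaff_fun /pfaff_arg subr0 ln1 oppr0 cexp0 invr1 subrr mul1r gauss_csum0.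
Qed.

End HypergeometricSystem.

(** * Hyperbolic functions *)

Section HyperbolicFunctions.
Variable R : realType.
Implicit Types x y : R.

Lemma is_derive_expRN x : is_derive x (1 : R) (fun t => expR (- t)) (- expR (- x)).
Proof.
have h := @is_derive_comp1 _ (@expR R) -%R _ _ _ (is_derive_expR _)
  (is_deriveN (is_derive_id x (1 : R))).
by apply: is_derive_ext h => //; rewrite mulrN1.
Qed.

Lemma is_derive_half (h k : R -> R) x l l' :
  is_derive x (1 : R) h l -> is_derive x (1 : R) k l' ->
  is_derive x (1 : R) (fun t => (h t + k t) / 2) ((l + l') / 2).
Proof.
move=> dh dk; apply: is_derive_ext (is_deriveZ 2^-1 (is_deriveD dh dk)).
  by apply/funext => t; rewrite !fctE /GRing.scale/= mulrC.
by rewrite /GRing.scale/= mulrC.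
Qed.

Lemma is_derive_cosh x : is_derive x (1 : R) (@cosh R) (sinh x).
Proof. exact: is_derive_half (is_derive_expR x) (is_derive_expRN x). Qed.

Lemma is_derive_sinh x : is_derive x (1 : R) (@sinh R) (cosh x).
Proof.
have h := is_derive_half (is_derive_expR x) (is_deriveN (is_derive_expRN x)).
by apply: is_derive_ext h => //; rewrite opprK.
Qed.

Lemma expRNM x : expR x * expR (- x) = 1.
Proof. by rewrite -expRD subrr expR0. Qed.

Lemma cosh2Bsinh2 x : cosh x ^+ 2 - sinh x ^+ 2 = 1.
Proof.
rewrite /cosh /sinh; transitivity (expR x * expR (- x)); first by field.
exact: expRNM.
Qed.

Lemma coshD x y : cosh (x + y) = cosh x * cosh y + sinh x * sinh y.
Proof. by rewrite /cosh /sinh opprD !expRD; field. Qed.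

Lemma sinhD x y : sinh (x + y) = sinh x * cosh y + cosh x * sinh y.
Proof. by rewrite /cosh /sinh opprD !expRD; field. Qed.

Lemma sinhN x : sinh (- x) = - sinh x.
Proof. by rewrite /sinh opprK; field. Qed.

Lemma coshN x : cosh (- x) = cosh x.
Proof. by rewrite /cosh opprK addrC. Qed.

Lemma sinh0 : sinh 0 = 0 :> R.
Proof. by rewrite /sinh oppr0 subrr mul0r. Qed.

Lemma cosh0 : cosh 0 = 1 :> R.
Proof. by rewrite /cosh oppr0 expR0; field. Qed.

Lemma coshDsinh x : cosh x + sinh x = expR x.
Proof. by rewrite /cosh /sinh; field. Qed.

Lemma sinh_gt0 x : 0 < x -> 0 < sinh x.
Proof.
by move=> x0; rewrite /sinh divr_gt0// subr_gt0 ltr_expR; lra.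
Qed.

Lemma cosh_ge1 x : 1 <= cosh x.
Proof.
have := cosh2Bsinh2 x; have := sqr_ge0 (sinh x).
have : 0 < cosh x by rewrite divr_gt0// addr_gt0 ?expR_gt0.
by move=> h0 h1 h2; nra.
Qed.

Lemma cosh_lt x y : 0 <= x -> x < y -> cosh x < cosh y.
Proof.
move=> x0 xy; have -> : y = x + (y - x) by ring.
set d := y - x; have d0 : 0 < d by rewrite subr_gt0.
rewrite coshD; have sd := sinh_gt0 d0.
have cd : 1 < cosh d by have := cosh2Bsinh2 d; have := cosh_ge1 d; nra.
have sx : 0 <= sinh x.
  by move: x0; rewrite le_eqVlt => /predU1P[<-|/sinh_gt0/ltW//]; rewrite sinh0.
have := cosh_ge1 x; have : 0 <= sinh x * sinh d by rewrite mulr_ge0// ltW.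
nra.
Qed.

Lemma cosh_le x y : 0 <= x -> x <= y -> cosh x <= cosh y.
Proof.
by move=> x0; rewrite le_eqVlt => /predU1P[->//|/(cosh_lt x0)/ltW].
Qed.

(** The witness is [arcosh v = ln (v + sqrt (v^2 - 1))]; the inverse of [v + r] is [v - r]. *)
Lemma cosh_surj v : 1 <= v -> exists2 x : R, 0 <= x & cosh x = v.
Proof.
move=> v1; pose r := Num.sqrt (v ^+ 2 - 1).
have v2 : 0 <= v ^+ 2 - 1 by nra.
have r2 : r ^+ 2 = v ^+ 2 - 1 by rewrite sqr_sqrtr.
have r0 : 0 <= r by exact: sqrtr_ge0.
exists (ln (v + r)); first by rewrite ln_ge0//; lra.
have vr : 0 < v + r by lra.
rewrite /cosh expRN lnK ?posrE//.
have -> : (v + r)^-1 = v - r.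
  apply: (mulfI (lt0r_neq0 vr)); rewrite mulfV ?lt0r_neq0//.
  by transitivity (v ^+ 2 - r ^+ 2); [rewrite r2; ring|ring].
by field.
Qed.

End HyperbolicFunctions.

(** * Uniqueness by energy estimates *)

Section Energy.
Variable R : realType.

Lemma cder_sqn_continuous (f : R -> R[i]) (x : R) l : cder f x l ->
  {for x, continuous (fun t => sqn (f t))}.
Proof. by move=> /is_derive_sqn; exact: is_derive_continuous. Qed.

(* The singular term of the Jacobi equation only lowers the energy
   |p|^2 + |q|^2, because 2c - 1 >= 0. *)
Lemma jacobi_system_unique (m : R[i]) (c T : R) (p q : R -> R[i]) :
  2^-1 <= c ->
  (forall X, 0 <= X <= T -> exists l, cder p X l) ->
  (forall X, 0 <= X <= T -> exists l, cder q X l) ->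
  (forall X, 0 < X <= T -> cder p X (m * q X)) ->
  (forall X, 0 < X <= T -> cder q X
    ((2 * c)%:C * p X - ((2 * c - 1) * (cosh X / sinh X))%:C * q X)) ->
  p 0 = 0 -> q 0 = 0 -> 0 <= T -> p T = 0 /\ q T = 0.
Proof.
move=> c2 cp cq dp dq p0 q0; rewrite le_eqVlt => /predU1P[<-//|T0].
pose E X := sqn (p X) + sqn (q X).
pose mr := complex.Re m; pose mi := complex.Im m.
(* By [2 x y <= x^2 + y^2] each group of cross terms in the derivative of [E] is at most its
   coefficient times [E]; the coefficients add up to [K]. *)
pose K := `|mr| + `|mi| + 2 * c.
have : E T <= 0.
  apply: (@gronwall_right _ E (fun X =>
    2 * (complex.Re (p X) * complex.Re (m * q X) +
         complex.Im (p X) * complex.Im (m * q X)) +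
    2 * (complex.Re (q X) * complex.Re
      ((2 * c)%:C * p X - ((2 * c - 1) * (cosh X / sinh X))%:C * q X) +
         complex.Im (q X) * complex.Im
      ((2 * c)%:C * p X - ((2 * c - 1) * (cosh X / sinh X))%:C * q X))) K 0 T T0).
  - apply: continuous_in_subspaceT => t; rewrite inE/= in_itv/= => ht.
    have [lp hp] := cp _ ht; have [lq hq] := cq _ ht.
    exact: continuousD (cder_sqn_continuous hp) (cder_sqn_continuous hq).
  - move=> X /andP[X0 XT]; have hX : 0 < X <= T by rewrite X0 ltW.
    have := is_derive_sqn (dp _ hX); have := is_derive_sqn (dq _ hX) => h1 h2.
    exact: is_deriveD.
  - move=> X /andP[X0 XT].
    rewrite /E /sqn !cReD !cImD !cReN !cImN !cReM !cImM/=.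
    move: (p X) (q X) => [a b] [d e] /=.
    rewrite !mul0r !subr0 !addr0 -/mr -/mi.
    set k := (2 * c - 1) * _.
    have k0 : 0 <= k.
      have h : 0 <= cosh X by have := cosh_ge1 X; lra.
      by apply: mulr_ge0; [lra|rewrite divr_ge0// ltW// sinh_gt0].
    have am (z x y : R) : 2 * (z * x * y) <= `|z| * (x ^+ 2 + y ^+ 2).
      have [z0|z0] := leP 0 z.
        have : 0 <= z * (x - y) ^+ 2 by rewrite mulr_ge0 ?sqr_ge0.
        rewrite ?ger0_norm//; nra.
      have : 0 <= - z * (x + y) ^+ 2 by rewrite mulr_ge0 ?sqr_ge0//; lra.
      rewrite ltr0_norm//; nra.
    have := am mr a d; have := am mr b e; have := am (- mi) a e; have := am mi b d.
    rewrite normrN => h1 h2 h3 h4.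
    have h5 := am (2 * c) a d; have h6 := am (2 * c) b e.
    have n2c : `|2 * c| = 2 * c by rewrite ger0_norm//; lra.
    rewrite n2c in h5 h6.
    have h7 : 0 <= k * (d ^+ 2 + e ^+ 2) by rewrite mulr_ge0// addr_ge0// sqr_ge0.
    rewrite /K; nra.
  - by rewrite /E p0 q0 /sqn/= !expr0n/= !addr0.
rewrite /E => ET; have := sqn_ge0 (p T); have := sqn_ge0 (q T) => h1 h2.
by split; apply: sqn_eq0; lra.
Qed.

Lemma cnorm1_sqr (z : R[i]) : cnorm1 z ^+ 2 <= 2 * sqn z.
Proof.
case: z => x y; rewrite /cnorm1 /sqn/= -(real_normK (num_real x)) -(real_normK (num_real y)).
by have := sqr_ge0 (`|x| - `|y|); nra.
Qed.

Lemma cnorm1_dot (z w : R[i]) :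
  `|complex.Re z * complex.Re w + complex.Im z * complex.Im w| <= cnorm1 z * cnorm1 w.
Proof.
case: z w => x y [x' y'] /=; apply: le_trans (ler_normD _ _) _.
rewrite !normrM /cnorm1/=.
have := normr_ge0 x; have := normr_ge0 y; have := normr_ge0 x'; have := normr_ge0 y'.
nra.
Qed.

(** Gronwall for a system with bounded coefficients, on either side of the initial point; the case
    [y < x] is reflected by [t -> - t]. *)
Lemma linear_system_unique (p q lp lq : R -> R[i]) (K x y : R) :
  0 <= K -> (forall t, x <= t <= y \/ y <= t <= x -> cder p t (lp t) /\ cder q t (lq t)) ->
  (forall t, x <= t <= y \/ y <= t <= x -> cnorm1 (lp t) <= K * (cnorm1 (p t) + cnorm1 (q t)) /\
     cnorm1 (lq t) <= K * (cnorm1 (p t) + cnorm1 (q t))) ->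
  p x = 0 -> q x = 0 -> p y = 0 /\ q y = 0.
Proof.
move=> K0 dpq lepq px qx.
pose E t := sqn (p t) + sqn (q t).
pose E' t := 2 * (complex.Re (p t) * complex.Re (lp t) + complex.Im (p t) * complex.Im (lp t))
  + 2 * (complex.Re (q t) * complex.Re (lq t) + complex.Im (q t) * complex.Im (lq t)).
have Ex : E x <= 0 by rewrite /E px qx /sqn/= !expr0n/= !addr0.
have dE t : x <= t <= y \/ y <= t <= x -> is_derive t (1 : R) E (E' t).
  by move=> /dpq[/is_derive_sqn h1 /is_derive_sqn h2]; exact: is_deriveD.
(* With [P] and [Q] the norms of [p t] and [q t], the left side is at most [2 K (P + Q)^2], and
   [(P + Q)^2 <= 4 E]: hence the factor 8. *)
have leE t : x <= t <= y \/ y <= t <= x -> `|E' t| <= 8 * K * E t.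
  move=> ht; have [h1 h2] := lepq _ ht.
  apply: le_trans (ler_normD _ _) _; rewrite !normrM !(ger0_norm (_ : 0 <= 2))//.
  have := cnorm1_dot (p t) (lp t); have := cnorm1_dot (q t) (lq t).
  have := cnorm1_sqr (p t); have := cnorm1_sqr (q t).
  have := cnorm1_ge0 (p t); have := cnorm1_ge0 (q t); have := cnorm1_ge0 (lp t).
  move: (cnorm1 (p t)) (cnorm1 (q t)) (cnorm1 (lp t)) (cnorm1 (lq t)) h1 h2 => P Q LP LQ.
  rewrite /E; move: (sqn (p t)) (sqn (q t)) `| _ | `| _ | => SP SQ A B h1 h2 lp0 Q0 P0 hQ hP hB hA.
  have hA' : A <= P * (K * (P + Q)) by apply: le_trans hA _; rewrite ler_wpM2l.
  have hB' : B <= Q * (K * (P + Q)) by apply: le_trans hB _; rewrite ler_wpM2l.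
  have h3 : (P + Q) ^+ 2 <= 4 * (SP + SQ) by have := sqr_ge0 (P - Q); nra.
  have := ler_wpM2l K0 h3; nra.
suff : E y <= 0.
  rewrite /E => Ey; have := sqn_ge0 (p y); have := sqn_ge0 (q y) => h1 h2.
  by split; apply: sqn_eq0; lra.
have [xy|yx|<-//] := ltgtP x y.
  apply: (@gronwall_right _ E E' (8 * K) x y) => //.
  - apply: continuous_in_subspaceT => t; rewrite inE/= in_itv/= => ht.
    exact: is_derive_continuous (dE t (or_introl ht)).
  - by move=> t /andP[xt ty]; apply: dE; left; rewrite !ltW.
  - move=> t /andP[xt ty]; apply: le_trans (ler_norm _) _; apply: leE.
    by left; rewrite !ltW.
pose F t := E (- t).
have dF t : - x <= t <= - y -> is_derive t (1 : R) F (- E' (- t)).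
  move=> ht; have h : x <= - t <= y \/ y <= - t <= x by right; lra.
  have := @is_derive_comp1 _ E -%R _ _ _ (dE _ h) (is_deriveN (is_derive_id t (1 : R))).
  by apply: is_derive_ext => //; rewrite mulrN1.
have := @gronwall_right _ F (fun t => - E' (- t)) (8 * K) (- x) (- y).
rewrite /F !opprK; apply => //.
- by rewrite ltrN2.
- apply: continuous_in_subspaceT => t; rewrite inE/= in_itv/= => ht.
  exact: is_derive_continuous (dF t ht).
- by move=> t /andP[xt ty]; apply: dF; rewrite !ltW.
- move=> t /andP[xt ty]; rewrite -[leLHS]opprK; apply: le_trans (ler_norm _) _.
  by rewrite opprK normrN; apply: leE; right; lra.
Qed.

End Energy.

(** * The system in the hyperbolic variable *)

Section JacobiForm.
Variable R : realType.
Implicit Types (a b : R[i]) (c t X : R).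

(** Equal to [- sinh (X / 2) ^ 2], the argument of the Jacobi function at [X / 2]. *)
Definition jacobi_arg X : R := (1 - cosh X) / 2.

Lemma is_derive_jacobi_arg X : is_derive X (1 : R) jacobi_arg (- (sinh X / 2)).
Proof.
have h := is_derive_half (is_derive_cst (1 : R) X 1) (is_deriveN (is_derive_cosh X)).
by apply: is_derive_ext h => //; rewrite add0r mulNr.
Qed.

Lemma jacobi_arg_le0 X : jacobi_arg X <= 0.
Proof. by have := cosh_ge1 X; rewrite /jacobi_arg; lra. Qed.

Lemma jacobi_argM X : jacobi_arg X * (1 - jacobi_arg X) = - (sinh X ^+ 2 / 4).
Proof.
have := cosh2Bsinh2 X; rewrite /jacobi_arg => h.
have -> : sinh X ^+ 2 = cosh X ^+ 2 - 1 by rewrite -h; ring.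
by field.
Qed.

Section Pair.
Variables (a b : R[i]) (c : R) (f g : R -> R[i]).
Hypothesis c0 : 0 < c.
Hypothesis abc : a + b + 1 = (2 * c)%:C.

Definition even_part X := f (jacobi_arg X).
Definition odd_part X := (sinh X)%:C * g (jacobi_arg X).
Definition jacobi_rate : R[i] := - (a * b) / (2 * c)%:C.

Lemma cder_even_part X : hyp_system a b c f g (jacobi_arg X) ->
  cder even_part X (jacobi_rate * odd_part X).
Proof.
move=> [df _]; have := cder_comp df (is_derive_jacobi_arg X).
congr (cder _ _ _); rewrite /jacobi_rate /odd_part rmorphN !rmorphM fmorphV rmorph_nat.
by field; exact: realC_neq0.
Qed.

(** Because [a + b + 1 = 2 c], the coefficient [c - (a + b + 1) t] is [c * cosh X]. The last term is
    kept in [g] rather than in the odd part, so that the formula holds at [X = 0] too. *)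
Lemma cder_odd_part X : hyp_system a b c f g (jacobi_arg X) ->
  cder odd_part X ((2 * c)%:C * even_part X - ((2 * c - 1) * cosh X)%:C * g (jacobi_arg X)).
Proof.
move=> [_ [dg hdg e]].
have := cderM (cder_real (is_derive_sinh X)) (cder_comp hdg (is_derive_jacobi_arg X)).
congr (cder _ _ _).
have e2 : (sinh X)%:C * ((- (sinh X / 2))%:C * dg) =
   2 * ((jacobi_arg X * (1 - jacobi_arg X))%:C * dg).
  rewrite jacobi_argM expr2 !rmorphN !rmorphM !fmorphV !rmorph_nat.
  by field.
rewrite e2 e abc /even_part.
have -> : (jacobi_arg X)%:C = (1 - (cosh X)%:C) / 2.
  by rewrite /jacobi_arg rmorphM rmorphB fmorphV rmorph1 rmorph_nat.
by rewrite !rmorphM rmorphB rmorphM rmorph1 rmorph_nat; field.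
Qed.

Lemma cder_odd_part' X : 0 < X -> hyp_system a b c f g (jacobi_arg X) ->
  cder odd_part X ((2 * c)%:C * even_part X -
    ((2 * c - 1) * (cosh X / sinh X))%:C * odd_part X).
Proof.
move=> X0 /cder_odd_part; congr (cder _ _ _); congr (_ - _).
rewrite /odd_part mulrA -rmorphM; congr (_%:C * _).
by field; rewrite gt_eqF// sinh_gt0.
Qed.

End Pair.

(** Along [t = (1 - cosh X) / 2] the difference of the two pairs solves the Jacobi system with zero
    data at [X = 0]. The odd part determines [g] after division by [sinh X]; at [X = 0] the value of
    [g] is given. *)
Lemma hyp_system_unique a b c f1 g1 f2 g2 t :
  2^-1 <= c -> a + b + 1 = (2 * c)%:C ->
  (forall s, t <= s <= 0 -> hyp_system a b c f1 g1 s) ->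
  (forall s, t <= s <= 0 -> hyp_system a b c f2 g2 s) ->
  f1 0 = f2 0 -> g1 0 = g2 0 -> t <= 0 -> f1 t = f2 t /\ g1 t = g2 t.
Proof.
move=> c2 abc h1 h2 f0 g0 t0; have c0 : 0 < c by lra.
have [X X0 cX] : exists2 X : R, 0 <= X & cosh X = 1 - 2 * t.
  by apply: cosh_surj; lra.
have tX : jacobi_arg X = t by rewrite /jacobi_arg cX; lra.
have rng Y : 0 <= Y <= X -> t <= jacobi_arg Y <= 0.
  move=> /andP[Y0 YX]; rewrite jacobi_arg_le0 andbT -tX /jacobi_arg.
  by have := cosh_le Y0 YX; lra.
pose p Y := even_part f1 Y - even_part f2 Y.
pose q Y := odd_part g1 Y - odd_part g2 Y.
have j0 : jacobi_arg 0 = 0 by rewrite /jacobi_arg cosh0 subrr mul0r.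
have [] := @jacobi_system_unique _ (jacobi_rate a b c) c X p q c2.
- move=> Y /rng hY; eexists.
  exact: cderB (cder_even_part c0 (h1 _ hY)) (cder_even_part c0 (h2 _ hY)).
- move=> Y /rng hY; eexists.
  exact: cderB (cder_odd_part abc (h1 _ hY)) (cder_odd_part abc (h2 _ hY)).
- move=> Y /andP[Y0 YX]; have hY : t <= jacobi_arg Y <= 0 by apply: rng; lra.
  rewrite /q mulrBr.
  exact: cderB (cder_even_part c0 (h1 _ hY)) (cder_even_part c0 (h2 _ hY)).
- move=> Y /andP[Y0 YX]; have hY : t <= jacobi_arg Y <= 0 by apply: rng; lra.
  have := cderB (cder_odd_part' abc Y0 (h1 _ hY)) (cder_odd_part' abc Y0 (h2 _ hY)).
  congr (cder _ _ _); rewrite /p /q; ring.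
- by rewrite /p /even_part j0 f0 subrr.
- by rewrite /q /odd_part sinh0 !mul0r subrr.
- exact: X0.
rewrite /p /q /even_part /odd_part tX => /eqP; rewrite subr_eq0 => /eqP -> .
rewrite -mulrBr => /eqP; rewrite mulf_eq0 subr_eq0 => /orP[|/eqP -> //].
move: X0; rewrite le_eqVlt => /predU1P[X0|X0].
  by move: tX; rewrite -X0 j0 => <-.
by rewrite fmorph_eq0 gt_eqF// sinh_gt0.
Qed.

End JacobiForm.

(** * Gluing the Gauss series and Pfaff's formula *)

Section GluedSolution.
Variable R : realType.
Implicit Types (a b : R[i]) (c t : R).

(* The Gauss series covers ]-1, 1[ and Pfaff's formula ]-oo, 1/2[. *)
Definition hyp_fun a b c t : R[i] :=
  if t < 0 then pfaff_fun a (c%:C - b) c t else csum (gauss_coef a b c%:C) t.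

Lemma near_hyp_system a b c f g f' g' t :
  (\forall s \near t, f s = f' s) -> (\forall s \near t, g s = g' s) ->
  hyp_system a b c f g t -> hyp_system a b c f' g' t.
Proof.
move=> ff' gg' [df [dg hdg e]]; split.
  by rewrite -(nbhs_singleton gg'); exact: near_cder df.
exists dg; first exact: near_cder hdg.
by rewrite -(nbhs_singleton gg') -(nbhs_singleton ff').
Qed.

(** On [[t, 0]] both pairs solve the same system, and all four functions equal 1 at 0. *)
Lemma gauss_pfaff a b c t : 2^-1 <= c -> a + b + 1 = (2 * c)%:C ->
  -1 < t <= 0 ->
  pfaff_fun a (c%:C - b) c t = csum (gauss_coef a b c%:C) t /\
  pfaff_fun (a + 1) (c%:C - b) (c + 1) t =
    csum (gauss_coef (a + 1) (b + 1) (c + 1)%:C) t.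
Proof.
move=> c2 abc /andP[t1 t0]; have c0 : 0 < c by lra.
apply: (hyp_system_unique c2 abc) => //.
- by move=> s /andP[ts s0]; apply: pfaff_hyp_system => //; lra.
- move=> s /andP[ts s0]; apply: gauss_hyp_system => //.
  by rewrite ltr_norml; lra.
- by rewrite pfaff_fun0 gauss_csum0.
- by rewrite pfaff_fun0 gauss_csum0.
Qed.

Lemma hyp_fun_gauss a b c t : 2^-1 <= c -> a + b + 1 = (2 * c)%:C ->
  `|t| < 1 -> hyp_fun a b c t = csum (gauss_coef a b c%:C) t.
Proof.
move=> c2 abc; rewrite ltr_norml => /andP[t1 t2]; rewrite /hyp_fun.
by case: ltP => // t0; apply: (gauss_pfaff c2 abc _).1; rewrite t1 ltW.
Qed.

Lemma abc_next a b c : a + b + 1 = (2 * c)%:C ->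
  (a + 1) + (b + 1) + 1 = (2 * (c + 1))%:C.
Proof.
move=> h; have -> : a + 1 + (b + 1) + 1 = a + b + 1 + 2 by ring.
by rewrite h mulrDr mulr1 rmorphD rmorph_nat.
Qed.

(** At [t >= 0], in particular at 0 where the definition switches branch, the Gauss series
    represents both glued functions in a whole neighbourhood. *)
Lemma hyp_fun_system a b c t : 2^-1 <= c -> a + b + 1 = (2 * c)%:C ->
  t < 1 -> hyp_system a b c (hyp_fun a b c) (hyp_fun (a + 1) (b + 1) (c + 1)) t.
Proof.
move=> c2 abc t1; have c0 : 0 < c by lra.
have c21 : 2^-1 <= c + 1 by lra.
have abc1 := abc_next abc.
have bc : (c + 1)%:C - (b + 1) = c%:C - b by rewrite rmorphD rmorph1; ring.
have [t0|t0] := ltP t 0.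
  apply: near_hyp_system (pfaff_hyp_system a b c0 (_ : t < 2^-1)); last by lra.
    near=> s; have s0 : s < 0 by near: s; exact: lt_nbhsl.
    by rewrite /hyp_fun s0.
  near=> s; have s0 : s < 0 by near: s; exact: lt_nbhsl.
  by rewrite /hyp_fun s0 bc.
have tn : `|t| < 1 by rewrite ltr_norml; lra.
apply: near_hyp_system (gauss_hyp_system a b c0 tn).
  near=> s; rewrite hyp_fun_gauss//.
  rewrite ltr_norml; apply/andP; split; near: s.
    by apply: lt_nbhsr; lra.
  exact: lt_nbhsl.
near=> s; rewrite hyp_fun_gauss//.
rewrite ltr_norml; apply/andP; split; near: s.
  by apply: lt_nbhsr; lra.
exact: lt_nbhsl.
Unshelve. all: end_near. Qed.

End GluedSolution.

(** * Power series solutions at regular points *)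

Section LocalAnalyticity.
Variable R : realType.
Implicit Types (a b : R[i]) (c t : R).

Section Recursion.
Variables (a b : R[i]) (c x0 : R) (f0 g0 : R[i]).
(** Coefficients of the system recentred at [x0]: with [t = x0 + s], [t (1 - t) = p0 + p1 s - s^2]
    and [c - (a + b + 1) t = q0 + q1 s]. *)
Let p0 : R[i] := (x0 * (1 - x0))%:C.
Let p1 : R[i] := (1 - 2 * x0)%:C.
Let q0 : R[i] := c%:C - (a + b + 1) * x0%:C.
Let q1 : R[i] := - (a + b + 1).

(* Taylor coefficients at x0 of a solution of the hypergeometric system; the
   third component remembers the previous coefficient of g. *)
Fixpoint taylor_rec (n : nat) : R[i] * R[i] * R[i] :=
  if n is k.+1 then
    let: (F, G, G') := taylor_rec k in
    (a * b / c%:C * (k.+1%:R^-1 * G),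
     p0^-1 * (k.+1%:R^-1 * (c%:C * F - q0 * G - q1 * G' - p1 * (k%:R * G)
        + (k%:R - 1) * G')), G)
  else (f0, g0, 0).

Definition taylor_f n := (taylor_rec n).1.1.
Definition taylor_g n := (taylor_rec n).1.2.

Lemma taylor_recE n : taylor_rec n = (taylor_f n, taylor_g n, shift_seq taylor_g n).
Proof.
rewrite /taylor_f /taylor_g; case: n => [|n] //=.
by case: (taylor_rec n) => [[F G] G'].
Qed.

Lemma taylor_fS n : taylor_f n.+1 = a * b / c%:C * (n.+1%:R^-1 * taylor_g n).
Proof. by rewrite {1}/taylor_f /= taylor_recE. Qed.

Lemma taylor_gS n : taylor_g n.+1 =
   p0^-1 * (n.+1%:R^-1 * (c%:C * taylor_f n - q0 * taylor_g n
     - q1 * shift_seq taylor_g n - p1 * (n%:R * taylor_g n)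
        + (n%:R - 1) * shift_seq taylor_g n)).
Proof. by rewrite {1}/taylor_g /= taylor_recE. Qed.

Lemma cnorm1_invn n : cnorm1 (n.+1%:R^-1 : R[i]) = n.+1%:R^-1.
Proof.
by rewrite -(rmorph_nat (real_complex R)) -fmorphV cnorm1_real ger0_norm ?invr_ge0.
Qed.

Lemma cnorm1_ratio n : cnorm1 (n.+1%:R^-1 * n%:R : R[i]) <= 1.
Proof.
apply: le_trans (cnorm1M _ _) _; rewrite cnorm1_invn cnorm1_nat.
by rewrite mulrC ler_pdivrMr// mul1r ler_nat.
Qed.

Lemma cnorm1_ratio' n : cnorm1 (n.+1%:R^-1 * (n%:R - 1) : R[i]) <= 1.
Proof.
apply: le_trans (cnorm1M _ _) _; rewrite cnorm1_invn.
rewrite -(rmorph_nat (real_complex R)) -(rmorph1 (real_complex R)) -rmorphB cnorm1_real.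
rewrite mulrC ler_pdivrMr// mul1r -natr1 ler_norml.
by have : 0 <= n%:R :> R by []; move=> h; apply/andP; split; lra.
Qed.

Lemma cnorm1_invn_le1 n : cnorm1 (n.+1%:R^-1 : R[i]) <= 1.
Proof. by rewrite cnorm1_invn invf_le1// ler1n. Qed.

(** Taken together, the norms of the three components satisfy a first-order recursion with
    coefficients bounded in [n], so they grow at most geometrically. The summand 1 in [rho] pays for
    the component that only copies [taylor_g]. *)
Lemma taylor_cgeo : exists2 rho : R, 0 < rho & cgeo taylor_f rho /\ cgeo taylor_g rho.
Proof.
pose N n := cnorm1 (taylor_f n) + cnorm1 (taylor_g n) + cnorm1 (shift_seq taylor_g n).
pose K1 := cnorm1 (a * b / c%:C).
pose K2 := cnorm1 p0^-1 * (cnorm1 c%:C + cnorm1 q0 + cnorm1 q1 + cnorm1 p1 + 1).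
have K10 : 0 <= K1 by exact: cnorm1_ge0.
have K20 : 0 <= K2 by rewrite mulr_ge0 ?addr_ge0 ?cnorm1_ge0.
pose rho := K1 + K2 + 1.
have r0 : 0 < rho by rewrite ltr_wpDl// addr_ge0.
have N0 n : 0 <= N n by rewrite !addr_ge0 ?cnorm1_ge0.
have mul (z w u : R[i]) : cnorm1 z <= 1 -> cnorm1 (w * (z * u)) <= cnorm1 w * cnorm1 u.
  move=> z1; apply: le_trans (cnorm1M _ _) _; rewrite ler_wpM2l ?cnorm1_ge0//.
  apply: le_trans (cnorm1M _ _) _; rewrite -[leRHS]mul1r ler_wpM2r ?cnorm1_ge0//.
have step n : N n.+1 <= rho * N n.
  have NF : cnorm1 (taylor_f n) <= N n.
    by rewrite /N -addrA lerDl addr_ge0 ?cnorm1_ge0.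
  have NG : cnorm1 (taylor_g n) <= N n.
    by rewrite /N addrAC lerDr addr_ge0 ?cnorm1_ge0.
  have NS : cnorm1 (shift_seq taylor_g n) <= N n.
    by rewrite /N lerDr addr_ge0 ?cnorm1_ge0.
  have hF : cnorm1 (taylor_f n.+1) <= K1 * N n.
    rewrite taylor_fS; apply: le_trans (mul _ _ _ (cnorm1_invn_le1 _)) _.
    by rewrite ler_wpM2l.
  have hG : cnorm1 (taylor_g n.+1) <= K2 * N n.
    rewrite taylor_gS /K2 -mulrA; apply: le_trans (cnorm1M _ _) _.
    rewrite ler_wpM2l ?cnorm1_ge0//.
    have -> : n.+1%:R^-1 * (c%:C * taylor_f n - q0 * taylor_g n -
       q1 * shift_seq taylor_g n - p1 * (n%:R * taylor_g n) +
       (n%:R - 1) * shift_seq taylor_g n) =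
      c%:C * (n.+1%:R^-1 * taylor_f n) + - q0 * (n.+1%:R^-1 * taylor_g n)
      + - q1 * (n.+1%:R^-1 * shift_seq taylor_g n)
      + - p1 * ((n.+1%:R^-1 * n%:R) * taylor_g n)
      + 1 * ((n.+1%:R^-1 * (n%:R - 1)) * shift_seq taylor_g n) by ring.
    have m (w z u : R[i]) : cnorm1 z <= 1 -> cnorm1 u <= N n ->
        cnorm1 (w * (z * u)) <= cnorm1 w * N n.
      by move=> z1 uN; apply: le_trans (mul _ _ _ z1) _; rewrite ler_wpM2l ?cnorm1_ge0.
    have distr (A B C D : R) :
      (A + B + C + D + 1) * N n = A * N n + B * N n + C * N n + D * N n + 1 * N n by ring.
    rewrite distr.
    apply: le_trans (cnorm1D _ _) (lerD _ _); last first.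
      have -> : 1 = cnorm1 (1 : R[i]) by rewrite -(rmorph1 (real_complex R)) cnorm1_real normr1.
      by apply: m => //; exact: cnorm1_ratio'.
    apply: le_trans (cnorm1D _ _) (lerD _ _); last first.
      by rewrite -(cnorm1N p1); apply: m => //; exact: cnorm1_ratio.
    apply: le_trans (cnorm1D _ _) (lerD _ _); last first.
      by rewrite -(cnorm1N q1); apply: m => //; exact: cnorm1_invn_le1.
    apply: le_trans (cnorm1D _ _) (lerD _ _); last first.
      by rewrite -(cnorm1N q0); apply: m => //; exact: cnorm1_invn_le1.
    by apply: m => //; exact: cnorm1_invn_le1.
  have -> : rho * N n = K1 * N n + K2 * N n + N n by rewrite /rho; ring.
  rewrite {1}/N /=.
  by apply: lerD => //; apply: lerD.
have NA n : N n <= N 0%N * rho ^+ n.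
  elim: n => [|n ih]; first by rewrite expr0 mulr1.
  by apply: le_trans (step n) _; rewrite exprS mulrCA ler_wpM2l// ltW.
exists rho => //; split; exists (N 0%N) => n; apply: le_trans (NA n).
  by rewrite /N -addrA lerDl addr_ge0 ?cnorm1_ge0.
by rewrite /N addrAC lerDr addr_ge0 ?cnorm1_ge0.
Qed.

Lemma taylor_sum_system s rho : 0 < rho -> cgeo taylor_f rho -> cgeo taylor_g rho ->
  rho * `|s| < 1 -> x0 * (1 - x0) != 0 ->
  [/\ cder (csum taylor_f) s (a * b / c%:C * csum taylor_g s),
   cder (csum taylor_g) s (csum (cdiffs taylor_g) s) &
   ((x0 + s) * (1 - (x0 + s)))%:C * csum (cdiffs taylor_g) s =
    c%:C * csum taylor_f s - (c%:C - (a + b + 1) * (x0 + s)%:C) * csum taylor_g s].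
Proof.
move=> r0 gf gg rs x00.
have F := cgeo_is_csum r0 gf rs; have G := cgeo_is_csum r0 gg rs.
have DF := cgeo_cdiffs_is_csum r0 gf rs; have D := cgeo_cdiffs_is_csum r0 gg rs.
have e1 : csum (cdiffs taylor_f) s = a * b / c%:C * csum taylor_g s.
  apply: is_csum_unique DF _; apply: is_csum_ext (is_csumZ (a * b / c%:C) G) => n.
  by rewrite /cdiffs taylor_fS [RHS]mulrCA mulVKf ?natC_neq0.
split.
- by rewrite -e1; apply: cder_csum gf rs.
- by apply: cder_csum gg rs.
have L := is_csumD (is_csumZ p0 D) (is_csumD (is_csumZ p1 (is_csumX D))
  (is_csumZ (-1) (is_csumX (is_csumX D)))).
have M := is_csumD (is_csumZ c%:C F) (is_csumD (is_csumZ (- q0) G)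
  (is_csumZ (- q1) (is_csumX G))).
have p00 : p0 != 0 by rewrite fmorph_eq0.
have LM : (fun n => p0 * cdiffs taylor_g n + (p1 * shift_seq (cdiffs taylor_g) n
    + -1 * shift_seq (shift_seq (cdiffs taylor_g)) n)) =1
  (fun n => c%:C * taylor_f n + (- q0 * taylor_g n + - q1 * shift_seq taylor_g n)).
  move=> n; rewrite {1}/cdiffs taylor_gS mulrCA !mulVKf// ?natC_neq0//.
  by case: n => [|[|n]]; rewrite /= /cdiffs -?natr1; ring.
have := is_csum_unique (is_csum_ext LM L) M => H.
transitivity (p0 * csum (cdiffs taylor_g) s + (p1 * (s%:C * csum (cdiffs taylor_g) s)
   + -1 * (s%:C * (s%:C * csum (cdiffs taylor_g) s)))).
  by rewrite /p0 /p1 !rmorphM !rmorphB !rmorphD !rmorphM rmorph1 rmorph_nat; ring.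
by rewrite H /q0 /q1 rmorphD; ring.
Qed.

End Recursion.

Lemma is_derive_subr (x0 t : R) : is_derive t (1 : R) (fun t => t - x0) 1.
Proof.
apply: is_derive_ext (is_deriveB (is_derive_id t (1 : R)) (is_derive_cst x0 t 1)) => //.
by rewrite subr0.
Qed.

(** The Taylor series with initial values [f x0] and [g x0] solves the same system. Near [x0] the
    factor [t (1 - t)] stays away from 0, so uniqueness for regular linear systems identifies the
    series with [f] and [g]. *)
Lemma hyp_system_analytic a b c f g (x0 : R) : x0 != 0 -> x0 < 1 ->
  (forall t, t < 1 -> hyp_system a b c f g t) ->
  real_analytic_at f x0 /\ real_analytic_at g x0.
Proof.
move=> x00 x01 sys.
pose u := taylor_f a b c x0 (f x0) (g x0).
pose v := taylor_g a b c x0 (f x0) (g x0).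
have [rho r0 [gu gv]] := taylor_cgeo a b c x0 (f x0) (g x0).
have x01' : x0 * (1 - x0) != 0 by rewrite mulf_neq0// subr_eq0 gt_eqF.
(* The three bounds keep the series inside its disc of convergence, [|t|] above [|x0| / 2] and
   [1 - t] above [(1 - x0) / 2]; the last two yield the lower bound [kap]. *)
pose d := Num.min (rho^-1 / 2) (Num.min (`|x0| / 2) ((1 - x0) / 2)).
have ir0 : 0 < rho^-1 by rewrite invr_gt0.
have x00' : 0 < `|x0| by rewrite normr_gt0.
have d0 : 0 < d by rewrite !lt_min; apply/and3P; split; lra.
have dE : [/\ d <= rho^-1 / 2, d <= `|x0| / 2 & d <= (1 - x0) / 2].
  by rewrite /d !ge_min !lexx !orbT.
case: dE => d1 d2 d3.
pose kap : R := (`|x0| / 2) * ((1 - x0) / 2).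
have kap0 : 0 < kap by rewrite mulr_gt0//; lra.
have low t : `|t - x0| <= d -> kap <= `|t * (1 - t)|.
  rewrite ler_norml => /andP[h1 h2]; rewrite normrM ler_pM//; try lra.
    have := lerB_normD t (x0 - t); rewrite addrCA subrr addr0.
    have : `|x0 - t| <= d by rewrite ler_norml; lra.
    have := lerB_dist x0 (x0 - t); rewrite opprB addrCA subrr addr0; lra.
  rewrite ger0_norm; lra.
pose e t : R[i] := f t - csum u (t - x0); pose h t : R[i] := g t - csum v (t - x0).
pose inr t := `|t - x0| <= d.
have inr_rho t : inr t -> rho * `|t - x0| < 1.
  move=> ht; rewrite -ltr_pdivlMl// mulr1.
  by apply: le_lt_trans ht _; apply: le_lt_trans d1 _; lra.
have inr1 t : inr t -> t < 1 by rewrite /inr ler_norml; lra.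
pose le t : R[i] := a * b / c%:C * h t.
pose lh t : R[i] := (t * (1 - t))^-1%:C * (c%:C * e t - (c%:C - (a + b + 1) * t%:C) * h t).
have der t : inr t -> cder e t (le t) /\ cder h t (lh t).
  move=> ht; have t1 := inr1 _ ht; have tr := inr_rho _ ht.
  have [df [dg hdg eg]] := sys _ t1.
  have [ds1 ds2 es] := taylor_sum_system r0 gu gv tr x01'.
  have c1 := @cder_comp _ (csum u) (fun t => t - x0) t _ _ ds1 (is_derive_subr x0 t).
  have c2 := @cder_comp _ (csum v) (fun t => t - x0) t _ _ ds2 (is_derive_subr x0 t).
  split.
    have := cderB df c1; congr (cder _ _ _); rewrite /le /h /v rmorph1; ring.
  have := cderB hdg c2; congr (cder _ _ _).
  have w0 : t * (1 - t) != 0.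
    by rewrite -normr_gt0; apply: lt_le_trans (low _ ht).
  have w0C : (t * (1 - t))%:C != 0 :> R[i] by rewrite fmorph_eq0.
  apply: (mulfI w0C); rewrite /lh mulrA -rmorphM mulfV// rmorph1 !mul1r mulrBr eg.
  move: es; rewrite (_ : x0 + (t - x0) = t); last by ring.
  by move=> ->; rewrite /e /h /u /v; ring.
have ck0 : 0 <= kap^-1 by rewrite invr_ge0 ltW.
have xd0 : 0 <= `|x0| + d by rewrite addr_ge0 ?ltW.
pose K1 := cnorm1 (a * b / c%:C).
pose K2 := kap^-1 * (cnorm1 c%:C + (cnorm1 c%:C + cnorm1 (a + b + 1) * (`|x0| + d))).
have K10 : 0 <= K1 by exact: cnorm1_ge0.
have K20 : 0 <= K2.
  apply: mulr_ge0 => //; apply: addr_ge0; first exact: cnorm1_ge0.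
  apply: addr_ge0; first exact: cnorm1_ge0.
  by apply: mulr_ge0 => //; exact: cnorm1_ge0.
pose K := K1 + K2.
have K0 : 0 <= K by apply: addr_ge0.
have bnd t : inr t -> cnorm1 (le t) <= K * (cnorm1 (e t) + cnorm1 (h t)) /\
    cnorm1 (lh t) <= K * (cnorm1 (e t) + cnorm1 (h t)).
  move=> ht.
  have E0 := cnorm1_ge0 (e t); have H0 := cnorm1_ge0 (h t).
  split.
    apply: le_trans (cnorm1M _ _) _; rewrite -/K1 /K.
    have := mulr_ge0 K10 E0; have := mulr_ge0 K20 E0; have := mulr_ge0 K20 H0; nra.
  apply: (@le_trans _ _ (K2 * (cnorm1 (e t) + cnorm1 (h t)))); last first.
    rewrite /K ler_wpM2r ?addr_ge0//; lra.
  apply: le_trans (cnorm1M _ _) _; rewrite /K2 -mulrA; apply: ler_pM.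
  - exact: cnorm1_ge0.
  - exact: cnorm1_ge0.
  - rewrite cnorm1_real normfV lef_pV2 ?posrE ?low//.
    by apply: lt_le_trans (low _ ht).
  apply: le_trans (cnorm1D _ _) _; rewrite cnorm1N.
  have q1 : cnorm1 (c%:C - (a + b + 1) * t%:C) <=
      cnorm1 c%:C + cnorm1 (a + b + 1) * (`|x0| + d).
    apply: le_trans (cnorm1D _ _) _; rewrite cnorm1N lerD2l.
    apply: le_trans (cnorm1M _ _) _; rewrite ler_wpM2l ?cnorm1_ge0// cnorm1_real.
    rewrite -[t](subrK x0) addrC; apply: le_trans (ler_normD _ _) _.
    by rewrite lerD2l.
  have h1 := cnorm1M c%:C (e t).
  have h2 := cnorm1M (c%:C - (a + b + 1) * t%:C) (h t).
  have h3 := ler_wpM2r H0 q1.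
  have h4 : 0 <= (cnorm1 c%:C + cnorm1 (a + b + 1) * (`|x0| + d)) * cnorm1 (e t).
    apply: mulr_ge0 => //; apply: addr_ge0; first exact: cnorm1_ge0.
    by apply: mulr_ge0 => //; exact: cnorm1_ge0.
  have h5 : 0 <= cnorm1 c%:C * cnorm1 (h t) by rewrite mulr_ge0 ?cnorm1_ge0.
  move: h1 h2 h3 h4 h5; lra.
have zero t : inr t -> e t = 0 /\ h t = 0.
  move=> ht.
  have sub s : x0 <= s <= t \/ t <= s <= x0 -> inr s.
    by move: ht; rewrite /inr !ler_norml => /andP[? ?] [] /andP[? ?]; lra.
  apply: (linear_system_unique K0) => [s /sub hs|s /sub hs||].
  - exact: der.
  - exact: bnd.
  - by rewrite /e subrr csum0 subrr.
  - by rewrite /h subrr csum0 subrr.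
have near_inr : \forall t \near x0, inr t.
  apply: filterS (nbhsx_ballx x0 d d0) => t; rewrite /ball/= distrC /inr.
  exact: ltW.
split.
- exists u; apply: filterS near_inr => t ht; apply/pseries_sumP.
  have [/eqP] := zero _ ht; rewrite subr_eq0 => /eqP -> _.
  by apply: cgeo_is_csum gu (inr_rho _ ht).
- exists v; apply: filterS near_inr => t ht; apply/pseries_sumP.
  have [_ /eqP] := zero _ ht; rewrite subr_eq0 => /eqP ->.
  by apply: cgeo_is_csum gv (inr_rho _ ht).
Qed.

End LocalAnalyticity.

(** * Identity theorem and the value of the continuation *)

Section IdentityTheorem.
Variable R : realType.

(** Abel: the terms of a convergent series are bounded. *)
Lemma pseries_cvg_geo_bounded (c : nat -> R) (h : R) : h != 0 ->
  cvgn (pseries c h) -> geo_bounded c `|h|^-1.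
Proof.
move=> h0 /cvg_series_cvg_0 ch.
have := cvg_seq_bounded (cvgP _ ch) => -[M [_ hM]].
exists (M + 1) => n; have MM : M < M + 1 by rewrite ltrDl.
have := hM _ MM n I; rewrite /= normrM normrX => hn.
by rewrite exprVn ler_pdivlMr// exprn_gt0// normr_gt0.
Qed.

(** The sum is continuous at 0, so the constant coefficient is its limit from the right, which is 0.
    Dividing by [h] shifts the coefficients and allows induction. *)
Lemma pseries_eq0 (c : nat -> R) (d : R) : 0 < d ->
  (forall h : R, 0 < h < d -> pseries c h @ \oo --> (0 : R)) -> forall n, c n = 0.
Proof.
move=> d0 hc.
have first (e : nat -> R) : (forall h : R, 0 < h < d -> pseries e h @ \oo --> (0 : R)) ->
    e 0%N = 0.
  move=> he; have d2 : 0 < d / 2 < d by lra.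
  have d2n : d / 2 != 0 by rewrite gt_eqF//; lra.
  have g := pseries_cvg_geo_bounded d2n (cvgP _ (he _ d2)).
  have nd2 : `|d / 2| = d / 2 by rewrite ger0_norm//; lra.
  have D : is_derive (0 : R) (1 : R) (fun x => limn (pseries e x))
      (limn (pseries (pseries_diffs e) 0)).
    by apply: geo_bounded_derive g _; rewrite ?normr0 ?mulr0// invr_gt0 nd2; lra.
  have C : {for (0 : R), continuous (fun x => limn (pseries e x))}.
    exact: is_derive_continuous D.
  have c0 : limn (pseries e 0) = e 0%N.
    apply: cvg_lim => //; apply: cvg_near_cst; exists 1%N => // k /= k0.
    rewrite /pseries /series /= big_ltn// expr0 mulr1 big_nat big1 ?addr0//.
    by move=> i /andP[i0 _]; rewrite expr0n gtn_eqF// mulr0.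
  rewrite -c0; apply: (@cvg_unique _ _ ((fun x => limn (pseries e x)) @ 0^'+)) => //.
    exact: cvg_at_right_filter C.
  apply: cvg_near_cst; near=> x; apply: cvg_lim => //; apply: he.
  apply/andP; split; near: x; first exact: nbhs_right_gt.
  exact: nbhs_right_lt.
move=> n; elim: n c hc => [|n ih] c hc; first exact: first.
apply: (ih (fun k => c k.+1)) => h hd.
have h0 : h != 0 by case/andP: hd => h0 _; rewrite gt_eqF.
have := hc h hd; rewrite -(cvg_shiftS (pseries c h)).
have -> : (fun n => pseries c h n.+1) = (fun n => h * pseries (fun k => c k.+1) h n).
  apply/funext => k; rewrite /pseries /series /= big_nat_recl// (first c hc) mul0r add0r.
  by rewrite mulr_sumr; apply: eq_bigr => i _; rewrite exprS; ring.
move=> L0; have L : (fun k => h^-1 * (h * pseries (fun k => c k.+1) h k)) @ \oo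
    --> h^-1 * (0 : R) by apply: cvgM L0; exact: cvg_cst.
rewrite mulr0 in L; suff <- : (fun k => h^-1 * (h * pseries (fun k => c k.+1) h k)) =
   pseries (fun k => c k.+1) h by exact: L.
by apply/funext => k; rewrite mulKf.
Unshelve. all: end_near. Qed.

Lemma is_csum_eq0 (u : nat -> R[i]) (d : R) : 0 < d ->
  (forall h : R, 0 < h < d -> is_csum u h 0) -> forall n, u n = 0.
Proof.
move=> d0 hu n; apply: complex_ext.
- by apply: (@pseries_eq0 (re_seq u) d d0) => h /hu[].
- by apply: (@pseries_eq0 (im_seq u) d d0) => h /hu[].
Qed.

(* If f1 and f2 differed at some t < 0, the supremum of the points where they
   differ would be a point at whose right they agree. *)
Lemma real_analytic_identity (f1 f2 : R -> R[i]) (r : R) : 0 < r ->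
  (forall x : R, x <= 0 -> real_analytic_at f1 x) ->
  (forall x : R, x <= 0 -> real_analytic_at f2 x) ->
  (forall x, `|x| < r -> f1 x = f2 x) -> forall t : R, t <= 0 -> f1 t = f2 t.
Proof.
move=> r0 a1 a2 f12 t t0; apply/eqP/negPn/negP => ft.
pose A : set R := [set x | x <= 0 /\ f1 x != f2 x].
have At : A t by split.
have hA : has_sup A by split; [exists t|exists 0 => x []].
have s0 : sup A <= 0 by apply: ge_sup; [exists t|move=> x []].
have sr : sup A <= - r.
  apply: ge_sup; first by exists t.
  move=> x [x0 fx]; rewrite leNgt; apply/negP => rx; move/eqP: fx; apply.
  by apply: f12; rewrite ltr_norml; lra.
have above x : sup A < x <= 0 -> f1 x = f2 x.
  move=> /andP[sx x0]; apply/eqP/negPn/negP => fx.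
  have : x <= sup A by apply: ub_le_sup => //; case: hA.
  by rewrite leNgt sx.
have [u1 hu1] := a1 _ s0; have [u2 hu2] := a2 _ s0.
have [e /= e0 he] : exists2 e : R, 0 < e & forall x, `|x - sup A| < e ->
    pseries_sum u1 (x - sup A) (f1 x) /\ pseries_sum u2 (x - sup A) (f2 x).
  case: (filterI hu1 hu2) => e /= e0 he.
  by exists e => // x hx; apply: he; rewrite /= distrC.
(* Since [sup A <= - r], a step smaller than [r] to the right of [sup A] stays negative, in the
   region where [above] applies. *)
pose d := Num.min e r.
have d0 : 0 < d by rewrite lt_min e0 r0.
have dd x : `|x - sup A| < e -> is_csum (fun n => u1 n + -1 * u2 n) (x - sup A) (f1 x - f2 x).
  move=> /he[/pseries_sumP h1 /pseries_sumP h2].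
  by have := is_csumD h1 (is_csumZ (-1) h2); rewrite mulN1r.
have z := @is_csum_eq0 (fun n => u1 n + -1 * u2 n) d d0.
have {}z n : u1 n + -1 * u2 n = 0.
  apply: z => h /andP[h0]; rewrite lt_min => /andP[he' hr].
  have := dd (h + sup A); rewrite addrK => /(_ _)/[!gtr0_norm]//.
  by rewrite (above (h + sup A)) ?subrr; [apply|lra].
have near_eq x : `|x - sup A| < e -> f1 x = f2 x.
  move=> /dd h; apply/eqP; rewrite -subr_eq0; apply/eqP.
  apply: is_csum_unique h _.
  have -> : (fun n => u1 n + -1 * u2 n) = (fun n => 0 * u1 n).
    by apply/funext => n; rewrite z mul0r.
  have : `|sup A - sup A| < e by rewrite subrr normr0.
  move=> /he _; rewrite -(mul0r (0 : R[i])).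
  have p0 (w : nat -> R) : (forall n, w n = 0) ->
      pseries w (x - sup A) @ \oo --> (0 : R).
    move=> w0; apply: cvg_near_cst; near=> n.
    by rewrite /pseries /series /= big1// => i _; rewrite w0 mul0r.
  by split; rewrite !mul0r; apply: p0 => n; rewrite /re_seq /im_seq mul0r.
have [x Ax sx] := sup_adherent e0 hA.
have xs : x <= sup A by apply: ub_le_sup Ax; case: hA.
case: Ax => _ /eqP; apply; apply: near_eq.
by rewrite ltr_norml; lra.
Unshelve. all: end_near. Qed.

Lemma real_analytic_gauss (a b : R[i]) (c : R) (f : R -> R[i]) : 0 < c ->
  (forall x, `|x| < 1 -> pseries_sum (gauss_coef a b c%:C) x (f x)) ->
  real_analytic_at f 0.
Proof.
move=> c0 hf; exists (gauss_coef a b c%:C); near=> x; rewrite subr0; apply: hf.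
near: x; exists (1 : R); first exact: ltr01.
by move=> x /=; rewrite sub0r normrN.
Unshelve. all: end_near. Qed.

(** The system is singular at 0, so analyticity there is taken from the Gauss series itself; every
    other point below 1 is regular. *)
Lemma hyp_fun_continuation (a b : R[i]) (c : R) : 2^-1 <= c ->
  a + b + 1 = (2 * c)%:C -> gauss_continuation a b c%:C (hyp_fun a b c).
Proof.
move=> c2 abc; have c0 : 0 < c by lra.
have G x : `|x| < 1 -> pseries_sum (gauss_coef a b c%:C) x (hyp_fun a b c x).
  by move=> x1; apply/pseries_sumP; rewrite hyp_fun_gauss//; exact: gauss_is_csum.
split=> // x x1; have [->|x0] := eqVneq x 0; first exact: real_analytic_gauss G.
exact: (hyp_system_analytic x0 x1 (fun t => hyp_fun_system c2 abc)).1.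
Qed.

(** The glued solution excludes the default value of [xget], and the identity theorem shows that any
    continuation agrees with it on the nonpositive axis. *)
Lemma hyp2F1E (a b : R[i]) (c t : R) : 2^-1 <= c -> a + b + 1 = (2 * c)%:C ->
  t <= 0 -> hyp2F1 a b c%:C t = hyp_fun a b c t.
Proof.
move=> c2 abc t0; have H := hyp_fun_continuation c2 abc.
rewrite /hyp2F1; case: xgetP => [w _ [f [f1 f2] <-]|/(_ (hyp_fun a b c t))].
  apply: (@real_analytic_identity _ _ 1 _ _ _ _ t t0) => //.
  - by move=> x x0; apply: f2; lra.
  - by move=> x x0; apply: H.2; lra.
  - move=> x x1; apply: is_csum_unique; apply/pseries_sumP; first exact: f1.
    exact: H.1.
by case; exists (hyp_fun a b c).
Qed.

End IdentityTheorem.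

(** * Weighted integrals *)

Section OpenIntervals.
Variable R : realType.
Local Notation mu := (@lebesgue_measure R).
Implicit Types (F G h k : R -> R) (a b : R).

(** Cuts for an exhaustion of []a, b[] by compact intervals. The offset 3 keeps each cut below half
    of the length from [n = 0] on. *)
Definition inner_left a b (n : nat) : R := a + (b - a) / n.+3%:R.
Definition inner_right a b (n : nat) : R := b - (b - a) / n.+3%:R.
Definition inner_itv a b n : set R := `[inner_left a b n, inner_right a b n]%classic.

Lemma inner_bounds a b n : a < b ->
  [/\ a < inner_left a b n, inner_left a b n < inner_right a b n
    & inner_right a b n < b].
Proof.
move=> ab; rewrite /inner_left /inner_right.
have n3 : (3 : R) <= n.+3%:R by rewrite ler_nat.
have i0 : 0 < n.+3%:R^-1 :> R by rewrite invr_gt0 ltr0n.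
have i1 : (n.+3%:R^-1 : R) <= 3^-1 by rewrite lef_pV2// posrE ltr0n.
have ba : 0 < b - a by lra.
have h1 : 0 < (b - a) / n.+3%:R by rewrite mulr_gt0.
have h2 : (b - a) / n.+3%:R <= (b - a) / 3 by rewrite ler_wpM2l// ltW.
move: ((b - a) / n.+3%:R) h1 h2 => r h1 h2.
by split; lra.
Qed.

Lemma inner_itv_sub a b n : a < b -> inner_itv a b n `<=` `]a, b[%classic.
Proof.
move=> ab x; have [h1 h2 h3] := inner_bounds n ab.
by rewrite /inner_itv /= !in_itv/= => /andP[h4 h5]; lra.
Qed.

Lemma inner_step a b n m : a < b -> (n <= m)%N ->
  inner_left a b m <= inner_left a b n /\ inner_right a b n <= inner_right a b m.
Proof.
move=> ab nm; rewrite /inner_left /inner_right.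
have i1 : (m.+3%:R^-1 : R) <= n.+3%:R^-1 by rewrite lef_pV2 ?posrE ?ltr0n// ler_nat.
have ba : 0 <= b - a by lra.
have h : (b - a) / m.+3%:R <= (b - a) / n.+3%:R by rewrite ler_wpM2l.
move: ((b - a) / n.+3%:R) ((b - a) / m.+3%:R) h => r s h.
by split; lra.
Qed.

Lemma inner_itv_nd a b : a < b -> nondecreasing_seq (inner_itv a b).
Proof.
move=> ab n m nm; apply/subsetPset => x; rewrite /inner_itv/= !in_itv/=.
by have [h1 h2] := inner_step ab nm; move=> /andP[h3 h4]; lra.
Qed.

Lemma inner_gap_small a b e : a < b -> 0 < e -> exists N, forall n, (N <= n)%N ->
  (b - a) / n.+3%:R < e.
Proof.
move=> ab e0; exists (Num.truncn ((b - a) / e)).+1 => n Nn.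
rewrite ltr_pdivrMr ?ltr0n// mulrC -ltr_pdivrMr//.
apply: lt_le_trans (real_truncnS_gt (num_real _)) _.
by rewrite ler_nat (leq_trans Nn)// -addn3 leq_addr.
Qed.

Lemma inner_itv_bigcup a b : a < b -> \bigcup_n inner_itv a b n = `]a, b[%classic.
Proof.
move=> ab; apply/seteqP; split => [x [n _] /(inner_itv_sub ab)//|x].
rewrite /= in_itv/= => /andP[ax xb].
have h1 : 0 < x - a by lra.
have h2 : 0 < b - x by lra.
have [N hN] := inner_gap_small ab h1; have [M hM] := inner_gap_small ab h2.
exists (maxn N M) => //; rewrite /inner_itv /= in_itv/= /inner_left /inner_right.
have := hN (maxn N M) (leq_maxl _ _); have := hM (maxn N M) (leq_maxr _ _).
by move: ((b - a) / _) => r h3 h4; lra.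
Qed.

Lemma inner_left_cvg a b : a < b -> inner_left a b n @[n --> \oo] --> a.
Proof.
move=> ab; apply/cvgrPdist_lt => e e0; have [N hN] := inner_gap_small ab e0.
exists N => // n /= /hN h; have [h1 _ _] := inner_bounds n ab.
rewrite distrC ger0_norm ?subr_ge0 ?ltW//.
by rewrite /inner_left addrC addKr.
Qed.

Lemma inner_right_cvg a b : a < b -> inner_right a b n @[n --> \oo] --> b.
Proof.
move=> ab; apply/cvgrPdist_lt => e e0; have [N hN] := inner_gap_small ab e0.
exists N => // n /= /hN h; have [_ _ h1] := inner_bounds n ab.
rewrite ger0_norm ?subr_ge0 ?ltW//.
by rewrite /inner_right opprB addrCA subrr addr0.
Qed.

Lemma continuous_itv_measurable h a b :
  (forall x, a < x < b -> {for x, continuous h}) -> measurable_fun `]a, b[%classic h.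
Proof.
move=> ch; apply: subspace_continuous_measurable_fun => //.
by apply: continuous_in_subspaceT => x; rewrite inE/= in_itv/= => /ch.
Qed.

Lemma ge0_integral_inner_cvg (f : R -> \bar R) a b : a < b ->
  measurable_fun `]a, b[%classic f -> (forall x, a < x < b -> (0 <= f x)%E) ->
  (\int[mu]_(x in inner_itv a b n) f x)%E @[n --> \oo] -->
  (\int[mu]_(x in `]a, b[) f x)%E.
Proof.
move=> ab mf f0; rewrite -(inner_itv_bigcup ab).
apply: ge0_nondecreasing_set_cvg_integral.
- exact: inner_itv_nd.
- by move=> i; exact: measurable_itv.
- by move=> i; apply: measurable_funS mf => //; exact: inner_itv_sub.
- by move=> i x /(inner_itv_sub ab); rewrite /= in_itv; exact: f0.
Qed.

(** At the endpoints [F'] may vanish and [G] may blow up. The substitution is therefore made on the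
    inner intervals and carried to the limit by monotone convergence on both sides. *)
Lemma ge0_integral_subst_oo F F' G a b : a < b ->
  (forall x, a <= x <= b -> is_derive x (1 : R) F (F' x)) ->
  (forall x, a < x < b -> {for x, continuous F'}) ->
  (forall x, a < x < b -> 0 < F' x) ->
  (forall y, F a < y < F b -> {for y, continuous G}) ->
  (forall y, F a < y < F b -> 0 <= G y) ->
  (\int[mu]_(y in `]F a, F b[) (G y)%:E =
   \int[mu]_(x in `]a, b[) (G (F x) * F' x)%:E)%E.
Proof.
move=> ab dF cF' F'0 cG G0.
have cF x : a <= x <= b -> {for x, continuous F}.
  by move=> /dF/is_derive_continuous.
have Fin x y : a <= x -> x < y -> y <= b -> F x < F y.
  move=> ax xy yb.
  have [z||z] := @MVT _ F F' x y xy.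
  - by rewrite in_itv/= => /andP[xz zy]; apply: dF; lra.
  - apply: continuous_in_subspaceT => z; rewrite inE/= in_itv/= => /andP[xz zy].
    by apply: cF; lra.
  - rewrite in_itv/= => /andP[xz zy] E.
    by rewrite -subr_gt0 E mulr_gt0 ?subr_gt0//; apply: F'0; lra.
have Fx x : a < x < b -> F a < F x < F b.
  by move=> /andP[ax xb]; rewrite !Fin//; lra.
have mG : measurable_fun `]F a, F b[%classic G by apply: continuous_itv_measurable.
have cFF x : a < x < b -> {for x, continuous (fun x => G (F x) * F' x)}.
  move=> xab; apply: cvgM; last exact: cF'.
  apply: (@continuous_comp _ _ _ F G); first by apply: cF; lra.
  by apply: cG; exact: Fx.
have mGF : measurable_fun `]a, b[%classic (fun x => (G (F x) * F' x)%:E).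
  by apply/measurable_EFinP; exact: continuous_itv_measurable.
(* Images of the inner intervals under [F]; they exhaust []F a, F b[] because [F] is continuous up
   to the endpoints. *)
pose B n := `[F (inner_left a b n), F (inner_right a b n)]%classic.
have Bsub n : B n `<=` `]F a, F b[%classic.
  move=> y; rewrite /B/= !in_itv/= => /andP[h4 h5].
  have [h1 h2 h3] := inner_bounds n ab.
  have h6 : F a < F (inner_left a b n) by apply: Fin; lra.
  have h7 : F (inner_right a b n) < F b by apply: Fin; lra.
  by lra.
have Bnd : nondecreasing_seq B.
  move=> n m nm; apply/subsetPset => y; rewrite /B/= !in_itv/=.
  have [h1 h2] := inner_step ab nm; have [h3 h4 h5] := inner_bounds n ab.
  have [h6 h7 h8] := inner_bounds m ab.
  have le u v : a <= u -> u <= v -> v <= b -> F u <= F v.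
    move=> au; rewrite le_eqVlt => /predU1P[->//|uv vb]; exact/ltW/Fin.
  have h9 : F (inner_left a b m) <= F (inner_left a b n) by apply: le; lra.
  have h10 : F (inner_right a b n) <= F (inner_right a b m) by apply: le; lra.
  by move=> /andP[h11 h12]; lra.
have BU : \bigcup_n B n = `]F a, F b[%classic.
  apply/seteqP; split => [y [n _] /Bsub//|y].
  rewrite /= in_itv/= => /andP[Fay yFb].
  have ca : F (inner_left a b n) @[n --> \oo] --> F a.
    by apply: continuous_cvg; [apply: cF; lra|exact: inner_left_cvg].
  have cb : F (inner_right a b n) @[n --> \oo] --> F b.
    by apply: continuous_cvg; [apply: cF; lra|exact: inner_right_cvg].
  have [N _ hN] : \forall n \near \oo, F (inner_left a b n) < y.
    exact: cvgr_lt ca _ Fay.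
  have [M _ hM] : \forall n \near \oo, y < F (inner_right a b n).
    exact: cvgr_gt cb _ yFb.
  exists (maxn N M) => //; rewrite /B/= in_itv/=.
  by rewrite !ltW ?hN ?hM//= ?leq_maxl ?leq_maxr.
have LHS : (\int[mu]_(y in B n) (G y)%:E)%E @[n --> \oo] -->
    (\int[mu]_(y in `]F a, F b[) (G y)%:E)%E.
  rewrite -BU; apply: ge0_nondecreasing_set_cvg_integral => //.
  - by move=> i; exact: measurable_itv.
  - by move=> i; apply/measurable_EFinP; apply: measurable_funS mG => //.
  - by move=> i y /Bsub; rewrite /= in_itv/= lee_fin; exact: G0.
have RHS0 : (\int[mu]_(x in inner_itv a b n) (G (F x) * F' x)%:E)%E @[n --> \oo] -->
    (\int[mu]_(x in `]a, b[) (G (F x) * F' x)%:E)%E.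
  apply: ge0_integral_inner_cvg => // x xab.
  by rewrite lee_fin mulr_ge0 ?G0 ?Fx// ltW// F'0.
apply: cvg_unique LHS _ => //.
apply: cvg_trans RHS0; apply: near_eq_cvg; near=> n.
have [h1 h2 h3] := inner_bounds n ab.
have F1E x : a < x < b -> F^`()%classic x = F' x.
  move=> xab; have h : a <= x <= b by lra.
  by rewrite derive1E; have := dF _ h => d; rewrite derive_val.
have cF1 x : a < x < b -> {for x, continuous F^`()%classic}.
  move=> xab; have h := cF' _ xab; rewrite /prop_for /continuous_at (F1E _ xab).
  apply: cvg_trans h; apply: near_eq_cvg; near=> z; apply/esym/F1E; apply/andP; split; near: z.
    by apply: lt_nbhsr; lra.
  by apply: lt_nbhsl; lra.
have inner x : inner_left a b n <= x <= inner_right a b n -> a < x < b by lra.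
rewrite /B integration_by_substitution_increasing.
- apply: eq_integral => x; rewrite inE /inner_itv/= in_itv/= => /inner xab.
  by rewrite fctE F1E.
- exact: ltW.
- move=> x y; rewrite !in_itv/= => /andP[h4 h5] /andP[h6 h7] xy; apply: Fin; lra.
- by move=> x; rewrite in_itv/= => /andP[h4 h5]; apply: cF1; lra.
- by apply/cvg_ex; exists (F^`()%classic (inner_left a b n)); apply: cvg_at_right_filter; apply: cF1; lra.
- by apply/cvg_ex; exists (F^`()%classic (inner_right a b n)); apply: cvg_at_left_filter; apply: cF1; lra.
- split.
  + move=> x; rewrite in_itv/= => /andP[h4 h5].
    have h : a <= x <= b by lra.
    by have := dF _ h => d; exact: ex_derive.
  + by apply: cvg_at_right_filter; apply: cF; lra.
  + by apply: cvg_at_left_filter; apply: cF; lra.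
- apply: continuous_in_subspaceT => y; rewrite inE/= => /Bsub.
  by rewrite /= in_itv/=; exact: cG.
Unshelve. all: end_near. Qed.

End OpenIntervals.

(** * Translation and reflection of Lebesgue measure *)

Section RealLineChangeOfVariable.
Variable R : realType.
Local Notation mu := (@lebesgue_measure R).

Lemma measurable_shift (c : R) : measurable_fun [set: R] (fun x : R => x + c).
Proof. by apply: measurable_funD => //; exact: measurable_cst. Qed.

Lemma lebesgue_measure_shift (c : R) (A : set R) : measurable A ->
  pushforward mu ((fun x => x + c) : R -> measurableTypeR R) A = mu A.
Proof.
move=> mA; apply/esym/lebesgue_measure_unique => //=; first exact: measurable_shift.
move=> _ _ [[a b]] _ <-; rewrite /pushforward.
have -> : (fun x => x + c) @^-1` `]a, b]%classic = `]a - c, b - c]%classic.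
  by apply/seteqP; split => x /=; rewrite !in_itv/= ltrBlDr lerBrDr.
rewrite !lebesgue_measure_itv/= !lte_fin ltrD2r; case: ifP => // _.
by rewrite -!EFinB; congr (_%:E); ring.
Qed.

Lemma ge0_integral_shift (f : R -> \bar R) (c : R) :
  measurable_fun [set: R] f -> (forall x, (0 <= f x)%E) ->
  (\int[mu]_x f (x + c)%R = \int[mu]_x f x)%E.
Proof.
move=> mf f0.
have h := @ge0_integral_pushforward _ _ (measurableTypeR R) (measurableTypeR R) R
  ((fun x => x + c) : R -> measurableTypeR R) (measurable_shift c) mu setT f measurableT mf.
rewrite preimage_setT in h; rewrite -h//.
apply: eq_measure_integral => //=; first exact: measurable_shift.
by move=> m A mA _; exact: lebesgue_measure_shift.
Qed.

Lemma integral_reflect (f : R -> \bar R) : measurable_fun [set: R] f ->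
  mu.-integrable setT (fun x => f (- x)) ->
  (\int[mu]_x f (- x)%R = \int[mu]_x f x)%E.
Proof.
move=> mf intf.
have mopp : measurable_fun [set: R] (-%R : R -> R) by exact: oppr_measurable.
have h := @integral_pushforward _ _ (measurableTypeR R) (measurableTypeR R) R
  (-%R : R -> measurableTypeR R) mopp mu setT f mf.
rewrite preimage_setT in h; rewrite -h//.
by apply: eq_measure_integral => //= A mA _; exact: lebesgue_measureN.
Qed.

End RealLineChangeOfVariable.

(** * Positivity and finiteness of the Gamma integral *)

Section WeightIntegral.
Variable R : realType.
Local Notation mu := (@lebesgue_measure R).

Lemma is_derive_powR (q t : R) : 0 < t ->
  is_derive t (1 : R) (fun t => t `^ q) (q * t `^ (q - 1)).
Proof.
move=> t0; have h : t \in `]0, +oo[ by rewrite in_itv/= t0.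
by rewrite -(powR_derive1 q h) derive1E; apply: DeriveDef => //; exact: derivable_powR.
Qed.

Lemma continuous_powR (q t : R) : 0 < t -> {for t, continuous (fun t => t `^ q)}.
Proof.
by move=> /(is_derive_powR q); exact: is_derive_continuous.
Qed.

(** A primitive with values in [[0, M]] bounds every inner integral by [M], even when [k] is
    unbounded near the endpoints. *)
Lemma ge0_integral_oo_le (Phi k : R -> R) (a b M : R) : a < b ->
  (forall x, a < x < b -> is_derive x (1 : R) Phi (k x)) ->
  (forall x, a < x < b -> {for x, continuous k}) ->
  (forall x, a < x < b -> 0 <= k x) -> (forall x, a < x < b -> 0 <= Phi x <= M) ->
  (\int[mu]_(x in `]a, b[) (k x)%:E <= M%:E)%E.
Proof.
move=> ab dPhi ck k0 PhiM.
have cPhi x : a < x < b -> {for x, continuous Phi}.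
  by move=> /dPhi/is_derive_continuous.
have L : (\int[mu]_(x in inner_itv a b n) (k x)%:E)%E @[n --> \oo] -->
    (\int[mu]_(x in `]a, b[) (k x)%:E)%E.
  apply: ge0_integral_inner_cvg => //.
  by apply/measurable_EFinP; exact: continuous_itv_measurable.
apply: cvge_le L; near=> n.
have [h1 h2 h3] := inner_bounds n ab.
have inn x : inner_left a b n <= x <= inner_right a b n -> a < x < b by lra.
rewrite (@continuous_FTC2 _ k Phi)//.
- have p1 : 0 <= Phi (inner_left a b n) <= M by apply: PhiM; lra.
  have p2 : 0 <= Phi (inner_right a b n) <= M by apply: PhiM; lra.
  by rewrite -EFinB lee_fin; lra.
- apply: continuous_in_subspaceT => x; rewrite inE/= in_itv/= => /inn; exact: ck.
- split.
  + move=> x; rewrite in_itv/= => /andP[h4 h5]; have xab : a < x < b by lra.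
    by have := dPhi _ xab => d; exact: ex_derive.
  + by apply: cvg_at_right_filter; apply: cPhi; lra.
  + by apply: cvg_at_left_filter; apply: cPhi; lra.
- move=> x; rewrite in_itv/= => /andP[h4 h5]; have xab : a < x < b by lra.
  by have := dPhi _ xab => d; rewrite derive1E derive_val.
Unshelve. all: end_near. Qed.

Definition Gamma_integrand (q t : R) : R := t `^ (q - 1) * expR (- t).
(** Extended-real value, so that Tonelli's theorem can be applied before finiteness is known. *)
Definition eGamma (q : R) : \bar R := (\int[mu]_(t in `]0%R, +oo[) (Gamma_integrand q t)%:E)%E.

Lemma Gamma_integrand_ge0 q t : 0 <= Gamma_integrand q t.
Proof. by rewrite mulr_ge0 ?powR_ge0 ?expR_ge0. Qed.

Lemma measurable_Gamma_integrand q (D : set R) : measurable D ->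
  measurable_fun D (fun t => (Gamma_integrand q t)%:E).
Proof.
move=> mD; apply/measurable_EFinP; apply: measurable_funM.
  by apply: measurable_funTS; exact: measurable_powR.
apply: measurable_funTS; apply: measurableT_comp => //; exact: oppr_measurable.
Qed.

Lemma ln_le_sub1 (t : R) : 0 < t -> ln t <= t - 1.
Proof. by move=> t0; have := expR_ge1Dx (ln t); rewrite lnK ?posrE//; lra. Qed.

Lemma eGamma_ge0 q : (0 <= eGamma q)%E.
Proof. by apply: integral_ge0 => t _; rewrite lee_fin Gamma_integrand_ge0. Qed.

Lemma eGamma_gt0 q : (0 < eGamma q)%E.
Proof.
(* On [[1, 2]] one has [0 <= ln t <= 1] and [t <= 2], so the integrand is at least this [m]. *)
pose m := expR (- `|q - 1| - 2).
apply: (@lt_le_trans _ _ (\int[mu]_(t in `[1%R, 2%R]) (cst m%:E t))%E).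
  rewrite integral_cst//= lebesgue_measure_itv/= lte_fin ifT; last by lra.
  by rewrite -EFinD -EFinM lte_fin mulr_gt0 ?expR_gt0//; lra.
apply: (@le_trans _ _ (\int[mu]_(t in `[1%R, 2%R]) (Gamma_integrand q t)%:E)%E); last first.
  apply: ge0_subset_integral => //.
  - exact: measurable_Gamma_integrand.
  - by move=> t _; rewrite lee_fin Gamma_integrand_ge0.
  - by move=> t /=; rewrite !in_itv/= andbT; lra.
apply: ge0_le_integral => //.
- by move=> t _; rewrite lee_fin expR_ge0.
- exact: measurable_Gamma_integrand.
- move=> t /=; rewrite in_itv/= => /andP[t1 t2]; rewrite lee_fin /Gamma_integrand.
  have t0 : 0 < t by lra.
  rewrite /powR gt_eqF// -expRD ler_expR.
  have l0 : 0 <= ln t by rewrite ln_ge0.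
  have l1 := ln_le_sub1 t0.
  have h : - ((q - 1) * ln t) <= `|q - 1| * 1.
    apply: le_trans (ler_norm _) _; rewrite normrN normrM ler_wpM2l// ger0_norm//; lra.
  lra.
Qed.

Lemma eGamma_lty (q : R) : 0 < q -> (eGamma q < +oo)%E.
Proof.
move=> q0; rewrite /eGamma.
have U : `]0%R, +oo[%classic = `]0%R, 1%R[%classic `|` `[1%R, +oo[%classic :> set R.
  apply/seteqP; split => t /=; rewrite !in_itv/= !andbT.
    by move=> t0; case: (ltP t 1) => h; [left; rewrite t0|right].
  by move=> [/andP[]//|]; lra.
rewrite U ge0_integral_setU//=; last 3 first.
- by rewrite -U; exact: measurable_Gamma_integrand.
- by move=> t _; rewrite lee_fin Gamma_integrand_ge0.
- apply/disj_setPS => t [/=]; rewrite !in_itv/= andbT => /andP[_ h1 h2]; lra.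
apply: lte_add_pinfty.
  apply: (@le_lt_trans _ _ (\int[mu]_(t in `]0%R, 1%R[) (t `^ (q - 1))%:E)%E).
    apply: ge0_le_integral => //.
    - by move=> t _; rewrite lee_fin Gamma_integrand_ge0.
    - exact: measurable_Gamma_integrand.
    - by apply/measurable_EFinP; apply: measurable_funTS; exact: measurable_powR.
    - move=> t /=; rewrite in_itv/= => /andP[t0 t1]; rewrite lee_fin.
      by rewrite -[leRHS]mulr1 ler_wpM2l ?powR_ge0// expR_le1; lra.
  apply: (@le_lt_trans _ _ (q^-1)%:E); last by rewrite ltry.
  apply: (@ge0_integral_oo_le (fun t => q^-1 * t `^ q) (fun t => t `^ (q - 1))) => //.
  - move=> t /andP[t0 _]; have := is_deriveZ q^-1 (is_derive_powR q t0).
    by apply: is_derive_ext => //; rewrite /GRing.scale/= mulKf// gt_eqF.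
  - by move=> t /andP[t0 _]; exact: continuous_powR.
  - by move=> t _; exact: powR_ge0.
  - move=> t /andP[t0 t1]; have iq : 0 <= q^-1 by rewrite invr_ge0 ltW.
    rewrite mulr_ge0 ?powR_ge0//= -[leRHS]mulr1 ler_wpM2l//.
    have one : 1 `^ q = 1 :> R by rewrite powR1.
    by rewrite -[leRHS]one ge0_ler_powR ?nnegrE// ltW.
(* From [ln (t / K) <= t / K - 1] the logarithm contributes at most [t / 2] plus the constant
   [|q - 1| * ln K]. The integrand is then at most [C * expR (- t / 2)], a multiple of an
   exponential density. *)
pose K := 2 * (`|q - 1| + 1).
have K0 : 0 < K by rewrite mulr_gt0// ltr_wpDl.
pose C := expR (`|q - 1| * ln K).
have half : (0 : R) < 2^-1 by lra.
have intE := integrable_exponential_pdf half.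
apply: (@le_lt_trans _ _ (\int[mu]_(t in `[1%R, +oo[) ((2 * C) * exponential_pdf 2^-1 t)%:E)%E).
  apply: ge0_le_integral => //.
  - by move=> t _; rewrite lee_fin Gamma_integrand_ge0.
  - exact: measurable_Gamma_integrand.
  - apply/measurable_EFinP; apply: measurable_funM; first exact: measurable_cst.
    by apply: measurable_funTS; exact: measurable_exponential_pdf.
  - move=> t /=; rewrite in_itv/= andbT => t1; rewrite lee_fin.
    have t0 : 0 < t by lra.
    have -> : exponential_pdf 2^-1 t = 2^-1 * expR (- 2^-1 * t) by rewrite exponential_pdfE// ltW.
    rewrite /Gamma_integrand /powR gt_eqF// -expRD.
    rewrite (_ : 2 * C * (2^-1 * expR (- 2^-1 * t)) = C * expR (- 2^-1 * t)); last by field.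
    rewrite /C -expRD ler_expR.
    have l0 : 0 <= ln t by rewrite ln_ge0.
    have h1 : ln t <= t / K + ln K.
      have tK : 0 < t / K by rewrite divr_gt0.
      have := ln_le_sub1 tK; rewrite ln_div ?posrE//; lra.
    have h2 : (q - 1) * ln t <= `|q - 1| * (t / K + ln K).
      apply: le_trans (ler_norm _) _; rewrite normrM ler_wpM2l// ger0_norm//; lra.
    have h3 : `|q - 1| * (t / K) <= t / 2.
      rewrite mulrCA ler_pM2l// ler_pdivrMr// /K; lra.
    rewrite mulrDr in h2; lra.
have iE : mu.-integrable `[1%R, +oo[
    (fun t => ((2 * C)%:E * (exponential_pdf 2^-1 t)%:E)%E).
  by apply: integrableZl => //; apply: integrableS intE.
have /integrableP[_] := iE; apply: le_lt_trans.
by apply: le_integral => //; [exact: integrable_abse|move=> t _; exact: lee_abs].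
Qed.

End WeightIntegral.

(** * The Beta integral *)

Section BetaGamma.
Variable R : realType.
Local Notation mu := (@lebesgue_measure R).

Definition jweight (q s : R) : R := (1 - s ^+ 2) `^ q.
Definition eBeta (q : R) : \bar R := (\int[mu]_(s in `](-1)%R, 1%R[) (jweight q s)%:E)%E.

(** The power is cut off to positive arguments, so that the region [y^2 < r] is carried by the
    integrand and Tonelli applies on the whole plane. *)
Let phi (q u : R) : R := ((fun u => u `^ q) \_ `]0, +oo[) u.

Let phiE q u : 0 < u -> phi q u = u `^ q.
Proof. by move=> u0; rewrite /phi patchE mem_set//= in_itv/= u0. Qed.

Let phi0 q u : u <= 0 -> phi q u = 0.
Proof. by move=> u0; rewrite /phi patchE memNset//= in_itv/= andbT; apply/negP; rewrite -leNgt. Qed.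

Let phi_ge0 q u : 0 <= phi q u.
Proof. by have [u0|u0] := leP u 0; [rewrite phi0|rewrite phiE// powR_ge0]. Qed.

Let measurable_phi q : measurable_fun [set: R] (phi q).
Proof.
have mI : measurable (`]0, +oo[%classic : set R) by exact: measurable_itv.
apply/(measurable_restrictT (fun u : R => u `^ q) mI).
by apply: measurable_funTS; exact: measurable_powR.
Qed.

Let measurable_sqr : measurable_fun [set: R] (fun y : R => y ^+ 2).
Proof. by apply: continuous_measurable_fun; exact: exprn_continuous. Qed.

Lemma measurable_jweight q : measurable_fun [set: R] (jweight q).
Proof.
apply: (measurableT_comp (measurable_powR q)).
by apply: measurable_funB; [exact: measurable_cst|exact: measurable_sqr].
Qed.

Let measurable_expRN : measurable_fun [set: R] (fun r : R => expR (- r)).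
Proof. by apply: measurableT_comp => //; exact: oppr_measurable. Qed.

Let integrand (q : R) (z : R * R) : \bar R := (phi q (z.2 - z.1 ^+ 2) * expR (- z.2))%:E.

Let measurable_integrand q :
  measurable_fun [set: measurableTypeR R * measurableTypeR R] (integrand q).
Proof.
apply/measurable_EFinP; apply: measurable_funM.
  apply: (measurableT_comp (measurable_phi q)).
  apply: measurable_funB; first exact: measurable_snd.
  exact: (measurableT_comp measurable_sqr measurable_fst).
exact: (measurableT_comp measurable_expRN measurable_snd).
Qed.

Let integrand_ge0 q z : (0 <= integrand q z)%E.
Proof. by rewrite lee_fin mulr_ge0 ?phi_ge0 ?expR_ge0. Qed.

(** Translating [r] by [y^2] splits [expR (- r)] into [expR (- u)] and the Gaussian in [y]. *)
Let inner_r q y : (\int[mu]_r integrand q (y, r) =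
  eGamma (q + 1) * (gauss_fun y)%:E)%E.
Proof.
pose f u : \bar R := ((phi q u * expR (- u)) * gauss_fun y)%:E.
have mphi : measurable_fun [set: R] (fun u => (phi q u * expR (- u))%:E).
  apply/measurable_EFinP; apply: measurable_funM; first exact: measurable_phi.
  exact: measurable_expRN.
have -> : (fun r => integrand q (y, r)) = (fun r => f (r + - y ^+ 2)).
  apply/funext => r; rewrite /integrand /f /=; congr (_%:E).
  rewrite -mulrA; congr (_ * _).
  by rewrite /gauss_fun -expRD; congr expR; ring.
rewrite ge0_integral_shift//; last first.
- by move=> u; rewrite lee_fin !mulr_ge0 ?phi_ge0 ?expR_ge0.
- apply/measurable_EFinP; apply: measurable_funM; last exact: measurable_cst.
  apply: measurable_funM; first exact: measurable_phi.
  exact: measurable_expRN.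
rewrite /f; under eq_integral do rewrite EFinM.
rewrite ge0_integralZr//; last 2 first.
- by move=> u _; rewrite lee_fin mulr_ge0 ?phi_ge0 ?expR_ge0.
- by rewrite lee_fin gauss_fun_ge0.
congr (_ * _)%E; rewrite /eGamma [RHS]integral_mkcond; apply: eq_integral => u _.
rewrite patchE; case: ifPn => [|]; rewrite ?inE ?notin_setE/= in_itv/= andbT => h.
  by rewrite phiE// /Gamma_integrand addrK.
by rewrite phi0 ?mul0r// leNgt; apply/negP.
Qed.

(** The scaling [y = sqrt r * s] produces the power [r ^ (q + 1/2)], the Gamma integrand at
    [q + 3/2]. *)
Let inner_y q r : 0 < r -> (\int[mu]_y integrand q (y, r) =
  (Gamma_integrand (q + 3 / 2) r)%:E * eBeta q)%E.
Proof.
move=> r0; pose sr := Num.sqrt r.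
have sr0 : 0 < sr by rewrite sqrtr_gt0.
have sr2 : sr ^+ 2 = r by rewrite sqr_sqrtr// ltW.
have inside y : - sr < y < sr -> 0 < r - y ^+ 2 by rewrite -sr2 => /andP[? ?]; nra.
transitivity (\int[mu]_(y in `](- sr)%R, sr[) ((r - y ^+ 2) `^ q * expR (- r))%:E)%E.
  rewrite [RHS]integral_mkcond; apply: eq_integral => y _.
  rewrite patchE; case: ifPn => [|]; rewrite ?inE ?notin_setE/= in_itv/= => h.
    by rewrite /integrand/= phiE// inside.
  rewrite /integrand/= phi0 ?mul0r//.
  rewrite -sr2; move/negP: h; rewrite negb_and -!leNgt => /orP[h|h]; nra.
have m11 : -1 < 1 :> R by lra.
transitivity (\int[mu]_(s in `](-1)%R, 1%R[) ((r - (sr * s) ^+ 2) `^ q * expR (- r) * sr)%:E)%E.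
  have := @ge0_integral_subst_oo _ (fun s => sr * s) (fun=> sr)
  (fun y => (r - y ^+ 2) `^ q * expR (- r)) (-1) 1 m11.
  rewrite mulrN1 mulr1; apply.
  - by move=> x _; exact: is_derive_scale.
  - by move=> x _; exact: cvg_cst.
  - by move=> x _; exact: sr0.
  - move=> y /inside h.
    apply: cvgM; last exact: cvg_cst.
    apply: (@continuous_comp R R R (fun y : R => r - y ^+ 2) (fun u : R => u `^ q)).
      apply: continuousB; first exact: cvg_cst.
      exact: exprn_continuous.
    exact: continuous_powR.
  - by move=> y _; rewrite mulr_ge0 ?powR_ge0 ?expR_ge0.
rewrite /eBeta -ge0_integralZl_EFin//; last first.
- exact: Gamma_integrand_ge0.
- by apply/measurable_EFinP; apply: measurable_funTS; exact: measurable_jweight.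
- by move=> s _; rewrite lee_fin powR_ge0.
apply: eq_integral => s; rewrite inE/= in_itv/= => /andP[s1 s2].
rewrite -EFinM; congr (_%:E); rewrite /Gamma_integrand /jweight.
have -> : r - (sr * s) ^+ 2 = r * (1 - s ^+ 2) by rewrite exprMn sr2; ring.
rewrite powRM ?(ltW r0)//; last by nra.
have -> : r `^ (q + 3 / 2 - 1) = r `^ q * sr.
  have -> : q + 3 / 2 - 1 = q + 2^-1 by field.
  rewrite powRD; last by apply/implyP => _; rewrite gt_eqF.
  by rewrite powR12_sqrt// ltW.
by ring.
Qed.

(* Both sides integrate (r - y^2)^q e^(-r) over the region y^2 < r. *)
Lemma eBeta_eGamma q :
  (eGamma (q + 1) * (Num.sqrt pi)%:E = eGamma (q + 3 / 2) * eBeta q)%E.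
Proof.
have beta0 : (0 <= eBeta q)%E by apply: integral_ge0 => s _; rewrite lee_fin powR_ge0.
rewrite -integralT_gauss -ge0_integralZl//; last 3 first.
- by apply/measurable_EFinP; exact: measurable_gauss_fun.
- by move=> y _; rewrite lee_fin gauss_fun_ge0.
- exact: eGamma_ge0.
transitivity (\int[mu]_y \int[mu]_r integrand q (y, r))%E.
  by apply: eq_integral => y _; rewrite inner_r.
rewrite (@fubini_tonelli _ _ _ _ R mu mu (integrand q) (measurable_integrand q) (integrand_ge0 q)).
rewrite /eGamma -ge0_integralZr//; last 2 first.
- exact: measurable_Gamma_integrand.
- by move=> t _; rewrite lee_fin Gamma_integrand_ge0.
rewrite [RHS]integral_mkcond; apply: eq_integral => r _.
rewrite patchE; case: ifPn => [|]; rewrite ?inE ?notin_setE/= in_itv/= andbT => h.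
  by rewrite inner_y.
apply: integral0_eq => y _; rewrite /integrand/= phi0 ?mul0r//.
by move/negP: h; rewrite -leNgt; have := sqr_ge0 y; lra.
Qed.

End BetaGamma.

(** * Real integrals against the Jacobi weight *)

Section JacobiWeight.
Variable R : realType.
Local Notation mu := (@lebesgue_measure R).
Local Notation B := (`](-1)%R, 1%R[%classic : set R).

Lemma segment_bounded (h : R -> R) (a b : R) :
  (forall x, a <= x <= b -> {for x, continuous h}) ->
  exists2 M, 0 <= M & forall x, a <= x <= b -> `|h x| <= M.
Proof.
move=> ch.
have cw : {within `[a, b], continuous h}.
  by apply: continuous_in_subspaceT => x; rewrite inE/= in_itv/=; exact: ch.
have /compact_bounded[M [_ hM]] := continuous_compact cw (@segment_compact _ a b).
exists (`|M| + 1); first by rewrite addr_ge0.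
move=> x xab; apply: (hM (`|M| + 1)); first by rewrite (le_lt_trans (ler_norm _))// ltrDl.
by exists x => //=; rewrite in_itv.
Qed.

(** The Beta integral is finite because its product with the positive number [eGamma (q + 3 / 2)] is
    finite. *)
Lemma eBeta_fin (q : R) : -1 < q ->
  exists2 b : R, eBeta q = b%:E & Num.sqrt pi * Gamma (q + 1) = Gamma (q + 3 / 2) * b /\
    0 < Gamma (q + 1) /\ 0 < Gamma (q + 3 / 2).
Proof.
move=> q1.
have fin p : 0 < p -> exists2 g : R, eGamma p = g%:E & Gamma p = g /\ 0 < g.
  move=> p0; have := eGamma_gt0 p; have := eGamma_lty p0.
  have GE : Gamma p = fine (eGamma p) by [].
  case: (eGamma p) GE => [g|//|//] /= GE _; rewrite lte_fin => g0.
  by exists g.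
have [g1 e1 [E1 g10]] := fin (q + 1) ltac:(lra).
have [g2 e2 [E2 g20]] := fin (q + 3 / 2) ltac:(lra).
have := eBeta_eGamma q; rewrite e1 e2.
have : (0 <= eBeta q)%E by apply: integral_ge0 => s _; rewrite lee_fin powR_ge0.
case: (eBeta q) => [b|_|//] /=.
  rewrite -!EFinM => _ [e]; exists b => //; rewrite E1 E2 mulrC e.
  by rewrite g10 g20.
by rewrite gt0_muley ?lte_fin.
Qed.

Variable q : R.
Hypothesis q1 : -1 < q.

Lemma integrable_jweight : mu.-integrable B (EFin \o jweight q).
Proof.
apply/integrableP; split.
  by apply/measurable_EFinP; apply: measurable_funTS; exact: measurable_jweight.
have [b e _] := eBeta_fin q1.
have -> : (\int[mu]_(x in B) `|(EFin \o jweight q) x| = eBeta q)%E.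
  by apply: eq_integral => s _ /=; rewrite ger0_norm// powR_ge0.
by rewrite e ltry.
Qed.

Lemma bounded_jweight_integrable (h : R -> R) M :
  measurable_fun B h -> (forall s : R, -1 < s < 1 -> `|h s| <= M) ->
  mu.-integrable B (fun s => (h s * jweight q s)%:E).
Proof.
move=> mh hM.
have h0 : -1 < (0 : R) < 1 by rewrite ltrN10 ltr01.
have M0 : 0 <= M := le_trans (normr_ge0 _) (hM 0 h0).
apply: (@le_integrable _ _ R mu B _ _ (fun s => (M%:E * (EFin \o jweight q) s)%E)) => //.
- apply/measurable_EFinP; apply: measurable_funM => //.
  by apply: measurable_funTS; exact: measurable_jweight.
- move=> s /=; rewrite in_itv/= => /hM hs.
  rewrite lee_fin !normrM (ger0_norm M0) (ger0_norm (powR_ge0 _ _)).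
  by rewrite ler_wpM2r// powR_ge0.
- by apply: integrableZl => //; exact: integrable_jweight.
Qed.

Lemma cts_jweight_integrable (h : R -> R) :
  (forall s : R, -1 <= s <= 1 -> {for s, continuous h}) ->
  mu.-integrable B (fun s => (h s * jweight q s)%:E).
Proof.
move=> ch; have [M M0 hM] := segment_bounded ch.
apply: (@bounded_jweight_integrable _ M).
  by apply: continuous_itv_measurable => s hs; apply: ch; lra.
by move=> s hs; apply: hM; lra.
Qed.

Lemma integral_inner_cvg (k : R -> R) (a b : R) : a < b ->
  mu.-integrable `]a, b[%classic (EFin \o k) ->
  (\int[mu]_(x in inner_itv a b n) k x) @[n --> \oo] --> \int[mu]_(x in `]a, b[) k x.
Proof.
move=> ab ik.
have mab : measurable (`]a, b[%classic : set R) by exact: measurable_itv.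
have mk := measurable_int mu ik.
have [| | | | |_ _ L] := @dominated_convergence _ _ _ mu `]a, b[%classic mab
  (fun n => (EFin \o k) \_ (inner_itv a b n)) (EFin \o k) (fun x => `|(EFin \o k) x|%E).
- move=> n; apply/measurable_restrict => //; first exact: measurable_itv.
  by apply: measurable_funS mk => // x [].
- exact: mk.
- apply: aeW => x /=; rewrite in_itv/= => xab.
  have : `]a, b[%classic x by rewrite /= in_itv.
  rewrite -(inner_itv_bigcup ab) => -[N _ hN].
  apply: cvg_near_cst; exists N => // n /= Nn; rewrite patchE mem_set//.
  by have /subsetPset := inner_itv_nd ab Nn; apply.
- exact: integrable_abse.
- by apply: aeW => x n _ /=; rewrite patchE; case: ifP => // _; rewrite abse0.
have kfin : (\int[mu]_(x in `]a, b[) (k x)%:E)%E \is a fin_num.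
  exact: integrable_fin_num.
rewrite -(fineK kfin) in L.
suff E : (fun n => \int[mu]_(x in inner_itv a b n) k x) =
  fine \o (fun n => (\int[mu]_(x in `]a, b[) ((EFin \o k) \_ (inner_itv a b n)) x)%E).
  by rewrite E; exact: (fine_cvg L).
apply/funext => n /=; rewrite -integral_mkcondr; congr (fine (integral _ _ _)).
by rewrite setIidr//; exact: inner_itv_sub.
Qed.

(** The primitive [- (1 - s^2) ^ (q + 1) * h] tends to 0 at both ends, since [q + 1 > 0] and [h] is
    bounded. The fundamental theorem is applied on the inner intervals because the weight may blow
    up at the ends. *)
Lemma jweight_ibp (h h' : R -> R) :
  (forall s : R, -1 <= s <= 1 -> is_derive s (1 : R) h (h' s)) ->
  (forall s : R, -1 <= s <= 1 -> {for s, continuous h'}) ->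
  (2 * (q + 1)) * \int[mu]_(s in B) ((s * h s) * jweight q s) =
  \int[mu]_(s in B) (((1 - s ^+ 2) * h' s) * jweight q s).
Proof.
move=> dh ch'.
have ch (s : R) : -1 <= s <= 1 -> {for s, continuous h}.
  by move=> /dh/is_derive_continuous.
have cid (s : R) : {for s, continuous (fun s : R => s)} by exact: cvg_id.
have c1 (s : R) : -1 <= s <= 1 -> {for s, continuous (fun s : R => s * h s)}.
  by move=> hs; apply: continuousM; [exact: cid|exact: ch].
have csq (s : R) : {for s, continuous (fun s : R => 1 - s ^+ 2)}.
  by apply: continuousB; [exact: cvg_cst|exact: exprn_continuous].
have c2 (s : R) : -1 <= s <= 1 -> {for s, continuous (fun s : R => (1 - s ^+ 2) * h' s)}.
  by move=> hs; apply: continuousM; [exact: csq|exact: ch'].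
have i1 := cts_jweight_integrable c1; have i2 := cts_jweight_integrable c2.
have mB : measurable B by exact: measurable_itv.
rewrite -RintegralZl//.
apply/eqP; rewrite -subr_eq0 -RintegralB//; last first.
  rewrite (_ : (_ \o _) = (fun s => ((2 * (q + 1))%:E * (s * h s * jweight q s)%:E)%E))//.
  exact: integrableZl.
apply/eqP.
pose k s := 2 * (q + 1) * (s * h s * jweight q s) - (1 - s ^+ 2) * h' s * jweight q s.
have ik : mu.-integrable B (EFin \o k).
  rewrite (_ : EFin \o k = (fun s => (((2 * (q + 1))%:E * (s * h s * jweight q s)%:E)
     - ((1 - s ^+ 2) * h' s * jweight q s)%:E)%E))//.
  by apply: integrableB => //; exact: integrableZl.
have m11 : -1 < 1 :> R by lra.
have L := integral_inner_cvg m11 ik.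
pose Phi (s : R) : R := - ((1 - s ^+ 2) `^ (q + 1) * h s).
have pos (s : R) : -1 < s < 1 -> 0 < 1 - s ^+ 2 by move=> /andP[? ?]; nra.
have dPhi (s : R) : -1 < s < 1 -> is_derive s (1 : R) Phi (k s).
  move=> hs; have hs' : -1 <= s <= 1 by lra.
  have s0 := pos _ hs.
  have dsq : is_derive s (1 : R) (fun s : R => 1 - s ^+ 2) (- (2 * s)).
    have did := is_derive_id s (1 : R).
    apply: is_derive_ext (is_deriveB (is_derive_cst (1 : R) s 1) (is_deriveM did did)).
      by apply/funext => u; rewrite !fctE expr2.
    by rewrite /GRing.scale/=; ring.
  have dp := @is_derive_comp1 _ (fun u : R => u `^ (q + 1)) (fun s : R => 1 - s ^+ 2) _ _ _ (is_derive_powR (q + 1) s0) dsq.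
  apply: is_derive_ext (is_deriveN (is_deriveM dp (dh _ hs'))) => //.
  rewrite /k /jweight /GRing.scale/= addrK.
  have -> : (1 - s ^+ 2) `^ (q + 1) = (1 - s ^+ 2) * (1 - s ^+ 2) `^ q.
    have c0 : (1 + q == 0) ==> (1 - s ^+ 2 != 0).
      by apply/implyP => _; rewrite gt_eqF.
    by rewrite (addrC q) (powRD c0) powRr1// ltW.
  by ring.
have cPhi (s : R) : -1 < s < 1 -> {for s, continuous Phi}.
  by move=> /dPhi/is_derive_continuous.
have cjw (s : R) : -1 < s < 1 -> {for s, continuous (jweight q)}.
  move=> hs; apply: (@continuous_comp R R R (fun s : R => 1 - s ^+ 2) (fun u => u `^ q)).
    exact: csq.
  exact: continuous_powR (pos _ hs).
have ck (s : R) : -1 < s < 1 -> {for s, continuous k}.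
  move=> hs; have hs' : -1 <= s <= 1 by lra.
  apply: continuousB; last by apply: continuousM; [exact: c2|exact: cjw].
  apply: continuousM; first exact: cvg_cst.
  by apply: continuousM; [exact: c1|exact: cjw].
have E n : \int[mu]_(x in inner_itv (-1) 1 n) k x =
    Phi (inner_right (-1) 1 n) - Phi (inner_left (-1) 1 n).
  have [h1 h2 h3] := inner_bounds n m11.
  rewrite /Rintegral (@continuous_FTC2 _ k Phi)//.
  - apply: continuous_in_subspaceT => x; rewrite inE/= in_itv/= => /andP[h4 h5].
    by apply: ck; lra.
  - split.
    + move=> x; rewrite in_itv/= => /andP[h4 h5]; have hx : -1 < x < 1 by lra.
      by have := dPhi _ hx => d; exact: ex_derive.
    + by apply: cvg_at_right_filter; apply: cPhi; lra.
    + by apply: cvg_at_left_filter; apply: cPhi; lra.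
  - move=> x; rewrite in_itv/= => /andP[h4 h5]; have hx : -1 < x < 1 by lra.
    by have := dPhi _ hx => d; rewrite derive1E derive_val.
have [M M0 hM] := segment_bounded ch.
have lim0 (s_ : nat -> R) : (forall n, -1 < s_ n < 1) ->
    1 - s_ n ^+ 2 @[n --> \oo] --> (0 : R) -> Phi (s_ n) @[n --> \oo] --> (0 : R).
  move=> hs ls.
  have l1 : (1 - s_ n ^+ 2) `^ (q + 1) @[n --> \oo] --> (0 : R).
    have q0 : 0 < q + 1 by rewrite -ltrBlDr sub0r.
    have := powR_cvg0 q0 => /cvg_at_rightP; apply; split => // n; exact: pos.
  have l2 : M * (1 - s_ n ^+ 2) `^ (q + 1) @[n --> \oo] --> (0 : R).
    by rewrite -(mulr0 M); apply: cvgMl_tmp.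
  apply: norm_cvg0; apply: (squeeze_cvgr _ (cvg_cst (0 : R)) l2); near=> n.
  rewrite normr_ge0/= /Phi normrN normrM (ger0_norm (powR_ge0 _ _)) mulrC.
  by rewrite ler_wpM2r ?powR_ge0// hM//; case/andP: (hs n) => ? ?; rewrite !ltW.
have inn n : (-1 < inner_left (-1 : R) 1 n < 1) /\ (-1 < inner_right (-1 : R) 1 n < 1).
  have [h1 h2 h3] := inner_bounds n m11.
  by split; apply/andP; split; [exact: h1|exact: lt_trans h2 h3|exact: lt_trans h1 h2|exact: h3].
have L0 : (\int[mu]_(x in inner_itv (-1) 1 n) k x) @[n --> \oo] --> (0 : R).
  rewrite (funext E) -(subrr (0 : R)); apply: cvgB; apply: lim0.
  - by move=> n; case: (inn n).
  - rewrite (_ : 0 = 1 - 1 ^+ 2 :> R); last by rewrite expr1n subrr.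
    exact: (cvg_comp _ _ (inner_right_cvg m11) (csq 1)).
  - by move=> n; case: (inn n).
  - rewrite (_ : 0 = 1 - (-1) ^+ 2 :> R); last by rewrite sqrrN expr1n subrr.
    exact: (cvg_comp _ _ (inner_left_cvg m11) (csq (-1))).
exact: cvg_unique L L0.
Unshelve. all: end_near. Qed.

Lemma jweight_reflect (h : R -> R) :
  (forall s : R, -1 <= s <= 1 -> {for s, continuous h}) ->
  \int[mu]_(s in B) (h (- s) * jweight q s) = \int[mu]_(s in B) (h s * jweight q s).
Proof.
move=> ch; pose f := (fun s => (h s * jweight q s)) \_ B.
have i := cts_jweight_integrable ch.
have mB : measurable B by exact: measurable_itv.
have iT : mu.-integrable setT (EFin \o f).
  by rewrite -restrict_EFin; apply/integrable_restrict => //; rewrite setTI.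
have mf := measurable_int mu iT.
rewrite [LHS]Rintegral_mkcond [RHS]Rintegral_mkcond.
rewrite (_ : (_ \_ B) = (fun s => f (- s))); last first.
  apply/funext => s; rewrite /f !patchE.
  have -> : (- s \in B) = (s \in B).
    by apply/idP/idP; rewrite !inE/= !in_itv/=; lra.
  by case: ifP => // _; rewrite /jweight sqrrN.
rewrite /Rintegral; congr fine.
have := @integral_reflect R (fun s => (f (- s))%:E); rewrite /=.
under eq_integral do rewrite opprK.
move=> <-//.
- by apply/measurable_EFinP; apply: measurableT_comp => //; exact/measurable_EFinP.
- by rewrite (_ : (fun x => _) = EFin \o f)//; apply/funext => x /=; rewrite opprK.
Qed.

End JacobiWeight.

(** * Complex integrals against the Jacobi weight *)

Section ComplexWeightIntegral.
Variable R : realType.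
Local Notation mu := (@lebesgue_measure R).
Local Notation B := (`](-1)%R, 1%R[%classic : set R).

Definition jint (q : R) (h : R -> R[i]) : R[i] :=
  (\int[mu]_(s in B) (complex.Re (h s) * jweight q s)) +i*
  (\int[mu]_(s in B) (complex.Im (h s) * jweight q s)).

(** A single class of integrands, closed under sums and products and integrable against the weight
    for every exponent above -1. *)
Definition cdiff_on (h : R -> R[i]) := forall s : R, -1 <= s <= 1 -> exists l, cder h s l.

Lemma cdiff_cst (z : R[i]) : cdiff_on (fun=> z).
Proof. by move=> s _; exists 0; exact: cder_cst. Qed.

Lemma cdiffD f g : cdiff_on f -> cdiff_on g -> cdiff_on (fun s => f s + g s).
Proof. by move=> df dg s hs; have [l hl] := df s hs; have [k hk] := dg s hs; exists (l + k); exact: cderD. Qed.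

Lemma cdiffM f g : cdiff_on f -> cdiff_on g -> cdiff_on (fun s => f s * g s).
Proof. by move=> df dg s hs; have [l hl] := df s hs; have [k hk] := dg s hs; eexists; exact: cderM hl hk. Qed.

Lemma cdiff_real (h h' : R -> R) :
  (forall s : R, is_derive s (1 : R) h (h' s)) -> cdiff_on (fun s => (h s)%:C).
Proof. by move=> dh s _; exists (h' s)%:C; exact: cder_real. Qed.

Lemma cdiff_id : cdiff_on (fun s => s%:C).
Proof. by apply: (@cdiff_real _ (fun=> 1)) => s; exact: is_derive_id. Qed.

Section FixedExponent.
Variable q : R.
Hypothesis q1 : -1 < q.

Lemma cdiff_integrable (h : R -> R[i]) : cdiff_on h ->
  mu.-integrable B (fun s => (complex.Re (h s) * jweight q s)%:E) /\
  mu.-integrable B (fun s => (complex.Im (h s) * jweight q s)%:E).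
Proof.
by move=> dh; split; apply: cts_jweight_integrable => // s /dh[l /cder_continuous[]].
Qed.

Lemma eq_jint (f g : R -> R[i]) : (forall s : R, -1 < s < 1 -> f s = g s) -> jint q f = jint q g.
Proof.
move=> fg; rewrite /jint; congr (_ +i* _); apply: eq_Rintegral => s;
  by rewrite inE/= in_itv/= => /fg ->.
Qed.

Lemma jintD f g : cdiff_on f -> cdiff_on g ->
  jint q (fun s => f s + g s) = jint q f + jint q g.
Proof.
move=> /cdiff_integrable[fr fi] /cdiff_integrable[gr gi].
have mB : measurable B by exact: measurable_itv.
apply: complex_ext; rewrite ?cReD ?cImD /=.
- by rewrite -RintegralD//; apply: eq_Rintegral => s _; rewrite cReD mulrDl.
- by rewrite -RintegralD//; apply: eq_Rintegral => s _; rewrite cImD mulrDl.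
Qed.

Lemma jintZ (z : R[i]) f : cdiff_on f -> jint q (fun s => z * f s) = z * jint q f.
Proof.
move=> /cdiff_integrable[fr fi].
have mB : measurable B by exact: measurable_itv.
have Z (k : R) (h : R -> R) : mu.-integrable B (fun s => (h s)%:E) ->
    mu.-integrable B (fun s => (k * h s)%:E).
  move=> ih; rewrite (_ : (fun s => _) = (fun s => (k%:E * (h s)%:E)%E))//.
  exact: integrableZl.
apply: complex_ext; rewrite ?cReM ?cImM /=.
- rewrite -!RintegralZl// -RintegralB//; [|exact: Z|exact: Z].
  by apply: eq_Rintegral => s _; rewrite cReM; ring.
- rewrite -!RintegralZl// -RintegralD//; [|exact: Z|exact: Z].
  by apply: eq_Rintegral => s _; rewrite cImM; ring.
Qed.

Lemma jint_reflect f : cdiff_on f -> jint q (fun s => f (- s)) = jint q f.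
Proof.
move=> df; apply: complex_ext => /=.
- by apply: (@jweight_reflect _ _ q1 (fun s => complex.Re (f s))) => s /df[l /cder_continuous[]].
- by apply: (@jweight_reflect _ _ q1 (fun s => complex.Im (f s))) => s /df[l /cder_continuous[]].
Qed.

Lemma jint_ibp (h h' : R -> R[i]) :
  (forall s : R, -1 <= s <= 1 -> cder h s (h' s)) -> cdiff_on h' ->
  (2 * (q + 1))%:C * jint q (fun s => s%:C * h s) =
  jint q (fun s => (1 - s ^+ 2)%:C * h' s).
Proof.
move=> dh dh'; apply: complex_ext; rewrite ?cReM ?cImM /= mul0r ?subr0 ?addr0.
- transitivity (2 * (q + 1) * \int[mu]_(s in B) (s * complex.Re (h s) * jweight q s)).
    by congr (_ * _); apply: eq_Rintegral => s _; rewrite cReM/= mul0r subr0.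
  have ch (s : R) : -1 <= s <= 1 -> {for s, continuous (fun s => complex.Re (h' s))}.
    by move=> /dh'[l /cder_continuous[]].
  rewrite (@jweight_ibp _ _ q1 (fun s => complex.Re (h s)) (fun s => complex.Re (h' s))
    (fun s hs => (dh s hs).1) ch).
  by apply: eq_Rintegral => s _; rewrite cReM/= mul0r subr0.
- transitivity (2 * (q + 1) * \int[mu]_(s in B) (s * complex.Im (h s) * jweight q s)).
    by congr (_ * _); apply: eq_Rintegral => s _; rewrite cImM/= mul0r addr0.
  have ch (s : R) : -1 <= s <= 1 -> {for s, continuous (fun s => complex.Im (h' s))}.
    by move=> /dh'[l /cder_continuous[]].
  rewrite (@jweight_ibp _ _ q1 (fun s => complex.Im (h s)) (fun s => complex.Im (h' s))
    (fun s hs => (dh s hs).2) ch).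
  by apply: eq_Rintegral => s _; rewrite cImM/= mul0r addr0.
Qed.

(** The partial derivative is dominated by a constant multiple of the weight, which is
    integrable. *)
Lemma real_jint_is_derive (f f' : R -> R -> R) (u v X M : R) : u < X < v ->
  (forall x s : R, u < x < v -> -1 <= s <= 1 -> is_derive x (1 : R) (f^~ s) (f' x s)) ->
  (forall x s : R, u < x < v -> -1 <= s <= 1 -> {for s, continuous (f x)}) ->
  (forall x s : R, u < x < v -> -1 <= s <= 1 -> `|f' x s| <= M) ->
  is_derive X (1 : R) (fun x => \int[mu]_(s in B) (f x s * jweight q s))
    (\int[mu]_(s in B) (f' X s * jweight q s)).
Proof.
move=> uXv df cf f'M.
have mB : measurable B by exact: measurable_itv.
have oc s : B s -> -1 <= s <= 1 by rewrite /= in_itv/= => /andP[? ?]; rewrite !ltW.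
pose h x s := f x s * jweight q s.
have dh x s : u < x < v -> B s -> is_derive x (1 : R) (h^~ s) (f' x s * jweight q s).
  move=> xuv Bs; have d := df x s xuv (oc _ Bs).
  apply: is_derive_ext (is_deriveM d (is_derive_cst (jweight q s) x (1 : R))) => //.
  by rewrite /GRing.scale/= mulr0 add0r mulrC.
have p1 x s : u < x < v -> B s -> partial1of2 h x s = f' x s * jweight q s.
  by move=> xuv Bs; have d := dh x s xuv Bs; rewrite partial1of2E derive_val.
have Ia : [set` `]u, v[] X by rewrite /= in_itv.
have ih x : [set` `]u, v[] x -> mu.-integrable B (EFin \o h x).
  rewrite /= in_itv/= => xuv; apply: (@cts_jweight_integrable _ _ q1 (f x)) => s hs; exact: cf.
have dh' x s : [set` `]u, v[] x -> B s -> derivable (h^~ s) x 1.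
  by rewrite /= in_itv/= => xuv Bs; have d := dh x s xuv Bs; exact: ex_derive.
have G0 s : 0 <= `|M| * jweight q s by rewrite mulr_ge0 ?powR_ge0.
have iG : mu.-integrable B (EFin \o (fun s => `|M| * jweight q s)).
  rewrite (_ : _ \o _ = (fun s => (`|M|%:E * (EFin \o jweight q) s)%E))//.
  by apply: integrableZl => //; exact: integrable_jweight.
have ub x s : [set` `]u, v[] x -> B s -> `|partial1of2 h x s| <= `|M| * jweight q s.
  rewrite /= in_itv/= => xuv Bs; rewrite p1// normrM (ger0_norm (powR_ge0 _ _)).
  rewrite ler_wpM2r ?powR_ge0//; apply: le_trans (f'M _ _ xuv (oc _ Bs)) _.
  exact: ler_norm.
have D := @derivable_under_integral R _ (measurableTypeR R) mu h B mB X u v Ia ih dh' _ G0 iG ub.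
have E := @differentiation_under_integral R _ (measurableTypeR R) mu h B mB X u v Ia ih dh' _ G0 iG ub.
apply: DeriveDef => //; rewrite -derive1E E; apply: eq_Rintegral => s.
by rewrite inE => Bs; rewrite p1.
Qed.

Lemma cder_jint (H H' : R -> R -> R[i]) (u v X M : R) : u < X < v ->
  (forall x s : R, u < x < v -> -1 <= s <= 1 -> cder (H^~ s) x (H' x s)) ->
  (forall x : R, u < x < v -> cdiff_on (H x)) ->
  (forall x s : R, u < x < v -> -1 <= s <= 1 -> cnorm1 (H' x s) <= M) ->
  cder (fun x => jint q (H x)) X (jint q (H' X)).
Proof.
move=> uXv dH cH HM; split => /=.
- apply: (@real_jint_is_derive (fun x s => complex.Re (H x s)) (fun x s => complex.Re (H' x s)) u v X M) => //.
  + by move=> x s xuv hs; have [] := dH x s xuv hs.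
  + by move=> x s xuv /(cH x xuv)[l /cder_continuous[]].
  + by move=> x s xuv hs; apply: le_trans (HM x s xuv hs); rewrite lerDl.
- apply: (@real_jint_is_derive (fun x s => complex.Im (H x s)) (fun x s => complex.Im (H' x s)) u v X M) => //.
  + by move=> x s xuv hs; have [] := dH x s xuv hs.
  + by move=> x s xuv /(cH x xuv)[l /cder_continuous[]].
  + by move=> x s xuv hs; apply: le_trans (HM x s xuv hs); rewrite lerDr.
Qed.

End FixedExponent.

(** [opdam_const] is the reciprocal of the mass of the weight: the Beta-Gamma relation at
    [q = alpha - 1/2], where [q + 1 = alpha + 1/2] and [q + 3/2 = alpha + 1]. *)
Lemma jint_const (alpha : R) : - 2^-1 < alpha ->
  (opdam_const alpha)%:C * jint (alpha - 2^-1) (fun=> 1) = 1.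
Proof.
move=> ha; have q1 : -1 < alpha - 2^-1 by lra.
have [b e [E [g1 g2]]] := eBeta_fin q1.
have e1 : alpha - 2^-1 + 1 = alpha + 2^-1 by field.
have e2 : alpha - 2^-1 + 3 / 2 = alpha + 1 by field.
rewrite e1 e2 in E g1 g2.
have bE : \int[mu]_(s in B) (1 * jweight (alpha - 2^-1) s) = b.
  rewrite /Rintegral; transitivity (fine (eBeta (alpha - 2^-1))); last by rewrite e.
  by congr fine; apply: eq_integral => s _; rewrite mul1r.
have b0E : \int[mu]_(s in B) (0 * jweight (alpha - 2^-1) s) = 0.
  rewrite /Rintegral (_ : (\int[mu]_(s in B) _)%E = 0%E)//.
  by apply: integral0_eq => s _; rewrite mul0r.
rewrite /jint /= bE b0E; apply: complex_ext; rewrite ?cReM ?cImM/= ?mulr0 ?mul0r ?subr0 ?addr0//.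
have p0 : 0 < Num.sqrt pi :> R by rewrite sqrtr_gt0 pi_gt0.
rewrite /opdam_const mulrAC -E mulfV// mulf_neq0// gt_eqF//.
Qed.

(** Links the mean value identities at two consecutive parameters. *)
Lemma jint_next (q : R) (h : R -> R[i]) :
  jint (q + 1) h = jint q (fun s => (1 - s ^+ 2)%:C * h s).
Proof.
have e s : s \in B -> jweight (q + 1) s = (1 - s ^+ 2) * jweight q s.
  rewrite inE/= in_itv/= => /andP[s1 s2].
  have s0 : 0 < 1 - s ^+ 2 by nra.
  have c0 : (1 + q == 0) ==> (1 - s ^+ 2 != 0) by apply/implyP => _; rewrite gt_eqF.
  by rewrite /jweight (addrC q) (powRD c0) powRr1// ltW.
apply: complex_ext => /=; apply: eq_Rintegral => s /e ->.
- by rewrite cReM/= mul0r subr0; ring.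
- by rewrite cImM/= mul0r addr0; ring.
Qed.

End ComplexWeightIntegral.

(** * Product formula *)

Section ProductFormula.
Variable R : realType.
Implicit Types X Y s v : R.
#[local] Opaque sinh cosh.

(** The hyperbolic law of cosines, with [s] in the role of the cosine of the angle: it runs from
    [cosh (X - Y)] at [s = -1] to [cosh (X + Y)] at [s = 1]. *)
Definition cosh_law X Y s : R := cosh X * cosh Y + sinh X * sinh Y * s.
Definition cosh_law_dX X Y s : R := sinh X * cosh Y + cosh X * sinh Y * s.

Lemma cosh_lawE X Y s :
  cosh_law X Y s = (1 + s) / 2 * cosh (X + Y) + (1 - s) / 2 * cosh (X - Y).
Proof. by rewrite /cosh_law !coshD coshN sinhN; field. Qed.

Lemma cosh_law_ge1 X Y s : -1 <= s <= 1 -> 1 <= cosh_law X Y s.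
Proof.
by rewrite cosh_lawE; have := cosh_ge1 (X + Y); have := cosh_ge1 (X - Y); nra.
Qed.

(** Trades the square of the X-derivative of [V] for [V^2 - 1], the leading coefficient in the
    equation of [P1]. The error is a multiple of [1 - s^2], which integration by parts in [s]
    absorbs. *)
Lemma cosh_law_dX_sqr X Y s :
  cosh_law_dX X Y s ^+ 2 = cosh_law X Y s ^+ 2 - 1 - sinh Y ^+ 2 * (1 - s ^+ 2).
Proof.
have hX := cosh2Bsinh2 X; have hY := cosh2Bsinh2 Y.
rewrite /cosh_law_dX /cosh_law.
transitivity ((cosh X * cosh Y + sinh X * sinh Y * s) ^+ 2 - 1 - sinh Y ^+ 2 * (1 - s ^+ 2)
  + (sinh Y ^+ 2 * s ^+ 2 - cosh Y ^+ 2) * (cosh X ^+ 2 - sinh X ^+ 2 - 1)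
  - (cosh Y ^+ 2 - sinh Y ^+ 2 - 1)); first by ring.
by rewrite hX hY; ring.
Qed.

Lemma cosh_norm X : cosh `|X| = cosh X.
Proof. by case: (ger0P X) => // _; rewrite coshN. Qed.

Lemma cosh_law_le X Y s W : -1 <= s <= 1 -> `|X| <= W -> cosh_law X Y s <= 2 * cosh (W + `|Y|).
Proof.
move=> hs XW; rewrite cosh_lawE.
have h Z : `|Z| <= W + `|Y| -> cosh Z <= cosh (W + `|Y|) by move=> /cosh_le; rewrite cosh_norm; apply.
have h1 : cosh (X + Y) <= cosh (W + `|Y|).
  by apply: h; apply: le_trans (ler_normD _ _) _; rewrite lerD2r.
have h2 : cosh (X - Y) <= cosh (W + `|Y|).
  by apply: h; apply: le_trans (ler_normB _ _) _; rewrite lerD2r.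
by have := cosh_ge1 (X + Y); have := cosh_ge1 (X - Y); nra.
Qed.

Lemma cosh_law_dX_le X Y s : -1 <= s <= 1 -> `|cosh_law_dX X Y s| <= cosh_law X Y s.
Proof.
move=> hs; have v1 := cosh_law_ge1 X Y hs.
rewrite -ler_sqr ?nnegrE//; last by lra.
rewrite real_normK ?num_real// cosh_law_dX_sqr.
have : 0 <= sinh Y ^+ 2 * (1 - s ^+ 2) by rewrite mulr_ge0 ?sqr_ge0//; nra.
lra.
Qed.

Lemma is_derive_linear (k l s : R) : is_derive s (1 : R) (fun s => k + l * s) l.
Proof.
apply: is_derive_ext (is_deriveD (is_derive_cst k s (1 : R)) (is_derive_scale l s)) => //.
by rewrite add0r.
Qed.

Lemma is_derive_combo (f g : R -> R) (k l X f' g' : R) :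
  is_derive X (1 : R) f f' -> is_derive X (1 : R) g g' ->
  is_derive X (1 : R) (fun X => f X * k + g X * l) (f' * k + g' * l).
Proof.
move=> df dg; have d1 := is_deriveM df (is_derive_cst k X (1 : R)).
have d2 := is_deriveM dg (is_derive_cst l X (1 : R)).
by apply: is_derive_ext (is_deriveD d1 d2) => //; rewrite /GRing.scale/=; ring.
Qed.

Lemma is_derive_cosh_law X Y s : is_derive X (1 : R) (fun X => cosh_law X Y s) (cosh_law_dX X Y s).
Proof.
have := is_derive_combo (cosh Y) (sinh Y * s) (is_derive_cosh X) (is_derive_sinh X).
by apply: is_derive_ext; [apply/funext => t|]; rewrite /cosh_law /cosh_law_dX !mulrA.
Qed.

Lemma is_derive_cosh_law_dX X Y s :
  is_derive X (1 : R) (fun X => cosh_law_dX X Y s) (cosh_law X Y s).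
Proof.
have := is_derive_combo (cosh Y) (sinh Y * s) (is_derive_sinh X) (is_derive_cosh X).
by apply: is_derive_ext; [apply/funext => t|]; rewrite /cosh_law /cosh_law_dX !mulrA.
Qed.

(** An abstract chain of three consecutive functions, so that the mean value identities can be used
    at [alpha] and at [alpha + 1] alike. *)
Variables (c : R) (m m1 : R[i]) (P0 P1 P2 : R -> R[i]).
Hypothesis c2 : 2^-1 < c.
Hypothesis dP0 : forall v, 1 <= v -> cder P0 v (m * P1 v).
Hypothesis dP1 : forall v, 1 <= v -> cder P1 v (m1 * P2 v).
Hypothesis dP2 : forall v, 1 <= v -> exists l, cder P2 v l.
Hypothesis P012 : forall v, 1 <= v ->
  (v ^+ 2 - 1)%:C * (m1 * P2 v) = (2 * c)%:C * (P0 v - v%:C * P1 v).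
Hypothesis P01 : P0 1 = 1.

(** With [c = alpha + 1] this is the exponent [alpha - 1/2] of the weight. *)
Local Notation q := (c - 3 / 2).
Local Notation V := cosh_law.
Local Notation VX := cosh_law_dX.

Let q1 : -1 < q. Proof. have := c2; lra. Qed.

Lemma bounded_on_segment (P : R -> R[i]) T : (forall v, 1 <= v -> exists l, cder P v l) ->
  exists2 M, 0 <= M & forall v, 1 <= v <= T -> cnorm1 (P v) <= M.
Proof.
move=> dP.
have [M1 M10 h1] := @segment_bounded _ (fun v => complex.Re (P v)) 1 T
  (fun v hv => let: ex_intro l hl := dP v (andP hv).1 in (cder_continuous hl).1).
have [M2 M20 h2] := @segment_bounded _ (fun v => complex.Im (P v)) 1 T
  (fun v hv => let: ex_intro l hl := dP v (andP hv).1 in (cder_continuous hl).2).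
by exists (M1 + M2); [exact: addr_ge0|move=> v hv; apply: lerD; [exact: h1|exact: h2]].
Qed.

Lemma cdiff_law (P : R -> R[i]) X Y : (forall v, 1 <= v -> exists l, cder P v l) ->
  cdiff_on (fun s => P (V X Y s)).
Proof.
move=> dP s hs; have [l hl] := dP _ (cosh_law_ge1 X Y hs).
eexists; apply: (@cder_comp _ P (fun s => V X Y s) _ _ _ hl); exact: is_derive_linear.
Qed.

Let eP0 v : 1 <= v -> exists l, cder P0 v l. Proof. by move=> /dP0; exists (m * P1 v). Qed.
Let eP1 v : 1 <= v -> exists l, cder P1 v l. Proof. by move=> /dP1; exists (m1 * P2 v). Qed.

Let dfP0 X Y := cdiff_law X Y eP0.
Let dfP1 X Y := cdiff_law X Y eP1.
Let dfP2 X Y := cdiff_law X Y dP2.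

Let dfV X Y : cdiff_on (fun s => (V X Y s)%:C).
Proof. by apply: (@cdiff_real _ _ (fun=> sinh X * sinh Y)) => s; exact: is_derive_linear. Qed.

Let dfVX X Y : cdiff_on (fun s => (VX X Y s)%:C).
Proof. by apply: (@cdiff_real _ _ (fun=> cosh X * sinh Y)) => s; exact: is_derive_linear. Qed.

Let near_norm X0 X : X0 - 1 < X < X0 + 1 -> `|X| <= `|X0| + 1.
Proof.
move=> /andP[h1 h2]; have h3 : `|X - X0| <= 1 by rewrite ler_norml; apply/andP; split; lra.
rewrite -[X](subrK X0) addrC; apply: le_trans (ler_normD _ _) _.
by rewrite lerD2l.
Qed.

Let cn_real (k : R) (z : R[i]) : cnorm1 (k%:C * z) <= `|k| * cnorm1 z.
Proof. by apply: le_trans (cnorm1M _ _) _; rewrite cnorm1_real. Qed.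

Lemma cder_even_mean X Y :
  cder (fun X => jint q (fun s => P0 (V X Y s))) X
    (m * jint q (fun s => (VX X Y s)%:C * P1 (V X Y s))).
Proof.
(* [T] bounds both [V] and its X-derivative for all [s] in [[-1, 1]] and all parameters within 1 of
   [X]: this is the uniform bound needed to differentiate under the integral. *)
pose T := 2 * cosh (`|X| + 1 + `|Y|).
have [M M0 hM] := bounded_on_segment T eP1.
have XX : X - 1 < X < X + 1 by lra.
have := @cder_jint R q q1 (fun x s => P0 (V x Y s))
  (fun x s => (VX x Y s)%:C * (m * P1 (V x Y s))) (X - 1) (X + 1) X
  (T * (cnorm1 m * M)) XX.
rewrite (_ : jint q (fun s => _ * (m * _)) = m * jint q (fun s => (VX X Y s)%:C * P1 (V X Y s))).
  apply.
  - move=> x s hx hs; apply: (@cder_comp _ P0 (fun x => V x Y s)).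
      by apply: dP0; exact: cosh_law_ge1.
    exact: is_derive_cosh_law.
  - by move=> x hx; exact: dfP0.
  - move=> x s hx hs; have v1 := cosh_law_ge1 x Y hs.
    have vT := cosh_law_le Y hs (near_norm hx).
    apply: le_trans (cn_real _ _) _; apply: ler_pM; rewrite ?cnorm1_ge0//.
      exact: le_trans (cosh_law_dX_le x Y hs) vT.
    apply: le_trans (cnorm1M _ _) _; rewrite ler_wpM2l ?cnorm1_ge0// hM//.
    by rewrite v1.
rewrite -jintZ//; last exact: cdiffM (dfVX X Y) (dfP1 X Y).
by apply: eq_jint => s _; ring.
Qed.

Lemma cder_odd_mean0 X Y :
  cder (fun X => jint q (fun s => (VX X Y s)%:C * P1 (V X Y s))) X
    (jint q (fun s => (V X Y s)%:C * P1 (V X Y s)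
      + (VX X Y s)%:C * ((VX X Y s)%:C * (m1 * P2 (V X Y s))))).
Proof.
pose T := 2 * cosh (`|X| + 1 + `|Y|).
have [M M0 hM] := bounded_on_segment T eP1.
have [N N0 hN] := bounded_on_segment T dP2.
have T0 : 0 <= T by have := cosh_ge1 (`|X| + 1 + `|Y|); rewrite /T; lra.
have XX : X - 1 < X < X + 1 by lra.
apply: (@cder_jint R q q1 (fun x s => (VX x Y s)%:C * P1 (V x Y s)) (fun x s => (V x Y s)%:C * P1 (V x Y s)
      + (VX x Y s)%:C * ((VX x Y s)%:C * (m1 * P2 (V x Y s)))) (X - 1) (X + 1) X
  (T * M + T * (T * (cnorm1 m1 * N))) XX).
- move=> x s hx hs; apply: cderM; first exact/cder_real/is_derive_cosh_law_dX.
  apply: (@cder_comp _ P1 (fun x => V x Y s)).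
    by apply: dP1; exact: cosh_law_ge1.
  exact: is_derive_cosh_law.
- by move=> x hx; exact: cdiffM (dfVX x Y) (dfP1 x Y).
- move=> x s hx hs; have v1 := cosh_law_ge1 x Y hs.
  have vT := cosh_law_le Y hs (near_norm hx).
  have vx := le_trans (cosh_law_dX_le x Y hs) vT.
  have hv : 1 <= V x Y s <= T by rewrite v1.
  apply: le_trans (cnorm1D _ _) (lerD _ _).
    apply: le_trans (cn_real _ _) _; apply: ler_pM; rewrite ?cnorm1_ge0 ?hM//.
    by rewrite ger0_norm//; lra.
  apply: le_trans (cn_real _ _) _; apply: ler_pM; rewrite ?cnorm1_ge0//.
  apply: le_trans (cn_real _ _) _; apply: ler_pM; rewrite ?cnorm1_ge0//.
  by apply: le_trans (cnorm1M _ _) _; rewrite ler_wpM2l ?cnorm1_ge0// hN.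
Qed.

(** Eliminates [Js] and [J2] from three relations: integration by parts links [Js] to [J2], the
    equation of [P1] introduces [J2], and an identity between [V], its X-derivative and [s]
    introduces [Js]. Division by [sinh X] twice is what requires [X != 0]. *)
Lemma odd_mean_eq X Y : X != 0 ->
  jint q (fun s => (V X Y s)%:C * P1 (V X Y s)
      + (VX X Y s)%:C * ((VX X Y s)%:C * (m1 * P2 (V X Y s)))) =
  (2 * c)%:C * jint q (fun s => P0 (V X Y s)) -
  ((2 * c - 1) * (cosh X / sinh X))%:C * jint q (fun s => (VX X Y s)%:C * P1 (V X Y s)).
Proof.
move=> X0.
have sX : sinh X != 0.
  have [XN|XP|/eqP] := ltgtP X 0; last by rewrite (negbTE X0).
    by rewrite -oppr_eq0 -sinhN gt_eqF// sinh_gt0// oppr_gt0.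
  by rewrite gt_eqF// sinh_gt0.
pose J0 := jint q (fun s => P0 (V X Y s)).
pose JV := jint q (fun s => (V X Y s)%:C * P1 (V X Y s)).
pose Js := jint q (fun s => s%:C * P1 (V X Y s)).
pose J2 := jint q (fun s => (1 - s ^+ 2)%:C * (m1 * P2 (V X Y s))).
have ds2 : cdiff_on (fun s => (1 - s ^+ 2)%:C).
  exact: (@cdiff_real _ _ (fun s => 0 - (s *: (1 : R) + s *: (1 : R)))).
have dm2 : cdiff_on (fun s => m1 * P2 (V X Y s)).
  exact: cdiffM (cdiff_cst _) (dfP2 X Y).
have ibp : (2 * c - 1)%:C * Js = (sinh X * sinh Y)%:C * J2.
  have := @jint_ibp R q q1 (fun s => P1 (V X Y s))
    (fun s => (sinh X * sinh Y)%:C * (m1 * P2 (V X Y s))).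
  rewrite (_ : 2 * (q + 1) = 2 * c - 1); last by field.
  move=> ->.
  - rewrite /J2 -jintZ//; last exact: cdiffM.
    by apply: eq_jint => s _; ring.
  - move=> s hs; apply: (@cder_comp _ P1 (fun s => V X Y s)).
      by apply: dP1; exact: cosh_law_ge1.
    exact: is_derive_linear.
  - exact: cdiffM (cdiff_cst _) dm2.
have E1 : jint q (fun s => (V X Y s)%:C * P1 (V X Y s)
      + (VX X Y s)%:C * ((VX X Y s)%:C * (m1 * P2 (V X Y s)))) =
  (2 * c)%:C * J0 + (1 - (2 * c)%:C) * JV + (- (sinh Y ^+ 2)%:C) * J2.
  rewrite /J0 /JV /J2.
  have d0 := dfP0 X Y; have dV := cdiffM (dfV X Y) (dfP1 X Y).
  have d2 := cdiffM ds2 dm2.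
  rewrite -!jintZ// -!jintD//; try (by apply: cdiffM => //; exact: cdiff_cst).
    apply: eq_jint => s /andP[s1 s2].
    have hs : -1 <= s <= 1 by rewrite !ltW.
    have := P012 (cosh_law_ge1 X Y hs).
    have -> : (V X Y s ^+ 2 - 1)%:C = (VX X Y s)%:C ^+ 2 + (sinh Y ^+ 2)%:C * (1 - s ^+ 2)%:C.
      by rewrite -rmorphXn -rmorphM -rmorphD; congr (_%:C); rewrite cosh_law_dX_sqr; ring.
    move=> e.
    transitivity ((V X Y s)%:C * P1 (V X Y s) + (((VX X Y s)%:C ^+ 2 +
      (sinh Y ^+ 2)%:C * (1 - s ^+ 2)%:C) * (m1 * P2 (V X Y s)))
      - (sinh Y ^+ 2)%:C * ((1 - s ^+ 2)%:C * (m1 * P2 (V X Y s)))); first by ring.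
    by rewrite e; ring.
  by apply: cdiffD; apply: cdiffM => //; exact: cdiff_cst.
have E2 : (sinh X)%:C * jint q (fun s => (VX X Y s)%:C * P1 (V X Y s)) * (cosh X)%:C =
    (sinh X ^+ 2)%:C * JV + (sinh X * sinh Y)%:C * Js.
  have dV := cdiffM (dfV X Y) (dfP1 X Y).
  have dVX := cdiffM (dfVX X Y) (dfP1 X Y).
  have ds := cdiffM (@cdiff_id R) (dfP1 X Y).
  rewrite /JV /Js -!jintZ// -jintD//; try (by apply: cdiffM => //; exact: cdiff_cst).
  rewrite mulrC -jintZ//; last by apply: cdiffM => //; exact: cdiff_cst.
  apply: eq_jint => s _.
  have E : cosh X * (sinh X * VX X Y s) = sinh X ^+ 2 * V X Y s + sinh X * sinh Y * s.
    have e : cosh X ^+ 2 = 1 + sinh X ^+ 2 by rewrite -(cosh2Bsinh2 X); ring.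
    transitivity (sinh X ^+ 2 * (cosh X * cosh Y) + sinh X * sinh Y * s * cosh X ^+ 2).
      by rewrite /VX; ring.
    by rewrite e /V; ring.
  have comb (k1 k2 k3 k4 k5 k6 : R) (z : R[i]) : k1 * (k2 * k3) = k4 * k5 + k6 * s ->
      k1%:C * (k2%:C * (k3%:C * z)) = k4%:C * (k5%:C * z) + k6%:C * (s%:C * z).
    by move=> /(congr1 (real_complex R)); rewrite rmorphD !rmorphM => e; rewrite !mulrA -mulrDl -e mulrA.
  exact: comb E.
have sXC : (sinh X)%:C != 0 :> R[i] by rewrite fmorph_eq0.
rewrite E1 -/J0; move: ibp E2.
set JX := jint q (fun s => (VX X Y s)%:C * _).
have e6 : (2 * c)%:C = 2 * c%:C :> R[i] by rewrite rmorphM rmorph_nat.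
have e1 : (2 * c - 1)%:C = 2 * c%:C - 1 :> R[i] by rewrite rmorphB rmorph1 rmorphM rmorph_nat.
have e2 : ((2 * c - 1) * (cosh X / sinh X))%:C =
    (2 * c%:C - 1) * ((cosh X)%:C / (sinh X)%:C) :> R[i].
  by rewrite [LHS]rmorphM fmorph_div rmorphB rmorph1 rmorphM rmorph_nat.
have e3 : (sinh X * sinh Y)%:C = (sinh X)%:C * (sinh Y)%:C :> R[i] by exact: rmorphM.
have e4 x : (sinh x ^+ 2)%:C = (sinh x)%:C ^+ 2 :> R[i] by exact: rmorphXn.
rewrite e6 e1 e2 e3 !e4.
move: (sinh X)%:C sXC => sx sx0.
set sy := (sinh Y)%:C; set cx := (cosh X)%:C; set C := c%:C => ibp E2.
have J2E : J2 * (sx * sy) = (2 * C - 1) * Js by rewrite ibp; ring.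
apply: (mulfI sx0); apply: (mulfI sx0).
transitivity (sx ^+ 2 * (2 * C * J0 + (1 - 2 * C) * JV) - sx * sy * (J2 * (sx * sy))); first by ring.
rewrite J2E.
transitivity (sx ^+ 2 * (2 * C * J0) - (2 * C - 1) * (sx * JX * cx)); last by field.
by rewrite E2; ring.
Qed.

Let b := jint q (fun=> 1).

(** At [X = 0] one has [V = cosh Y], and the X-derivative of [V] is [s * sinh Y]. The initial data
    of the two means are thus [k] and 0, which are those of [k] times the pair itself. *)
Lemma even_odd_mean_ge0 X Y : 0 <= X ->
  jint q (fun s => P0 (V X Y s)) = b * P0 (cosh Y) * P0 (cosh X) /\
  jint q (fun s => (VX X Y s)%:C * P1 (V X Y s)) =
    b * P0 (cosh Y) * ((sinh X)%:C * P1 (cosh X)).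
Proof.
move=> X0.
pose k := b * P0 (cosh Y).
pose p X := jint q (fun s => P0 (V X Y s)) - k * P0 (cosh X).
pose r X := jint q (fun s => (VX X Y s)%:C * P1 (V X Y s)) - k * ((sinh X)%:C * P1 (cosh X)).
have de x : cder (fun x => P0 (cosh x)) x (m * ((sinh x)%:C * P1 (cosh x))).
  have := cder_comp (dP0 (cosh_ge1 x)) (is_derive_cosh x).
  by congr (cder _ _ _); ring.
have dodd x : cder (fun x => (sinh x)%:C * P1 (cosh x)) x
    ((2 * c)%:C * P0 (cosh x) - ((2 * c - 1) * cosh x)%:C * P1 (cosh x)).
  have := cderM (cder_real (is_derive_sinh x)) (cder_comp (dP1 (cosh_ge1 x)) (is_derive_cosh x)).
  congr (cder _ _ _).
  have e : (cosh x ^+ 2 - 1)%:C = (sinh x)%:C * (sinh x)%:C :> R[i].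
    by rewrite -rmorphM; congr (_%:C); rewrite -(cosh2Bsinh2 x); ring.
  have e' : ((2 * c - 1) * cosh x)%:C = ((2 * c)%:C - 1) * (cosh x)%:C :> R[i].
    by rewrite [LHS]rmorphM rmorphB rmorph1.
  transitivity ((cosh x)%:C * P1 (cosh x) + (cosh x ^+ 2 - 1)%:C * (m1 * P2 (cosh x))).
    by rewrite e; ring.
  by rewrite (P012 (cosh_ge1 x)) e'; ring.
suff U : p X = 0 /\ r X = 0.
  by case: U => /eqP + /eqP; rewrite !subr_eq0 => /eqP -> /eqP ->.
apply: (@jacobi_system_unique R m c X p r (ltW c2)) => //.
- by move=> x _; eexists; apply: cderB; [exact: cder_even_mean|apply: cderZ; exact: de].
- by move=> x _; eexists; apply: cderB; [exact: cder_odd_mean0|apply: cderZ; exact: dodd].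
- move=> x _; have := cderB (cder_even_mean x Y) (cderZ k (de x)).
  by congr (cder _ _ _); rewrite /r; ring.
- move=> x /andP[x0 _]; have := cderB (cder_odd_mean0 x Y) (cderZ k (dodd x)).
  congr (cder _ _ _); rewrite odd_mean_eq ?gt_eqF//.
  have sx : sinh x != 0 by rewrite gt_eqF// sinh_gt0.
  have -> : ((2 * c - 1) * cosh x)%:C = ((2 * c - 1) * (cosh x / sinh x))%:C * (sinh x)%:C.
    by rewrite -rmorphM; congr (_%:C); field.
  by rewrite /p /r; ring.
- have z0 : jint q (fun s => P0 (V 0 Y s)) = P0 (cosh Y) * b.
    rewrite /b -jintZ//; last exact: cdiff_cst.
    by apply: eq_jint => s _; rewrite /cosh_law cosh0 sinh0 mul1r !mul0r addr0 mulr1.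
  by rewrite /p z0 cosh0 P01 /k; ring.
- rewrite /r sinh0 mul0r mulr0 subr0.
  (* The first moment of the weight vanishes: integration by parts with [h = 1]. *)
  have z : jint q (fun s => s%:C * 1) = 0.
    have n0 : (2 * (q + 1))%:C != 0 :> R[i] by rewrite fmorph_eq0 gt_eqF//; have := q1; lra.
    apply: (mulfI n0); rewrite mulr0 (@jint_ibp R q q1 _ (fun=> 0)).
    + rewrite (_ : (fun s => _) = (fun=> 0 * 1)); last by apply/funext => s; rewrite mulr0 mul0r.
      by rewrite jintZ ?mul0r//; exact: cdiff_cst.
    + by move=> s _; exact: cder_cst.
    + exact: cdiff_cst.
  transitivity (((sinh Y)%:C * P1 (cosh Y)) * jint q (fun s => s%:C * 1)); last by rewrite z mulr0.
  rewrite -jintZ//; last by apply: cdiffM; [exact: cdiff_id|exact: cdiff_cst].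
  apply: eq_jint => s _.
  rewrite /cosh_law /cosh_law_dX cosh0 sinh0 !mul1r !mul0r addr0 add0r rmorphM; ring.
Qed.

(** Uniqueness covers [X >= 0]; for the other sign, [s -> - s] changes [V X Y] into [V (- X) Y] and
    preserves the weight. *)
Lemma even_mean X Y : jint q (fun s => P0 (V X Y s)) = b * (P0 (cosh X) * P0 (cosh Y)).
Proof.
have [X0|X0] := leP 0 X; first by rewrite (even_odd_mean_ge0 Y X0).1; ring.
rewrite -(jint_reflect q1); last exact: dfP0.
have e s : V X Y (- s) = V (- X) Y s by rewrite /cosh_law coshN sinhN; ring.
under eq_fun do rewrite e.
rewrite (even_odd_mean_ge0 Y (_ : 0 <= - X)).1 ?coshN; last by lra.
by ring.
Qed.

Lemma odd_mean X Y : jint q (fun s => (VX X Y s)%:C * P1 (V X Y s)) =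
  b * ((sinh X)%:C * P1 (cosh X) * P0 (cosh Y)).
Proof.
have [X0|X0] := leP 0 X; first by rewrite (even_odd_mean_ge0 Y X0).2; ring.
rewrite -(jint_reflect q1); last exact: cdiffM (dfVX X Y) (dfP1 X Y).
have e s : (VX X Y (- s))%:C * P1 (V X Y (- s)) = -1 * ((VX (- X) Y s)%:C * P1 (V (- X) Y s)).
  have -> : V X Y (- s) = V (- X) Y s by rewrite /cosh_law coshN sinhN; ring.
  have -> : VX X Y (- s) = - VX (- X) Y s by rewrite /cosh_law_dX coshN sinhN; ring.
  by rewrite rmorphN; ring.
under eq_fun do rewrite e.
rewrite jintZ//; last exact: cdiffM (dfVX (- X) Y) (dfP1 (- X) Y).
have X0' : 0 <= - X by lra.
by rewrite (even_odd_mean_ge0 Y X0').2 coshN sinhN rmorphN; ring.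
Qed.

End ProductFormula.

(** * The hypergeometric functions in the variable cosh X, and the product formula *)

Section LegendreVariable.
Variable R : realType.
Implicit Types (a b : R[i]) (c v X Y s : R).

(** When [a + b + 1 = 2 c] this is a normalised Gegenbauer function of [v], with value 1 at
    [v = 1]. *)
Definition legendre_fun a b c v : R[i] := hyp_fun a b c ((1 - v) / 2).

Lemma cder_unique (f : R -> R[i]) x l k : cder f x l -> cder f x k -> l = k.
Proof.
move=> [lr li] [kr ki]; apply: complex_ext.
- by rewrite -(@derive_val _ _ _ _ _ _ _ lr) (@derive_val _ _ _ _ _ _ _ kr).
- by rewrite -(@derive_val _ _ _ _ _ _ _ li) (@derive_val _ _ _ _ _ _ _ ki).
Qed.

Lemma is_derive_half_onem v : is_derive v (1 : R) (fun v => (1 - v) / 2) (- 2^-1).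
Proof.
have := is_derive_linear 2^-1 (- 2^-1) v.
by apply: is_derive_ext => //; apply/funext => w; field.
Qed.

Lemma cder_legendre a b c v : 2^-1 <= c -> a + b + 1 = (2 * c)%:C -> 1 <= v ->
  cder (legendre_fun a b c) v
    (- (a * b) / (2 * c)%:C * legendre_fun (a + 1) (b + 1) (c + 1) v).
Proof.
move=> c2 abc v1; have t1 : (1 - v) / 2 < 1 by lra.
have [d _] := hyp_fun_system c2 abc t1.
have := @cder_comp _ _ (fun v => (1 - v) / 2) v _ _ d (is_derive_half_onem v).
congr (cder _ _ _); rewrite rmorphN rmorphM fmorphV rmorph_nat.
have c0 : c%:C != 0 :> R[i] by apply: realC_neq0; lra.
by rewrite /legendre_fun; field.
Qed.

Lemma legendre_contiguous a b c v : 2^-1 <= c -> a + b + 1 = (2 * c)%:C -> 1 <= v ->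
  (v ^+ 2 - 1)%:C * (- ((a + 1) * (b + 1)) / (2 * (c + 1))%:C *
     legendre_fun (a + 1 + 1) (b + 1 + 1) (c + 1 + 1) v) =
  (2 * c)%:C * (legendre_fun a b c v - v%:C * legendre_fun (a + 1) (b + 1) (c + 1) v).
Proof.
move=> c2 abc v1; have t1 : (1 - v) / 2 < 1 by lra.
have c21 : 2^-1 <= c + 1 by lra.
have [_ [dg hdg e]] := hyp_fun_system c2 abc t1.
have [d _] := hyp_fun_system c21 (abc_next abc) t1.
rewrite (cder_unique hdg d) abc in e; rewrite /legendre_fun.
have c0 : (c + 1)%:C != 0 :> R[i] by apply: realC_neq0; lra.
have e1 : (v ^+ 2 - 1)%:C = - 4 * ((1 - v) / 2 * (1 - (1 - v) / 2))%:C :> R[i].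
  by rewrite -(rmorph_nat (real_complex R)) -rmorphN -rmorphM; congr (_%:C); field.
have e2 : (2 * (c + 1))%:C = 2 * (c + 1)%:C :> R[i] by rewrite rmorphM rmorph_nat.
have e3 : ((1 - v) / 2)%:C = (1 - v%:C) / 2 :> R[i].
  by rewrite rmorphM fmorphV rmorphB rmorph1 rmorph_nat.
have e4 : (2 * c)%:C = 2 * c%:C :> R[i] by rewrite rmorphM rmorph_nat.
rewrite e3 e4 in e.
rewrite e1 e2 e4; move: e; set F := hyp_fun _ _ _ _; set z := (_ * _)%:C; set C := (c + 1)%:C in c0 * => e.
clearbody C z F.
transitivity (2 * (z * ((a + 1) * (b + 1) / C * F))); first by field.
by rewrite e; field.
Qed.

Section Opdam.
Variables (a b : R[i]) (alpha : R).
Hypothesis halpha : - 2^-1 < alpha.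
Local Notation c := (alpha + 1).
Local Notation q := (alpha - 2^-1).
Hypothesis abc : a + b + 1 = (2 * c)%:C.

(* The Opdam function at X / 2, when a = (2 alpha + 1 + i lambda) / 2. *)
Definition opdam_cosh (X : R) : R[i] :=
  legendre_fun a b c (cosh X) +
  a / (2 * c)%:C * ((sinh X)%:C * legendre_fun (a + 1) (b + 1) (c + 1) (cosh X)).

(* Half the sum over z and - z of the Opdam function times density_ratio below, when
   cosh 2z = cosh_law X Y s. *)
Definition opdam_fold X Y s : R[i] :=
  (1 + s)%:C * (legendre_fun a b c (cosh_law X Y s) +
    a / (2 * c)%:C * legendre_fun (a + 1) (b + 1) (c + 1) (cosh_law X Y s) *
    (expR (X + Y) - cosh_law X Y s)%:C).

Lemma cdiff_opdam_fold X Y : cdiff_on (opdam_fold X Y).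
Proof.
have c2 : 2^-1 <= c by have := halpha; lra.
have c21 : 2^-1 <= c + 1 by have := halpha; lra.
have d1 : cdiff_on (fun s => (1 + s)%:C).
  apply: (@cdiff_real _ _ (fun=> 1)) => s.
  by apply: is_derive_ext (is_derive_linear 1 1 s) => //; apply/funext => w; rewrite mul1r.
have d2 : cdiff_on (fun s => (expR (X + Y) - cosh_law X Y s)%:C).
  apply: (@cdiff_real _ _ (fun=> - (sinh X * sinh Y))) => s.
  apply: is_derive_ext (is_derive_linear (expR (X + Y) - cosh X * cosh Y) (- (sinh X * sinh Y)) s) => //.
  by apply/funext => w; rewrite /cosh_law; ring.
apply: cdiffM d1 _; apply: cdiffD.
  by apply: cdiff_law => v v1; eexists; exact: (cder_legendre c2 abc v1).
apply: cdiffM d2; apply: cdiffM; first exact: cdiff_cst.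
by apply: cdiff_law => v v1; eexists; exact: (cder_legendre c21 (abc_next abc) v1).
Qed.

Lemma opdam_product X Y :
  opdam_cosh X * opdam_cosh Y =
  (opdam_const alpha)%:C * jint q (opdam_fold X Y).
Proof.
have c2 : 2^-1 < c by have := halpha; lra.
have c21 : 2^-1 < c + 1 by have := halpha; lra.
have c22 : 2^-1 < c + 1 + 1 by have := halpha; lra.
have q1 : -1 < q by have := halpha; lra.
have abc1 := abc_next abc; have abc2 := abc_next abc1.
pose P0 := legendre_fun a b c; pose P1 := legendre_fun (a + 1) (b + 1) (c + 1).
pose P2 := legendre_fun (a + 1 + 1) (b + 1 + 1) (c + 1 + 1).
(* At the next level [even_mean] takes [P1], [P2], [P3] as its chain, so four consecutive functions
   are involved. *)
pose P3 := legendre_fun (a + 1 + 1 + 1) (b + 1 + 1 + 1) (c + 1 + 1 + 1).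
pose m := - (a * b) / (2 * c)%:C; pose m1 := - ((a + 1) * (b + 1)) / (2 * (c + 1))%:C.
pose m2 := - ((a + 1 + 1) * (b + 1 + 1)) / (2 * (c + 1 + 1))%:C.
have d0 v : 1 <= v -> cder P0 v (m * P1 v) by move=> v1; exact: cder_legendre (ltW c2) abc v1.
have d1 v : 1 <= v -> cder P1 v (m1 * P2 v) by move=> v1; exact: cder_legendre (ltW c21) abc1 v1.
have d2 v : 1 <= v -> cder P2 v (m2 * P3 v) by move=> v1; exact: cder_legendre (ltW c22) abc2 v1.
have c23 : 2^-1 < c + 1 + 1 + 1 by lra.
have d3 v : 1 <= v -> exists l, cder P3 v l.
  by move=> v1; eexists; exact: cder_legendre (ltW c23) (abc_next abc2) v1.
have e2 v : 1 <= v -> exists l, cder P2 v l by move=> /d2; exists (m2 * P3 v).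
have e1 v : 1 <= v -> exists l, cder P1 v l by move=> /d1; exists (m1 * P2 v).
have e0 v : 1 <= v -> exists l, cder P0 v l by move=> /d0; exists (m * P1 v).
have r0 v (v1 : 1 <= v) := legendre_contiguous (ltW c2) abc v1.
have r1 v (v1 : 1 <= v) := legendre_contiguous (ltW c21) abc1 v1.
have one a' b' c' : legendre_fun a' b' c' 1 = 1.
  by rewrite /legendre_fun subrr mul0r /hyp_fun ltxx gauss_csum0.
have qE : c - 3 / 2 = q by field.
have qE1 : c + 1 - 3 / 2 = q + 1 by field.
pose n := jint q (fun=> 1); pose n1 := jint (q + 1) (fun=> 1).
have H1 := even_mean c2 d0 d1 e2 r0 (one _ _ _) X Y.
have H2 := odd_mean c2 d0 d1 e2 r0 (one _ _ _) X Y.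
(* [V] is symmetric in [X] and [Y], so exchanging them gives the mean of the Y-derivative of [V]
   times [P1]. *)
have H3 := odd_mean c2 d0 d1 e2 r0 (one _ _ _) Y X.
have H4 := even_mean c21 d1 d2 d3 r1 (one _ _ _) X Y.
rewrite qE -/n in H1 H2 H3; rewrite qE1 -/n1 in H4.
pose V := cosh_law X Y.
have VE s : cosh_law Y X s = V s by rewrite /V /cosh_law; ring.
have dV0 := cdiff_law X Y e0; have dV1 := cdiff_law X Y e1.
have dsq : cdiff_on (fun s => (1 - s ^+ 2)%:C).
  exact: (@cdiff_real _ _ (fun s => 0 - (s *: (1 : R) + s *: (1 : R)))).
have rho0 : (2 * (q + 1))%:C != 0 :> R[i] by rewrite fmorph_eq0 gt_eqF//; lra.
have c0 : (2 * c)%:C != 0 :> R[i] by apply: realC_neq0; lra.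
have rhoE : (2 * (q + 1))%:C = (2 * c)%:C - 1 :> R[i].
  by rewrite -(rmorph1 (real_complex R)) -rmorphB; congr (_%:C); field.
have abE : a + b = (2 * (q + 1))%:C by rewrite rhoE -abc; ring.
(* Ratio of the masses of two consecutive weights, by parts with [h s = s]. *)
have N1 : (2 * c)%:C * n1 = (2 * (q + 1))%:C * n.
  have h := @jint_ibp R q q1 (fun s => s%:C) (fun=> 1)
    (fun s _ => cder_real (is_derive_id s 1)) (cdiff_cst 1).
  have n1E : n1 = jint q (fun s => (1 - s ^+ 2)%:C * 1) by rewrite /n1 jint_next.
  have sE : jint q (fun s => s%:C * s%:C) = n - n1.
    rewrite n1E.
    transitivity (n + -1 * jint q (fun s => (1 - s ^+ 2)%:C * 1)); last by ring.
    have d1' := cdiffM dsq (cdiff_cst (1 : R[i])).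
    rewrite /n -(jintZ q1 (-1) d1') -(jintD q1 (cdiff_cst 1) (cdiffM (cdiff_cst (-1)) d1')).
    by apply: eq_jint => s _; rewrite rmorphB rmorph1 rmorphXn/=; ring.
  have {}h : (2 * (q + 1))%:C * (n - n1) = n1 by rewrite -sE [RHS]n1E; exact: h.
  transitivity ((2 * (q + 1))%:C * n1 + (2 * (q + 1))%:C * (n - n1)); last by ring.
  by rewrite h rhoE; ring.
pose A := jint q (fun s => (1 - s ^+ 2)%:C * P1 (V s)).
have AE : A = n1 * (P1 (cosh X) * P1 (cosh Y)) by rewrite -H4; exact: esym (jint_next _ _).
(* Integration by parts trades the factor [s] for [1 - s^2], hence for the weight of the next
   level. *)
have S : (2 * (q + 1))%:C * jint q (fun s => s%:C * P0 (V s)) =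
    (sinh X * sinh Y)%:C * (m * A).
  rewrite (@jint_ibp R q q1 _ (fun s => (sinh X * sinh Y)%:C * (m * P1 (V s)))).
  - transitivity ((sinh X * sinh Y)%:C * m * A); last by ring.
    rewrite /A -(jintZ q1 _ (cdiffM dsq dV1)).
    by apply: eq_jint => s _; ring.
  - move=> s hs; apply: (@cder_comp _ P0 (fun s => V s)).
      by apply: d0; exact: cosh_law_ge1.
    exact: is_derive_linear.
  - by apply: cdiffM; [exact: cdiff_cst|apply: cdiffM; [exact: cdiff_cst|]].
have dVX (Z W : R) : cdiff_on (fun s => (cosh_law_dX Z W s)%:C).
  by apply: (@cdiff_real _ _ (fun=> cosh Z * sinh W)) => s; exact: is_derive_linear.
have H3' : jint q (fun s => (cosh_law_dX Y X s)%:C * P1 (V s)) =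
    n * ((sinh Y)%:C * P1 (cosh Y) * P0 (cosh X)).
  by rewrite -H3; apply: eq_jint => s _; rewrite VE.
pose kap : R[i] := a / (2 * c)%:C.
have foldE : jint q (opdam_fold X Y) =
   jint q (fun s => P0 (V s)) + (jint q (fun s => s%:C * P0 (V s)) +
   (kap * jint q (fun s => (cosh_law_dX X Y s)%:C * P1 (V s)) +
   (kap * jint q (fun s => (cosh_law_dX Y X s)%:C * P1 (V s)) +
   (kap * (sinh X * sinh Y)%:C) * A))).
  have dk := cdiff_cst kap; have dk' := cdiff_cst (kap * (sinh X * sinh Y)%:C).
  have ds := cdiffM (@cdiff_id R) dV0.
  have dx := cdiffM (dVX X Y) dV1; have dy := cdiffM (dVX Y X) dV1.
  have dA := cdiffM dsq dV1.
  have f3 := cdiffM dk dx; have f4 := cdiffM dk dy; have f5 := cdiffM dk' dA.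
  have f45 := cdiffD f4 f5; have f35 := cdiffD f3 f45.
  transitivity (jint q (fun s => P0 (V s) + (s%:C * P0 (V s) +
     (kap * ((cosh_law_dX X Y s)%:C * P1 (V s)) + (kap * ((cosh_law_dX Y X s)%:C * P1 (V s)) +
     kap * (sinh X * sinh Y)%:C * ((1 - s ^+ 2)%:C * P1 (V s))))))).
    apply: eq_jint => s _; rewrite /opdam_fold -/P0 -/P1 -/V -/kap.
    have E1 : (1 + s)%:C = 1 + s%:C :> R[i] by rewrite rmorphD rmorph1.
    have E2 : (1 + s) * (expR (X + Y) - V s) = cosh_law_dX X Y s + cosh_law_dX Y X s
        + (sinh X * sinh Y) * (1 - s ^+ 2).
      by rewrite -coshDsinh coshD sinhD /V /cosh_law /cosh_law_dX; ring.
    transitivity ((1 + s)%:C * P0 (V s) + kap * P1 (V s) * ((1 + s)%:C * (expR (X + Y) - V s)%:C)).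
      by ring.
    have E3 : (1 + s)%:C * (expR (X + Y) - V s)%:C = (cosh_law_dX X Y s)%:C +
        (cosh_law_dX Y X s)%:C + (sinh X * sinh Y)%:C * (1 - s ^+ 2)%:C :> R[i].
      by rewrite -!rmorphM -!rmorphD E2.
    by rewrite E3 E1; ring.
  etransitivity; first exact: (jintD q1 dV0 (cdiffD ds f35)); congr (_ + _).
  etransitivity; first exact: (jintD q1 ds f35); congr (_ + _).
  etransitivity; first exact: (jintD q1 f3 f45).
  congr (_ + _); first exact: (jintZ q1 kap dx).
  etransitivity; first exact: (jintD q1 f4 f5).
  congr (_ + _); first exact: (jintZ q1 kap dy).
  exact: (jintZ q1 _ dA).
rewrite foldE H1 H2 H3' AE.
have S' : jint q (fun s => s%:C * P0 (V s)) =
    (sinh X * sinh Y)%:C * m * n1 * (P1 (cosh X) * P1 (cosh Y)) / (2 * (q + 1))%:C.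
  apply: (mulfI rho0); rewrite S AE.
  by move: (2 * (q + 1))%:C rho0 => r hr; field.
have M1 : (opdam_const alpha)%:C * n = 1 by exact: jint_const.
have n1E : n1 = (2 * (q + 1))%:C * n / (2 * c)%:C by rewrite -N1 mulrC mulKf.
rewrite S' n1E /opdam_cosh -/P0 -/P1 -/kap.
have shE : (sinh X * sinh Y)%:C = (sinh X)%:C * (sinh Y)%:C :> R[i] by exact: rmorphM.
rewrite shE; move: (opdam_const alpha)%:C M1 => M M1.
transitivity ((M * n) * ((P0 (cosh X) + kap * ((sinh X)%:C * P1 (cosh X))) *
  (P0 (cosh Y) + kap * ((sinh Y)%:C * P1 (cosh Y))))); first by rewrite M1 mul1r.
have abE' : b = (2 * (q + 1))%:C - a by rewrite -abE; ring.
(* Substituting [a = 2 c * kap] and [b = 2 (q + 1) - a] splits [m] into a part with [kap ^ 2],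
   wanted for the product of the two odd terms, and a part that cancels the contribution of
   [1 - s^2] in [foldE]. *)
have mE : m * n = (2 * c)%:C * kap ^+ 2 * n - kap * (2 * (q + 1))%:C * n.
  rewrite /m /kap abE'; move: (2 * (q + 1))%:C (2 * c)%:C c0 => r C C0.
  by field.
move: (2 * (q + 1))%:C rho0 mE => r rho0 mE.
transitivity (M * (n * (P0 (cosh X) * P0 (cosh Y)) +
  (m * n * ((sinh X)%:C * (sinh Y)%:C) * (P1 (cosh X) * P1 (cosh Y)) / (2 * c)%:C +
  (kap * (n * ((sinh X)%:C * P1 (cosh X) * P0 (cosh Y))) +
  (kap * (n * ((sinh Y)%:C * P1 (cosh Y) * P0 (cosh X))) +
   kap * ((sinh X)%:C * (sinh Y)%:C) * (r * n / (2 * c)%:C * (P1 (cosh X) * P1 (cosh Y)))))))).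
  by rewrite mE; move: (2 * c)%:C c0 => C C0; field.
by move: (2 * c)%:C c0 => C C0; field; rewrite C0 rho0.
Qed.

End Opdam.
End LegendreVariable.

(** * Substitution and folding for signed integrands *)

Section SignedChangeOfVariable.
Variable R : realType.
Local Notation mu := (@lebesgue_measure R).
Implicit Types (F G : R -> R) (a b : R).

Section Substitution.
Variables (F F' G : R -> R) (a b : R).
Hypothesis ab : a < b.
Hypothesis dF : forall x, a <= x <= b -> is_derive x (1 : R) F (F' x).
Hypothesis cF' : forall x, a < x < b -> {for x, continuous F'}.
Hypothesis F'0 : forall x, a < x < b -> 0 < F' x.
Hypothesis cG : forall y, F a < y < F b -> {for y, continuous G}.

Let Fx x : a < x < b -> F a < F x < F b.
Proof.
move=> /andP[ax xb].
have Fin u v : a <= u -> u < v -> v <= b -> F u < F v.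
  move=> au uv vb; have [z||z] := @MVT _ F F' u v uv.
  - by rewrite in_itv/= => /andP[xz zy]; apply: dF; lra.
  - apply: continuous_in_subspaceT => z; rewrite inE/= in_itv/= => /andP[xz zy].
    have hz : a <= z <= b by lra.
    exact: is_derive_continuous (dF hz).
  - rewrite in_itv/= => /andP[xz zy] E.
    by rewrite -subr_gt0 E mulr_gt0 ?subr_gt0//; apply: F'0; lra.
by rewrite !Fin//; lra.
Qed.

Let cGF x : a < x < b -> {for x, continuous (fun x => G (F x) * F' x)}.
Proof.
move=> xab; apply: cvgM; last exact: cF'.
apply: (@continuous_comp _ _ _ F G); last by apply: cG; exact: Fx.
have hx : a <= x <= b by case/andP: xab => ? ?; rewrite !ltW.
exact: is_derive_continuous (dF hx).
Qed.

Lemma integral_subst_oo :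
  (\int[mu]_(y in `]F a, F b[) (G y)%:E =
   \int[mu]_(x in `]a, b[) (G (F x) * F' x)%:E)%E.
Proof.
have P (H : R -> R) : (forall y, F a < y < F b -> {for y, continuous H}) ->
    (forall y, 0 <= H y) ->
  (\int[mu]_(y in `]F a, F b[) (H y)%:E =
   \int[mu]_(x in `]a, b[) (H (F x) * F' x)%:E)%E.
  by move=> cH H0; apply: ge0_integral_subst_oo => // y _.
have pos (H : R -> R) y : {for y, continuous H} -> {for y, continuous (fun y => Num.max (H y) 0)}.
  by move=> cH; apply: continuous_max => //; exact: cvg_cst.
rewrite integralE [RHS]integralE; congr (_ - _)%E.
- transitivity (\int[mu]_(y in `]F a, F b[) (Num.max (G y) 0)%:E)%E.
    by apply: eq_integral => y _; rewrite funeposE EFin_max.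
  rewrite P; [|by move=> y /cG; exact: pos|by move=> y; rewrite le_max lexx orbT].
  apply: eq_integral => x; rewrite inE/= in_itv/= => xab.
  rewrite funeposE -EFin_max; congr (_%:E).
  by rewrite maxr_pMl ?ltW ?F'0// mul0r.
- transitivity (\int[mu]_(y in `]F a, F b[) (Num.max (- G y) 0)%:E)%E.
    by apply: eq_integral => y _; rewrite funenegE EFin_max.
  rewrite (P (fun y => Num.max (- G y) 0)).
  + apply: eq_integral => x; rewrite inE/= in_itv/= => xab.
    rewrite funenegE -EFinN -EFin_max; congr (_%:E).
    by rewrite maxr_pMl ?ltW ?F'0// mul0r mulNr.
  + by move=> y /cG cy; apply: (pos (fun y => - G y)); exact: continuousN.
  + by move=> y; rewrite le_max lexx orbT.
Qed.

Lemma integrable_subst_oo :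
  mu.-integrable `]F a, F b[ (EFin \o G) ->
  mu.-integrable `]a, b[ (fun x => (G (F x) * F' x)%:E).
Proof.
move=> /integrableP[_ fin]; apply/integrableP; split.
  by apply/measurable_EFinP; exact: continuous_itv_measurable cGF.
rewrite (_ : (\int[mu]_(x in _) _)%E = (\int[mu]_(y in `]F a, F b[) `|(EFin \o G) y|)%E)//.
have -> : (\int[mu]_(y in `]F a, F b[) `|(EFin \o G) y|)%E =
   (\int[mu]_(y in `]F a, F b[) (`|G y|)%:E)%E by [].
rewrite (@ge0_integral_subst_oo _ F F' (fun y => `|G y|) a b)//.
  apply: eq_integral => x; rewrite inE/= in_itv/= => xab.
  by rewrite normrM (gtr0_norm (F'0 xab)).
by move=> y /cG cy; apply: (@continuous_comp R R R G (fun u : R => `|u|)) => //; exact: norm_continuous.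
Qed.

End Substitution.

Lemma integrable_reflect (f : R -> \bar R) :
  mu.-integrable setT f -> mu.-integrable setT (fun x => f (- x)).
Proof.
move=> /integrableP[mf fin]; apply/integrableP; split.
  by apply: measurableT_comp => //; exact: oppr_measurable.
rewrite (_ : (\int[mu]_x _)%E = (\int[mu]_x `|f x|)%E)//.
have mopp : measurable_fun [set: R] (-%R : R -> R) by exact: oppr_measurable.
have mnf : measurable_fun [set: R] (fun x => `|f x|)%E by exact: measurableT_comp.
have h := @ge0_integral_pushforward _ _ (measurableTypeR R) (measurableTypeR R) R
  (-%R : R -> measurableTypeR R) mopp mu setT (fun x => `|f x|)%E measurableT mnf.
rewrite preimage_setT in h; rewrite -h//.
by apply: eq_measure_integral => //= A mA _; exact: lebesgue_measureN.
Qed.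

(** The support consists of two symmetric intervals; [u] is the sum of its restriction to the right
    one and the reflection of a function supported there. *)
Lemma integral_fold (u : R -> R) (a b : R) : 0 <= a -> a < b ->
  (forall z, ~~ (a < `|z| < b) -> u z = 0) ->
  mu.-integrable `]a, b[ (EFin \o u) ->
  mu.-integrable `]a, b[ (fun z => (u (- z))%:E) ->
  mu.-integrable setT (EFin \o u) /\
  (\int[mu]_z (u z)%:E = \int[mu]_(z in `]a, b[) (u z + u (- z))%:E)%E.
Proof.
move=> a0 ab u0 iu iv.
have mI : measurable (`]a, b[%classic : set R) by exact: measurable_itv.
pose f : R -> \bar R := (EFin \o u) \_ `]a, b[.
pose g : R -> \bar R := (fun z => (u (- z))%:E) \_ `]a, b[.
have fi : mu.-integrable setT f by apply/integrable_restrict => //; rewrite setTI.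
have gi : mu.-integrable setT g by apply/integrable_restrict => //; rewrite setTI.
have gi' := integrable_reflect gi.
have E : EFin \o u = (fun z => (f z + g (- z)%R)%E).
  apply/funext => z; rewrite /f /g !patchE /=.
  have mem (w : R) : (w \in `]a, b[%classic) = (a < w < b) by rewrite mem_setE in_itv.
  rewrite !mem opprK; have [z0|z0] := lerP 0 z.
    have -> : (a < - z < b) = false by apply/negP => /andP[h1 h2]; lra.
    rewrite adde0; case: ifPn => // h; rewrite u0//.
    by rewrite ger0_norm.
  have -> : (a < z < b) = false by apply/negP => /andP[h1 h2]; lra.
  rewrite add0e; case: ifPn => // h; rewrite u0//.
  by rewrite ltr0_norm.
have iu' : mu.-integrable setT (EFin \o u) by rewrite E; exact: integrableD.
split=> //.
rewrite (_ : (fun z => (u z)%:E) = EFin \o u)// E integralD//.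
rewrite integral_reflect//; last exact: (measurable_int mu gi).
by rewrite -!integral_mkcond -integralD.
Qed.

End SignedChangeOfVariable.

(** * The kernel *)

Section KernelDensity.
Variable R : realType.
Local Notation mu := (@lebesgue_measure R).
Implicit Types x y z : R.

Lemma powR_expR (u p : R) : expR u `^ p = expR (p * u).
Proof. by rewrite /powR gt_eqF ?expR_gt0// expRK. Qed.

Lemma coshB_prod (u v : R) : sinh (u + v) * sinh (u - v) = (cosh (2 * u) - cosh (2 * v)) / 2.
Proof.
rewrite (_ : 2 * u = (u + v) + (u - v)); last by ring.
rewrite (_ : 2 * v = (u + v) - (u - v)); last by ring.
by move: (u + v) (u - v) => p r; rewrite !coshD sinhN coshN; field.
Qed.

Lemma expRM_sinh (u v : R) : expR (u - v) * sinh (u + v) = (expR (2 * u) - expR (- (2 * v))) / 2.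
Proof.
rewrite /sinh mulrA; congr (_ / 2); rewrite mulrBr -!expRD.
by congr (expR _ - expR _); ring.
Qed.

Lemma sinh_neq0 x : x != 0 -> sinh x != 0.
Proof.
move=> X0; have [XN|XP|/eqP] := ltgtP x 0; last by rewrite (negbTE X0).
  by rewrite -oppr_eq0 -sinhN gt_eqF// sinh_gt0// oppr_gt0.
by rewrite gt_eqF// sinh_gt0.
Qed.

Lemma sinh_norm x : sinh `|x| = `|sinh x|.
Proof.
have [x0|x0] := lerP 0 x.
  rewrite ger0_norm//; move: x0; rewrite le_eqVlt => /predU1P[<-|/sinh_gt0 h].
    by rewrite sinh0 normr0.
  by rewrite (gtr0_norm h).
have h : 0 < sinh (- x) by apply: sinh_gt0; rewrite oppr_gt0.
by rewrite (ltr0_norm x0) -normrN -sinhN gtr0_norm.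
Qed.

Variables (alpha x y : R).
Hypothesis x0 : x != 0.
Hypothesis y0 : y != 0.
Local Notation X := (2 * x).
Local Notation Y := (2 * y).
Local Notation q := (alpha - 2^-1).
Local Notation lo := `| `|x| - `|y| |.
Local Notation hi := (`|x| + `|y|).

Definition law_scale : R := `|sinh X * sinh Y|.
(** Up to [law_sign], the parameter [s] with [cosh_law X Y s = cosh (2 * z)]. The absolute value in
    [law_scale] makes it increase from -1 to 1 between [lo] and [hi] for all signs of [x] and
    [y]. *)
Definition law_var z : R := (cosh (2 * z) - cosh X * cosh Y) / law_scale.
Definition law_sign : R := Num.sg (sinh X * sinh Y).
(* The density of the measure, up to an even factor in z. *)
Definition density_ratio z : R :=
  (cosh (2 * z) - cosh (X - Y)) / (sinh X * sinh Y) *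
  ((expR (X + Y) - expR (- (2 * z))) / sinh (2 * z)).

Let X0 : X != 0. Proof. by rewrite mulf_neq0. Qed.
Let Y0 : Y != 0. Proof. by rewrite mulf_neq0. Qed.

Lemma law_prod_neq0 : sinh X * sinh Y != 0.
Proof. by rewrite mulf_neq0 ?sinh_neq0. Qed.

Lemma law_scale_gt0 : 0 < law_scale.
Proof. by rewrite normr_gt0 law_prod_neq0. Qed.

Lemma law_signM : sinh X * sinh Y = law_sign * law_scale.
Proof. by rewrite /law_sign /law_scale -numEsg. Qed.

Lemma law_sign_sqr : law_sign ^+ 2 = 1.
Proof. by rewrite /law_sign sqr_sg law_prod_neq0. Qed.

Lemma law_signP : law_sign = 1 \/ law_sign = -1.
Proof.
rewrite /law_sign; have := law_prod_neq0.
by case: (sgrP (sinh X * sinh Y)) => //; [left|right].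
Qed.

Lemma cosh_lawK z : cosh_law X Y (law_sign * law_var z) = cosh (2 * z).
Proof.
rewrite /cosh_law law_signM /law_var.
transitivity (cosh X * cosh Y + law_sign ^+ 2 * (cosh (2 * z) - cosh X * cosh Y)).
  by field; rewrite gt_eqF// law_scale_gt0.
by rewrite law_sign_sqr; ring.
Qed.

Lemma cosh_double_norm x' : cosh (2 * `|x'|) = cosh (2 * x').
Proof. by rewrite -(cosh_norm (2 * x')) normrM (ger0_norm (_ : 0 <= 2)). Qed.

Lemma sinh_double_norm x' : sinh (2 * `|x'|) = `|sinh (2 * x')|.
Proof. by rewrite -sinh_norm normrM (ger0_norm (_ : 0 <= 2)). Qed.

Lemma law_scaleE : law_scale = sinh (2 * `|x|) * sinh (2 * `|y|).
Proof. by rewrite /law_scale normrM !sinh_double_norm. Qed.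

Lemma law_var_lo : law_var lo = -1.
Proof.
rewrite /law_var cosh_double_norm mulrBr coshD coshN sinhN mulrN -law_scaleE !cosh_double_norm.
by field; rewrite gt_eqF// law_scale_gt0.
Qed.

Lemma law_var_hi : law_var hi = 1.
Proof.
rewrite /law_var mulrDr coshD -law_scaleE !cosh_double_norm.
by field; rewrite gt_eqF// law_scale_gt0.
Qed.

Lemma lo_lt_hi : lo < hi.
Proof.
have h1 : 0 < `|x| by rewrite normr_gt0.
have h2 : 0 < `|y| by rewrite normr_gt0.
by rewrite ltr_norml; apply/andP; split; lra.
Qed.

Lemma is_derive_law_var z : is_derive z (1 : R) law_var (2 * sinh (2 * z) / law_scale).
Proof.
have h := @is_derive_comp1 _ (@cosh R) (fun z => 2 * z) z _ _ (is_derive_cosh _) (is_derive_scale 2 z).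
have := is_deriveZ law_scale^-1 (is_deriveB h (is_derive_cst (cosh X * cosh Y) z (1 : R))).
apply: is_derive_ext.
  by apply/funext => t; rewrite /law_var [RHS]mulrC.
by rewrite /GRing.scale/= subr0; ring.
Qed.

Lemma law_var_bounds z : lo < z < hi -> -1 < law_var z < 1.
Proof.
move=> /andP[h1 h2]; rewrite -law_var_lo -law_var_hi.
have l0 : 0 <= lo by [].
have i0 : 0 < law_scale^-1 by rewrite invr_gt0 law_scale_gt0.
rewrite /law_var !ltr_pM2r// !ltrD2r; apply/andP; split; apply: cosh_lt; lra.
Qed.

(** The product of the four sinh factors is [law_scale^2 (1 - law_var^2) / 4], the source of the
    weight. The exponential and the three sinh factors give the numerators of [density_ratio], and
    the remaining powers collapse to half the derivative of [law_var] at [|z|]. *)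
Lemma opdam_densityE z : lo < `|z| < hi ->
  opdam_density alpha x y z = opdam_const alpha * jweight q (law_var `|z|) *
    (sinh (2 * `|z|) / law_scale) * density_ratio z.
Proof.
move=> zI; have /andP[z1 z2] := zI.
have z0 : z != 0.
  by apply: contraTneq z1 => ->; rewrite normr0 -leNgt.
have az0 : 0 < `|z| by rewrite normr_gt0.
have [v1 v2] := andP (law_var_bounds zI).
have w0 : 0 < 1 - law_var `|z| ^+ 2 by nra.
have k0 : 0 < sinh (2 * `|z|) by apply: sinh_gt0; lra.
have D0 := law_scale_gt0.
rewrite /opdam_density /opdam_kernel x0 y0 z0 z1 z2 /= /opdam_weight.
have S4 : sinh (x + y + z) * sinh (- x + y + z) * sinh (x - y + z) * sinh (x + y - z) =
    law_scale ^+ 2 * (1 - law_var `|z| ^+ 2) / 4.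
  have -> : sinh (x + y + z) * sinh (- x + y + z) * sinh (x - y + z) * sinh (x + y - z) =
    (sinh ((x + y) + z) * sinh ((x + y) - z)) * (sinh (z + (x - y)) * sinh (z - (x - y))).
    have -> : - x + y + z = z - (x - y) by ring.
    have -> : x - y + z = z + (x - y) by ring.
    by ring.
  rewrite !coshB_prod (mulrDr 2 x y) (mulrBr 2 x y) !coshD sinhN coshN mulrN law_signM.
  rewrite /law_var cosh_double_norm.
  transitivity ((law_sign ^+ 2 * law_scale ^+ 2 - (cosh (2 * z) - cosh X * cosh Y) ^+ 2) / 4).
    by field.
  by rewrite law_sign_sqr; field; rewrite gt_eqF.
have S3 : expR (x + y - z) * (sinh (x + y + z) * sinh (- x + y + z) * sinh (x - y + z)) =
    (expR (X + Y) - expR (- (2 * z))) * (cosh (2 * z) - cosh (X - Y)) / 4.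
  transitivity ((expR (x + y - z) * sinh (x + y + z)) *
     (sinh (z + (x - y)) * sinh (z - (x - y)))).
    have -> : - x + y + z = z - (x - y) by ring.
    have -> : x - y + z = z + (x - y) by ring.
    by ring.
  by rewrite expRM_sinh coshB_prod (mulrDr 2 x y) (mulrBr 2 x y); field.
have W : sinh `|z| * cosh `|z| = sinh (2 * `|z|) / 2.
  have -> : 2 * `|z| = `|z| + `|z| by ring.
  by rewrite sinhD; field.
have N : `|sinh (2 * x) * sinh (2 * y) * sinh (2 * z)| = law_scale * sinh (2 * `|z|).
  by rewrite normrM -/law_scale sinh_double_norm.
have powers : 2 `^ (4 * alpha + 2) *
   ((law_scale ^+ 2 * (1 - law_var `|z| ^+ 2) / 4) `^ q /
    (law_scale * sinh (2 * `|z|)) `^ (2 * alpha)) *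
   (sinh (2 * `|z|) / 2) `^ (2 * alpha + 1) =
   4 * jweight q (law_var `|z|) * (sinh (2 * `|z|) / law_scale).
  rewrite /jweight.
  (* All bases are positive; once they are written as exponentials, only a linear identity between
     exponents remains. *)
  have e2 : 2 = expR (ln 2) :> R by rewrite lnK// posrE.
  have e4 : 4 = expR (2 * ln 2) :> R.
    rewrite (_ : 2 * ln 2 = ln 2 + ln 2 :> R); last by ring.
    by rewrite expRD -e2; ring.
  have [d ed] : exists d, law_scale = expR d by exists (ln law_scale); rewrite lnK.
  have [k ek] : exists k, sinh (2 * `|z|) = expR k by exists (ln (sinh (2 * `|z|))); rewrite lnK.
  have [u eu] : exists u, 1 - law_var `|z| ^+ 2 = expR u by exists (ln (1 - law_var `|z| ^+ 2)); rewrite lnK.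
  have P2 w : 2 `^ w = expR (w * ln 2) :> R by rewrite -powR_expR -e2.
  have K2 w : w / 2 = w * expR (- ln 2) :> R by rewrite expRN -e2.
  have K4 w : w / 4 = w * expR (- (2 * ln 2)) :> R by rewrite expRN -e4.
  rewrite eu ek ed K2 K4 P2 [X in _ = X * _ * _]e4.
  rewrite expr2 -!expRD !powR_expR -!expRN -!expRD.
  by congr expR; field.
rewrite S4 N W.
transitivity (opdam_const alpha * (2 `^ (4 * alpha + 2) *
   ((law_scale ^+ 2 * (1 - law_var `|z| ^+ 2) / 4) `^ q /
    (law_scale * sinh (2 * `|z|)) `^ (2 * alpha)) *
   (sinh (2 * `|z|) / 2) `^ (2 * alpha + 1)) *
  ((expR (x + y - z) * (sinh (x + y + z) * sinh (- x + y + z) * sinh (x - y + z))) /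
  (sinh (2 * x) * sinh (2 * y) * sinh (2 * z)))).
  by move: (_ `^ (4 * alpha + 2)) (_ `^ q) (_ `^ (2 * alpha)) (_ `^ (2 * alpha + 1)) => A1 A2 A3 A4; ring.
rewrite powers S3 /density_ratio.
have sz : sinh (2 * z) != 0 by apply: sinh_neq0; rewrite mulf_neq0.
have sx := sinh_neq0 X0; have sy := sinh_neq0 Y0.
by field; rewrite sz sx sy gt_eqF.
Qed.

End KernelDensity.

(** * Integration against the density *)

Section KernelIntegral.
Variable R : realType.
Local Notation mu := (@lebesgue_measure R).
Local Notation B := (`](-1)%R, 1%R[%classic : set R).
Implicit Types z : R.

Variables (alpha x y : R).
Hypothesis halpha : - 2^-1 < alpha.
Hypothesis x0 : x != 0.
Hypothesis y0 : y != 0.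
Local Notation X := (2 * x).
Local Notation Y := (2 * y).
Local Notation q := (alpha - 2^-1).
Local Notation lo := `| `|x| - `|y| |.
Local Notation hi := (`|x| + `|y|).

Let sX : sinh X != 0. Proof. by rewrite sinh_neq0// mulf_neq0. Qed.
Let sY : sinh Y != 0. Proof. by rewrite sinh_neq0// mulf_neq0. Qed.

Lemma density_ratioE z : density_ratio x y z =
  (1 + law_sign x y * law_var x y z) * ((expR (X + Y) - expR (- (2 * z))) / sinh (2 * z)).
Proof.
rewrite /density_ratio -(cosh_lawK x0 y0) /cosh_law coshD sinhN coshN.
by congr (_ * _); field; rewrite sX sY.
Qed.

Lemma law_sign_cases : law_sign x y = 1 /\ `|x - y| = lo \/ law_sign x y = -1 /\ `|x + y| = lo.
Proof.
have P (t : R) : 0 < t -> 0 < sinh (2 * t) by move=> t0; apply: sinh_gt0; lra.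
have N (t : R) : t < 0 -> sinh (2 * t) < 0.
  by move=> t0; rewrite -oppr_gt0 -sinhN -mulrN; apply: P; rewrite oppr_gt0.
rewrite /law_sign sgrM.
have [hx|hx|hx] := ltgtP x 0; last by move: x0; rewrite hx eqxx.
  have [hy|hy|hy] := ltgtP y 0; last by move: y0; rewrite hy eqxx.
    left; rewrite !ltr0_sg ?N//; split; first by ring.
    by rewrite (ltr0_norm hx) (ltr0_norm hy) -normrN; congr `|_|; ring.
  right; rewrite ltr0_sg ?N// gtr0_sg ?P//; split; first by ring.
  by rewrite (ltr0_norm hx) (gtr0_norm hy) -normrN; congr `|_|; ring.
have [hy|hy|hy] := ltgtP y 0; last by move: y0; rewrite hy eqxx.
  right; rewrite gtr0_sg ?P// ltr0_sg ?N//; split; first by ring.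
  by rewrite (gtr0_norm hx) (ltr0_norm hy); congr `|_|; ring.
left; rewrite !gtr0_sg ?P//; split; first by ring.
by rewrite (gtr0_norm hx) (gtr0_norm hy).
Qed.

(** The pole of [1 / sinh (2 * z)] at 0 matters when [|x| = |y|], and is compensated differently in
    the two cases. For equal signs, [cosh (2 * z) - cosh (X - Y)] is at most
    [cosh (2 * z) - 1 <= sinh (2 * |z|)]. For opposite signs, [|x + y| < |z|] bounds the difference
    of exponentials by [2 * sinh (2 * |z|)]. *)
Lemma density_ratio_bounded : exists M, forall z, lo < `|z| < hi -> `|density_ratio x y z| <= M.
Proof.
have D0 := law_scale_gt0 x0 y0.
case: law_sign_cases => [[_ E]|[E1 E]].
- exists ((expR (X + Y) + expR (2 * hi)) / law_scale x y) => z /andP[z1 z2].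
  have lo0 : 0 <= lo by [].
  have k0 : 0 < sinh (2 * `|z|) by apply: sinh_gt0; lra.
  have eN : cosh (X - Y) = cosh (2 * lo).
    by rewrite -E cosh_double_norm mulrBr.
  have N0 : 0 <= cosh (2 * z) - cosh (X - Y).
    by rewrite eN subr_ge0 -(cosh_double_norm z); apply: cosh_le; rewrite ?mulr_ge0// ler_pM2l// ltW.
  have N1 : cosh (2 * z) - cosh (X - Y) <= sinh (2 * `|z|).
    have h1 := cosh_ge1 (X - Y).
    have h2 : cosh (2 * z) = sinh (2 * `|z|) + expR (- (2 * `|z|)).
      by rewrite -coshDsinh coshN sinhN cosh_double_norm; ring.
    have h3 : expR (- (2 * `|z|)) <= 1 by rewrite expR_le1 oppr_le0 mulr_ge0.
    lra.
  have E0 : `|expR (X + Y) - expR (- (2 * z))| <= expR (X + Y) + expR (2 * hi).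
    have h1 := expR_gt0 (X + Y); have h2 := expR_gt0 (- (2 * z)).
    have h3 : expR (- (2 * z)) <= expR (2 * hi).
      have h4 := ler_norm (- z); rewrite normrN in h4.
      by rewrite ler_expR; lra.
    by rewrite ler_norml; apply/andP; split; lra.
  rewrite /density_ratio !normrM !normfV -/(law_scale x y) -sinh_double_norm (ger0_norm N0).
  have := normr_ge0 (expR (X + Y) - expR (- (2 * z))).
  move: (cosh (2 * z) - _) `|expR _ - _| (sinh _) (_ + expR _) (law_scale x y) N0 N1 k0 E0 D0
    => n e k C D n0 n1 k0 e1 D0 e0.
  have h : n / k <= 1 by rewrite ler_pdivrMr ?mul1r.
  have i0 : 0 <= n / k by rewrite divr_ge0// ltW.
  rewrite [leLHS](_ : _ = (n / k) * (e / D)); last by field; rewrite !gt_eqF.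
  have j0 : 0 <= e / D by rewrite divr_ge0// ltW.
  have j1 : e / D <= C / D by rewrite ler_pM2r ?invr_gt0.
  by nra.
- exists 4 => z zI; have /andP[z1 z2] := zI.
  have lo0 : 0 <= lo by [].
  have k0 : 0 < sinh (2 * `|z|) by apply: sinh_gt0; lra.
  have v1 : `|1 + law_sign x y * law_var x y z| <= 2.
    have -> : law_var x y z = law_var x y `|z| by rewrite /law_var cosh_double_norm.
    have /andP[h1 h2] := law_var_bounds x0 y0 zI.
    by rewrite E1 ler_norml; apply/andP; split; lra.
  have e1 : `|expR (X + Y) - expR (- (2 * z))| <= 2 * sinh (2 * `|z|).
    have -> : 2 * sinh (2 * `|z|) = expR (2 * `|z|) - expR (- (2 * `|z|)) by rewrite /sinh; field.
    have xyz : `|x + y| < `|z| by rewrite E.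
    have in_range t : `|t| <= `|z| -> expR (- (2 * `|z|)) <= expR (2 * t) <= expR (2 * `|z|).
      by rewrite ler_norml => /andP[h1 h2]; rewrite !ler_expR; apply/andP; split; lra.
    have /andP[h1 h2] := in_range _ (ltW xyz).
    have /andP[h3 h4] : expR (- (2 * `|z|)) <= expR (2 * - z) <= expR (2 * `|z|).
      by apply: in_range; rewrite normrN.
    rewrite -(mulrDr 2 x y) -mulrN ler_norml; apply/andP; split; lra.
  rewrite density_ratioE normrM normrM normfV -sinh_double_norm.
  have h : `|expR (X + Y) - expR (- (2 * z))| / sinh (2 * `|z|) <= 2.
    by rewrite ler_pdivrMr.
  rewrite (_ : 4 = 2 * 2 :> R); last by ring.
  by apply: ler_pM => //; rewrite divr_ge0// ltW.
Qed.

Lemma law_var_continuous z : {for z, continuous (law_var x y)}.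
Proof. exact: is_derive_continuous (is_derive_law_var x y z). Qed.

Lemma continuous_double (f : R -> R) z :
  {for 2 * z, continuous f} -> {for z, continuous (fun z => f (2 * z))}.
Proof.
move=> cf; apply: (@continuous_comp R R R (fun z => 2 * z) f) => //.
exact: is_derive_continuous (is_derive_scale 2 z).
Qed.

Lemma density_ratio_continuous z : z != 0 -> {for z, continuous (density_ratio x y)}.
Proof.
move=> z0.
have cs : {for z, continuous (fun z => sinh (2 * z))}.
  by apply: continuous_double; exact: is_derive_continuous (is_derive_sinh _).
have cc : {for z, continuous (fun z => cosh (2 * z))}.
  by apply: continuous_double; exact: is_derive_continuous (is_derive_cosh _).
have ce : {for z, continuous (fun z => expR (- (2 * z)))}.
  apply: (@continuous_double (fun z => expR (- z))).
  exact: is_derive_continuous (is_derive_expRN _).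
apply: cvgM.
  by apply: cvgM; [apply: cvgB => //; exact: cvg_cst|exact: cvg_cst].
apply: cvgM; first by apply: cvgB => //; exact: cvg_cst.
by apply: cvgV => //; rewrite sinh_neq0// mulf_neq0.
Qed.

Lemma continuous_opp_comp (f : R -> R) z :
  {for - z, continuous f} -> {for z, continuous (fun z => f (- z))}.
Proof. by move=> cf; apply: (@continuous_comp R R R -%R f) => //; exact: oppr_continuous. Qed.

Lemma jweight_continuous s : -1 < s < 1 -> {for s, continuous (jweight q)}.
Proof.
move=> /andP[s1 s2].
have w0 : 0 < 1 - s ^+ 2 by nra.
apply: (@continuous_comp R R R (fun s => 1 - s ^+ 2) (fun t => t `^ q)); last exact: continuous_powR.
by apply: cvgB; [exact: cvg_cst|exact: exprn_continuous].
Qed.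

Lemma opdam_density_out z : ~~ (lo < `|z| < hi) -> opdam_density alpha x y z = 0.
Proof.
move=> zI; rewrite /opdam_density /opdam_kernel x0 y0 /= (negbTE zI) andbF.
exact: mul0r.
Qed.

Section Fold.
(** [phi] stands for the real or imaginary part of the Opdam function, and [g] for the same part of
    the folded integrand. *)
Variables phi g : R -> R.
Hypothesis cphi : forall z, {for z, continuous phi}.
Hypothesis cg : forall s : R, -1 <= s <= 1 -> {for s, continuous g}.
Hypothesis foldE : forall z, lo < z < hi ->
  density_ratio x y z * phi z + density_ratio x y (- z) * phi (- z) = 2 * g (law_var x y z).

Lemma density_integral :
  mu.-integrable setT (fun z => (phi z * opdam_density alpha x y z)%:E) /\
  \int[mu]_(z in setT) (phi z * opdam_density alpha x y z) =
    opdam_const alpha * \int[mu]_(s in B) (g s * jweight q s).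
Proof.
have q1 : -1 < q by have := halpha; lra.
pose F' z := 2 * sinh (2 * z) / law_scale x y.
have D0 := law_scale_gt0 x0 y0.
have lo0 : 0 <= lo by [].
have mI : measurable (`]lo, hi[%classic : set R) by exact: measurable_itv.
have cF' z : lo < z < hi -> {for z, continuous F'}.
  move=> _; apply: cvgM; last exact: cvg_cst.
  apply: cvgM; first exact: cvg_cst.
  by apply: continuous_double; exact: is_derive_continuous (is_derive_sinh _).
have F'0 z : lo < z < hi -> 0 < F' z.
  by move=> zI; rewrite divr_gt0// mulr_gt0//; apply: sinh_gt0; lra.
have dF z : lo <= z <= hi -> is_derive z (1 : R) (law_var x y) (F' z).
  by move=> _; exact: is_derive_law_var.
(* Pullback of the weight under [law_var]. It is integrable by substitution, and each integrand
   below is [w] times a bounded continuous function. *)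
pose w z := jweight q (law_var x y z) * F' z.
have iw : mu.-integrable `]lo, hi[ (EFin \o w).
  have h := integrable_subst_oo (lo_lt_hi x0 y0) dF cF' F'0.
  apply: h; rewrite law_var_lo// law_var_hi//; last exact: integrable_jweight.
  by move=> s; exact: jweight_continuous.
have cw z : lo < z < hi -> {for z, continuous w}.
  move=> zI; apply: cvgM; last exact: cF'.
  apply: (@continuous_comp R R R (law_var x y) (jweight q)); first exact: law_var_continuous.
  by apply: jweight_continuous; exact: law_var_bounds.
have dom (h : R -> R) C : (forall z, lo < z < hi -> {for z, continuous h}) ->
    (forall z, lo < z < hi -> `|h z| <= C) ->
    mu.-integrable `]lo, hi[ (fun z => (w z * h z)%:E).
  move=> ch hC.
  apply: (@le_integrable _ _ R mu _ _ _ (fun z => (C%:E * (EFin \o w) z)%E)) => //.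
  - apply/measurable_EFinP; apply: continuous_itv_measurable => z zI.
    by apply: cvgM; [exact: cw|exact: ch].
  - move=> z /=; rewrite in_itv/= => zI.
    rewrite lee_fin !normrM mulrC; apply: ler_wpM2r => //.
    by rewrite (le_trans (hC _ zI))// ler_norm.
  - by apply: integrableZl.
pose M := opdam_const alpha.
pose u z := phi z * opdam_density alpha x y z.
(* [F'] is twice the factor in [opdam_densityE], hence [M / 2]; the factor 2 in [foldE] restores
   [M]. *)
have uE z t : lo < z < hi -> `|t| = z ->
    u t = w z * (M / 2 * (density_ratio x y t * phi t)).
  move=> zI tz; have tI : lo < `|t| < hi by rewrite tz.
  rewrite /u (opdam_densityE alpha x0 y0 tI) tz /w /F' -/M.
  by field; rewrite gt_eqF.
have z_pos z : lo < z < hi -> 0 < z by move=> /andP[]; lra.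
have [C hC] := density_ratio_bounded.
have [K K0 hK] : exists2 K, 0 <= K & forall z, - hi <= z <= hi -> `|phi z| <= K.
  by apply: segment_bounded => z _; exact: cphi.
have bound t : lo < `|t| < hi -> `|M / 2 * (density_ratio x y t * phi t)| <= `|M / 2| * (C * K).
  move=> tI; rewrite normrM; apply: ler_wpM2l => //.
  rewrite normrM; apply: ler_pM => //; first exact: hC.
  by apply: hK; rewrite -ler_norml; case/andP: tI => _ /ltW.
have cr t : t != 0 -> {for t, continuous (fun t => M / 2 * (density_ratio x y t * phi t))}.
  move=> t0; apply: cvgM; first exact: cvg_cst.
  by apply: cvgM; [exact: density_ratio_continuous|exact: cphi].
have i1 : mu.-integrable `]lo, hi[ (EFin \o u).
  apply: (@eq_integrable _ _ R mu _ _ (fun z => (w z * (M / 2 * (density_ratio x y z * phi z)))%:E)) => //.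
    move=> z; rewrite inE/= in_itv/= => zI; congr (_%:E); rewrite -uE//.
    by rewrite (gtr0_norm (z_pos z zI)).
  apply: (dom _ (`|M / 2| * (C * K))) => z zI.
    by apply: cr; rewrite gt_eqF// z_pos.
  by apply: bound; rewrite (gtr0_norm (z_pos z zI)).
have i2 : mu.-integrable `]lo, hi[ (fun z => (u (- z))%:E).
  apply: (@eq_integrable _ _ R mu _ _ (fun z => (w z * (M / 2 * (density_ratio x y (- z) * phi (- z))))%:E)) => //.
    move=> z; rewrite inE/= in_itv/= => zI; congr (_%:E); rewrite -uE//.
    by rewrite normrN (gtr0_norm (z_pos z zI)).
  apply: (dom (fun z => M / 2 * (density_ratio x y (- z) * phi (- z))) (`|M / 2| * (C * K))) => z zI.
    apply: (@continuous_opp_comp (fun t => M / 2 * (density_ratio x y t * phi t))).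
    by apply: cr; rewrite oppr_eq0 gt_eqF// z_pos.
  by apply: bound; rewrite normrN (gtr0_norm (z_pos z zI)).
have out z : ~~ (lo < `|z| < hi) -> u z = 0.
  by move=> zI; rewrite /u opdam_density_out// mulr0.
have [iu E] := integral_fold lo0 (lo_lt_hi x0 y0) out i1 i2.
split=> //.
rewrite /Rintegral E.
have -> : (\int[mu]_(z in `]lo, hi[) (u z + u (- z))%:E =
  \int[mu]_(z in `]lo, hi[) (M * (g (law_var x y z) * jweight q (law_var x y z)) * F' z)%:E)%E.
  apply: eq_integral => z; rewrite inE/= in_itv/= => zI; congr (_%:E).
  rewrite (uE z z)//; last by rewrite (gtr0_norm (z_pos z zI)).
  rewrite (uE z (- z))//; last by rewrite normrN (gtr0_norm (z_pos z zI)).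
  rewrite -mulrDr -mulrDr foldE// /w; by field.
have cG s : -1 < s < 1 -> {for s, continuous (fun s => M * (g s * jweight q s))}.
  move=> hs; apply: cvgM; first exact: cvg_cst.
  apply: cvgM; last exact: jweight_continuous.
  by apply: cg; lra.
have := @integral_subst_oo R _ _ (fun s => M * (g s * jweight q s)) _ _ (lo_lt_hi x0 y0) dF cF' F'0.
rewrite law_var_lo// law_var_hi// => /(_ cG) <-.
have mB : measurable B by exact: measurable_itv.
have iB := cts_jweight_integrable q1 cg.
by rewrite -RintegralZl.
Qed.

End Fold.
End KernelIntegral.

(** * The product formula for the Opdam function *)

Section OpdamProductFormula.
Variable R : realType.
Local Notation mu := (@lebesgue_measure R).
Variables (alpha : R) (lambda : R[i]).
Hypothesis halpha : - 2^-1 < alpha.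
Local Notation c := (alpha + 1).
Local Notation q := (alpha - 2^-1).

Let a : R[i] := ((2 * alpha + 1)%:C + 'i * lambda) / 2.
Let b : R[i] := ((2 * alpha + 1)%:C - 'i * lambda) / 2.

Let two : (2%:C : R[i]) = 2. Proof. exact: rmorph_nat. Qed.

Let abc : a + b + 1 = (2 * c)%:C.
Proof.
have -> : 2 * c = (2 * alpha + 1) + 1 by ring.
rewrite /a /b; move: (2 * alpha + 1) ('i * lambda) => t v.
have -> : (t + 1)%:C = t%:C + 1 :> R[i] by rewrite rmorphD rmorph1.
by field.
Qed.

Let c2 : 2^-1 <= c. Proof. by have := halpha; lra. Qed.
Let c21 : 2^-1 <= c + 1. Proof. by have := halpha; lra. Qed.

Lemma opdam_funE x : opdam_fun alpha lambda x = opdam_cosh a b alpha (2 * x).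
Proof.
have t0 : - sinh x ^+ 2 <= 0 by rewrite oppr_le0 sqr_ge0.
have half : (1 - cosh (2 * x)) / 2 = - sinh x ^+ 2.
  have -> : 2 * x = x + x by ring.
  by rewrite coshD; have := cosh2Bsinh2 x; lra.
have j0 : jacobi_fun alpha alpha lambda x = legendre_fun a b c (cosh (2 * x)).
  rewrite /legendre_fun half -(hyp2F1E c2 abc t0) /jacobi_fun.
  by rewrite (_ : alpha + alpha + 1 = 2 * alpha + 1)//; ring.
have j1 : jacobi_fun (alpha + 1) (alpha + 1) lambda x =
    legendre_fun (a + 1) (b + 1) (c + 1) (cosh (2 * x)).
  rewrite /legendre_fun half -(hyp2F1E c21 (abc_next abc) t0) /jacobi_fun.
  have -> : alpha + 1 + (alpha + 1) + 1 = (2 * alpha + 1) + 2 by ring.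
  rewrite /a /b; move: (2 * alpha + 1) ('i * lambda) => t v.
  have -> : (t + 2)%:C = t%:C + 2 :> R[i] by rewrite -two; exact: rmorphD.
  have -> : (t%:C + 2 + v) / 2 = (t%:C + v) / 2 + 1 by field.
  by have -> : (t%:C + 2 - v) / 2 = (t%:C - v) / 2 + 1 by field.
rewrite /opdam_fun j0 j1 /opdam_cosh; congr (_ + _); rewrite -mulrA; congr (_ * _).
have -> : 4 * c = 2 * (2 * c) by ring.
have c0 : (2 * c)%:C != 0 :> R[i] by apply: realC_neq0; have := halpha; lra.
rewrite /a [(2 * (2 * c))%:C](_ : _ = 2 * (2 * c)%:C); last by rewrite -two -rmorphM.
by move: (2 * c)%:C c0 (2 * alpha + 1) => C C0 A; field.
Qed.

(** Settles the cases where [x] or [y] vanishes and the measure is a Dirac mass. *)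
Lemma opdam_fun0 : opdam_fun alpha lambda 0 = 1.
Proof.
by rewrite opdam_funE /opdam_cosh mulr0 sinh0 cosh0 mul0r mulr0 addr0
  /legendre_fun subrr mul0r /hyp_fun ltxx gauss_csum0.
Qed.

Lemma cder_opdam_fun x : exists l, cder (opdam_fun alpha lambda) x l.
Proof.
have v1 : 1 <= cosh (2 * x) by exact: cosh_ge1.
have dc : is_derive x (1 : R) (fun x => cosh (2 * x)) (sinh (2 * x) * 2).
  exact: (@is_derive_comp1 _ (@cosh R) (fun z => 2 * z) x _ _ (is_derive_cosh _) (is_derive_scale 2 x)).
have ds : is_derive x (1 : R) (fun x => sinh (2 * x)) (cosh (2 * x) * 2).
  exact: (@is_derive_comp1 _ (@sinh R) (fun z => 2 * z) x _ _ (is_derive_sinh _) (is_derive_scale 2 x)).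
have d0 := @cder_comp _ _ (fun x => cosh (2 * x)) x _ _ (cder_legendre c2 abc v1) dc.
have d1 := @cder_comp _ _ (fun x => cosh (2 * x)) x _ _ (cder_legendre c21 (abc_next abc) v1) dc.
rewrite (_ : opdam_fun alpha lambda = fun x => opdam_cosh a b alpha (2 * x)); last first.
  by apply/funext => z; exact: opdam_funE.
by eexists; exact: cderD d0 (cderZ _ (cderM (cder_real ds) d1)).
Qed.

Lemma opdam_fun_measurable :
  measurable_fun [set: R] (fun z => complex.Re (opdam_fun alpha lambda z)) /\
  measurable_fun [set: R] (fun z => complex.Im (opdam_fun alpha lambda z)).
Proof.
by split; apply: continuous_measurable_fun => z; have [l /cder_continuous[]] := cder_opdam_fun z.
Qed.

Lemma opdam_dirac x :
  cintegrable (dirac (x : measurableTypeR R)) (opdam_fun alpha lambda) /\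
  cintegral (dirac (x : measurableTypeR R)) (opdam_fun alpha lambda) = opdam_fun alpha lambda x.
Proof.
have P (h : R -> R) : measurable_fun [set: R] h ->
    (dirac (x : measurableTypeR R)).-integrable setT (fun t => (h t)%:E) /\
    \int[dirac (x : measurableTypeR R)]_(t in setT) h t = h x.
  move=> mh; have mh' : measurable_fun [set: measurableTypeR R] (EFin \o h) by exact/measurable_EFinP.
  split; last by rewrite /Rintegral integral_dirac// diracT mul1e.
  apply/integrableP; split=> //.
  rewrite integral_dirac//; last exact: measurableT_comp.
  by rewrite diracT mul1e ltry.
have [mr mi] := opdam_fun_measurable.
have [ir er] := P _ mr; have [ii ei] := P _ mi.
split; first by split.
by rewrite /cintegral er ei; case: (opdam_fun alpha lambda x).
Qed.

Section Nonzero.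
Variables x y : R.
Hypothesis x0 : x != 0.
Hypothesis y0 : y != 0.
Local Notation sgn := (law_sign x y).

(** The even part of the Opdam function is multiplied by the sum of the ratios at [z] and [- z], the
    odd part by their difference. Since [expR (- (2 * z))] is [C - S], the sum loses its pole ([E1])
    and the factor [S] of the odd part removes the other one ([E2]). *)
Lemma opdam_fold_identity z : `| `|x| - `|y| | < z < `|x| + `|y| ->
  (density_ratio x y z)%:C * opdam_fun alpha lambda z +
  (density_ratio x y (- z))%:C * opdam_fun alpha lambda (- z) =
  2 * opdam_fold a b alpha (2 * x) (2 * y) (sgn * law_var x y z).
Proof.
move=> /andP[z1 _].
have z0 : 0 < z by rewrite (le_lt_trans _ z1).
have s0 : sinh (2 * z) != 0 by rewrite gt_eqF// sinh_gt0// mulr_gt0.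
have vN : law_var x y (- z) = law_var x y z by rewrite /law_var mulrN coshN.
rewrite !opdam_funE !density_ratioE// vN /opdam_cosh /opdam_fold (cosh_lawK x0 y0).
rewrite mulrN coshN sinhN opprK.
set P0 := legendre_fun _ _ _ _; set P1 := legendre_fun _ _ _ _; set k := _ / (2 * c)%:C.
set s := sgn * _; set e := expR (2 * x + _).
have eM : expR (- (2 * z)) = cosh (2 * z) - sinh (2 * z) by rewrite /cosh /sinh; field.
have eP : expR (2 * z) = cosh (2 * z) + sinh (2 * z) by rewrite coshDsinh.
rewrite eM eP; move: (cosh (2 * z)) (sinh (2 * z)) s0 => C S S0.
clearbody P0 P1 k s e.
have E1 : (1 + s) * ((e - (C - S)) / S) + (1 + s) * ((e - (C + S)) / - S) = (1 + s) * 2.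
  by field.
have E2 : ((1 + s) * ((e - (C - S)) / S)) * S + ((1 + s) * ((e - (C + S)) / - S)) * - S =
  (1 + s) * (e - C) * 2 by field.
move: ((1 + s) * ((e - (C - S)) / S)) ((1 + s) * ((e - (C + S)) / - S)) E1 E2 => r r' E1 E2.
transitivity ((r + r')%:C * P0 + k * P1 * (r * S + r' * - S)%:C).
  have -> : (r + r')%:C = r%:C + r'%:C :> R[i] by rewrite rmorphD.
  have -> : (r * S + r' * - S)%:C = r%:C * S%:C + r'%:C * (- S)%:C :> R[i].
    by rewrite -!rmorphM -rmorphD.
  by ring.
rewrite E1 E2.
have -> : ((1 + s) * 2)%:C = (1 + s)%:C * 2 :> R[i] by rewrite -two; exact: rmorphM.
have -> : ((1 + s) * (e - C) * 2)%:C = (1 + s)%:C * (e - C)%:C * 2 :> R[i].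
  by rewrite -two -!rmorphM.
by ring.
Qed.

Lemma opdam_mu_nonzero :
  cintegrable mu (fun z => opdam_fun alpha lambda z * (opdam_density alpha x y z)%:C) /\
  opdam_fun alpha lambda x * opdam_fun alpha lambda y =
  cintegral mu (fun z => opdam_fun alpha lambda z * (opdam_density alpha x y z)%:C).
Proof.
have q1 : -1 < q by have := halpha; lra.
(* The substitution produces the fold at [law_sign * s]; when the sign is -1, the reflection
   [s -> - s] removes it at the end. *)
pose h s := opdam_fold a b alpha (2 * x) (2 * y) (sgn * s).
have dh : cdiff_on h.
  move=> s hs; have hs' : -1 <= sgn * s <= 1.
    by case: (law_signP x0 y0) => ->; lra.
  have [l hl] := cdiff_opdam_fold halpha abc (2 * x) (2 * y) hs'.
  by eexists; exact: cder_comp hl (is_derive_scale sgn s).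
have ReE z : complex.Re (opdam_fun alpha lambda z * (opdam_density alpha x y z)%:C) =
    complex.Re (opdam_fun alpha lambda z) * opdam_density alpha x y z.
  by rewrite cReM/= mulr0 subr0.
have ImE z : complex.Im (opdam_fun alpha lambda z * (opdam_density alpha x y z)%:C) =
    complex.Im (opdam_fun alpha lambda z) * opdam_density alpha x y z.
  by rewrite cImM/= mulr0 add0r.
have real_mul (r : R) (w : R[i]) : complex.Re (r%:C * w) = r * complex.Re w /\
    complex.Im (r%:C * w) = r * complex.Im w.
  by rewrite cReM cImM/= !mul0r subr0 addr0.
have two_mul (w : R[i]) : 2 * w = 2%:C * w by rewrite two.
have [ir er] := @density_integral _ alpha x y halpha x0 y0
  (fun z => complex.Re (opdam_fun alpha lambda z)) (fun s => complex.Re (h s))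
  (fun z => let: ex_intro l hl := cder_opdam_fun z in (cder_continuous hl).1)
  (fun s hs => let: ex_intro l hl := dh s hs in (cder_continuous hl).1)
  (fun z zI => ltac:(by have := congr1 (@complex.Re R) (opdam_fold_identity zI);
     rewrite cReD two_mul !(real_mul _ _).1)).
have [ii ei] := @density_integral _ alpha x y halpha x0 y0
  (fun z => complex.Im (opdam_fun alpha lambda z)) (fun s => complex.Im (h s))
  (fun z => let: ex_intro l hl := cder_opdam_fun z in (cder_continuous hl).2)
  (fun s hs => let: ex_intro l hl := dh s hs in (cder_continuous hl).2)
  (fun z zI => ltac:(by have := congr1 (@complex.Im R) (opdam_fold_identity zI);
     rewrite cImD two_mul !(real_mul _ _).2)).
have ReF := funext ReE; have ImF := funext ImE.
split.
  split; [rewrite (_ : (fun t => _) = (fun z => (complex.Re (opdam_fun alpha lambda z) *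
    opdam_density alpha x y z)%:E))//|rewrite (_ : (fun t => _) = (fun z =>
    (complex.Im (opdam_fun alpha lambda z) * opdam_density alpha x y z)%:E))//].
  - by apply/funext => z; rewrite ReE.
  - by apply/funext => z; rewrite ImE.
have -> : cintegral mu (fun z => opdam_fun alpha lambda z * (opdam_density alpha x y z)%:C) =
    (opdam_const alpha)%:C * jint q h.
  rewrite /cintegral ReF ImF er ei; apply: complex_ext.
    by rewrite (real_mul _ _).1.
  by rewrite (real_mul _ _).2.
rewrite !opdam_funE (opdam_product halpha abc); congr (_ * _).
rewrite /h; case: (law_signP x0 y0) => ->.
  by apply: eq_jint => s _; rewrite mul1r.
rewrite -(jint_reflect q1 (cdiff_opdam_fold halpha abc _ _)).
by apply: eq_jint => s _; rewrite mulN1r.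
Qed.

End Nonzero.

End OpdamProductFormula.

Theorem theorem3p5 (R : realType) (alpha : R) (halpha : - 2^-1 < alpha)
    (x y : R) (lambda : R[i]) :
  opdam_mu_integrable alpha x y (opdam_fun alpha lambda) /\
  opdam_fun alpha lambda x * opdam_fun alpha lambda y =
    opdam_mu_integral alpha x y (opdam_fun alpha lambda).
Proof.
rewrite /opdam_mu_integrable /opdam_mu_integral; case: ifPn => [xy|].
  move: xy; rewrite mulf_eq0 negb_or => /andP[x0 y0].
  exact: (opdam_mu_nonzero lambda halpha x0 y0).
rewrite negbK mulf_eq0; case: ifPn => [/eqP -> _|y0]; last rewrite orbF => /eqP ->.
  by rewrite opdam_fun0// mulr1; have [i ->] := opdam_dirac lambda halpha x.
by rewrite opdam_fun0// mul1r; have [i ->] := opdam_dirac lambda halpha y.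
Qed.
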